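(* Let $u_\varepsilon$ be a sequence of solutions (along a sequence $\varepsilon\to0^+$) of $$\Delta u+\frac{1}{\varepsilon^2}\frac{e^u(1-e^u)}{(\tau+e^u)^3}=4\pi\sum_{j=1}^{d_1}m_{j,1}\delta_{p_{j,1}}-4\pi\sum_{j=1}^{d_2}m_{j,2}\delta_{p_{j,2}}\quad\text{on }\Omega .$$ Then, up to subsequences, one of the following holds true: (a) $u_\varepsilon\to0$ uniformly on any compact subset of $\Omega\setminus Z$; (b) for any compact subset $K\subset\Omega\setminus Z_2$ there exists $\nu_K>0$ such that $\limsup_{\varepsilon\to0}\big(\sup_K u_\varepsilon\big)\le-\nu_K$; (c) for any compact subset $K\subset\Omega\setminus Z_1$ there exists $\nu_K>0$ such that $\liminf_{\varepsilon\to0}\big(\inf_K u_\varepsilon\big)\ge\nu_K$.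
   Context: $\Omega$ is a flat 2-torus, $\tau\in(0,\infty)$ is fixed, $p_{j,i}$ ($1\le j\le d_i$, $i=1,2$) are pairwise distinct points of $\Omega$, $m_{j,i}\ge 0$ are real numbers, and $\delta_p$ is the Dirac measure at $p$. Set $Z_i=\{p_{j,i}:1\le j\le d_i\}$ for $i=1,2$ and $Z=Z_1\cup Z_2$. These data are independent of $\varepsilon$. Solutions are understood in the sense of distributions (smooth away from $Z$, with the logarithmic singularities dictated by the Dirac masses: when $m_{j,i}>0$, $u_\varepsilon\to-\infty$ at $p_{j,1}$ and $u_\varepsilon\to+\infty$ at $p_{j,2}$). *)

(* Defs.v *)
From HB Require Import structures.
From mathcomp Require Import all_boot all_order all_algebra.
From mathcomp Require Import all_classical all_reals all_analysis.

Set Implicit Arguments.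
Unset Strict Implicit.
Unset Printing Implicit Defensive.

Import Order.TTheory GRing.Theory Num.Theory.
Import numFieldNormedType.Exports.

Local Open Scope classical_set_scope.
Local Open Scope quotient_scope.
Local Open Scope ring_scope.

(* R * R carries the library's product topology (max norm); that norm is never
   used as a distance below, the Euclidean one enters only through [sqnorm]. *)

Definition lin_indep2 (R : realType) (a b : R * R) : Prop :=
  a.1 * b.2 - a.2 * b.1 != 0.

Definition lattice_rel (R : realType) (a b : R * R) : rel (R * R) :=
  fun x y => `[< exists m n : int, y = x + (a *~ m + b *~ n) >].

Lemma lattice_rel_refl (R : realType) (a b : R * R) :
  reflexive (lattice_rel a b).
Proof. by move=> x; apply/asboolP; exists 0, 0; rewrite !mulr0z !addr0. Qed.

Lemma lattice_rel_sym (R : realType) (a b : R * R) :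
  symmetric (lattice_rel a b).
Proof.
suff H x y : lattice_rel a b x y -> lattice_rel a b y x.
  by move=> x y; apply/idP/idP; exact: H.
move=> /asboolP[m [n ->]]; apply/asboolP; exists (- m), (- n).
by rewrite !mulrNz -opprD addrK.
Qed.

Lemma lattice_rel_trans (R : realType) (a b : R * R) :
  transitive (lattice_rel a b).
Proof.
move=> y x z /asboolP[m [n ->]] /asboolP[m' [n' ->]]; apply/asboolP.
by exists (m + m'), (n + n'); rewrite !mulrzDr -addrA addrACA.
Qed.

Canonical lattice_equiv (R : realType) (a b : R * R) :=
  EquivRel (lattice_rel a b) (@lattice_rel_refl R a b)
    (@lattice_rel_sym R a b) (@lattice_rel_trans R a b).

(* The torus R^2 / (Z a + Z b) with the quotient topology; it is a flat 2-torus
   when [lin_indep2 a b]. *)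
Definition torus (R : realType) (a b : R * R) :=
  quotient_topology {eq_quot (lattice_rel a b)}.

Definition torus_pi (R : realType) (a b : R * R) : R * R -> torus a b :=
  \pi_(torus a b).

(* Integral of a function on the torus, through its lift to the plane: Lebesgue
   measure on the half-open fundamental parallelogram. *)
Definition fund_domain (R : realType) (a b : R * R) : set (R * R) :=
  [set x | exists s t : R, [/\ 0 <= s < 1, 0 <= t < 1 & x = s *: a + t *: b]].

Definition lebesgue2 (R : realType) :=
  (@lebesgue_measure R \x @lebesgue_measure R)%E.

Definition partial1 (R : realType) (f : R * R -> R) : R * R -> R :=
  fun x => 'D_(1, 0) f x.

Definition partial2 (R : realType) (f : R * R -> R) : R * R -> R :=
  fun x => 'D_(0, 1) f x.

Definition laplacian (R : realType) (f : R * R -> R) : R * R -> R :=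
  fun x => partial1 (partial1 f) x + partial2 (partial2 f) x.

(* Meant for U open: f is C^k on U. *)
Fixpoint Ck_on (R : realType) (k : nat) (U : set (R * R)) (f : R * R -> R)
    : Prop :=
  (forall x, U x -> {for x, continuous f}) /\
  match k with
  | 0%N => True
  | k'.+1 =>
    [/\ forall x, U x -> derivable f x (1, 0),
        forall x, U x -> derivable f x (0, 1),
        Ck_on k' U (partial1 f)
      & Ck_on k' U (partial2 f)]
  end.

Definition smooth_on (R : realType) (U : set (R * R)) (f : R * R -> R) : Prop :=
  forall k, Ck_on k U f.

Definition sqnorm (R : realType) (x : R * R) : R := x.1 ^+ 2 + x.2 ^+ 2.

(* u - 2c log|x - p| has a finite limit at p. As (1 / 2 pi) log|x| is the
   fundamental solution of the Laplacian, this is the singularity produced by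
   a term 4 pi c delta_p in Delta u. *)
Definition log_singularity (R : realType) (a b : R * R)
    (u : torus a b -> \bar R) (p : torus a b) (c : R) : Prop :=
  forall P : R * R, torus_pi a b P = p ->
  exists l : R,
    (fine (u (torus_pi a b x)) - c * ln (sqnorm (x - P))) @[x --> P^'] --> l.

Definition nonlinearity (R : realType) (tau t : R) : R :=
  expR t * (1 - expR t) / (tau + expR t) ^+ 3.

(* Distributional solutions on the torus of
     Delta u + eps^-2 nonlinearity tau u
       = 4 pi sum_j m1_j delta_{p1_j} - 4 pi sum_j m2_j delta_{p2_j}.
   u is extended-real valued: by continuity it is -oo at p1_j and +oo at p2_j
   when the corresponding mass is positive, and finite there when it is 0. *)
Record is_solution (R : realType) (a b : R * R) (tau : R) (d1 d2 : nat)
    (p1 : 'I_d1 -> torus a b) (p2 : 'I_d2 -> torus a b)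
    (m1 : 'I_d1 -> R) (m2 : 'I_d2 -> R) (eps : R) (u : torus a b -> \bar R)
    : Prop := IsSolution {
  sol_continuous : continuous u ;
  sol_finite : forall q, ~ (range p1 `|` range p2) q -> u q \is a fin_num ;
  sol_smooth :
    smooth_on (torus_pi a b @^-1` (~` (range p1 `|` range p2)))
      (fun x => fine (u (torus_pi a b x))) ;
  sol_log1 : forall j, log_singularity u (p1 j) (m1 j) ;
  sol_log2 : forall j, log_singularity u (p2 j) (- m2 j) ;
  sol_integrable :
    (@lebesgue2 R).-integrable (fund_domain a b)
      (fun x => (fine (u (torus_pi a b x)))%:E) ;
  sol_weak : forall phi : torus a b -> R,
    smooth_on setT (phi \o torus_pi a b) ->
    \int[@lebesgue2 R]_(x in fund_domain a b)
      (fine (u (torus_pi a b x)) * laplacian (phi \o torus_pi a b) x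
       + eps ^- 2 * (nonlinearity tau (fine (u (torus_pi a b x)))
                     * phi (torus_pi a b x)))
    = 4 * pi * (\sum_(j < d1) m1 j * phi (p1 j))
      - 4 * pi * (\sum_(j < d2) m2 j * phi (p2 j))
}.

(* Main.v *)
(* Write the equation, lifted to the plane, as laplacian w = eps^-2 g(w), where g
   vanishes at 0 and has the sign of w.  Testing it against T = tanh (w / 2), which
   is bounded whatever the size of the singularities, bounds the integral of
   T' |grad w|^2 + eps^-2 T g(w) over a fundamental cell, uniformly in eps.  As
   T^2 T' is dominated by T g(w), the arithmetic-geometric mean inequality shows
   that the gradient of T^3 is O(eps) in L^1.  Hence, by Chebyshev and Fubini, T^3 is
   within delta of a single value k_eps on a grid of lines whose mesh l needs only be
   a large multiple of eps / delta.  Along a subsequence k_eps tends to 0, stays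
   below some -theta, or stays above some theta.  The maximum principle in the cells of the
   grid carries this over to the whole torus: for k_eps -> 0 the constants are
   barriers and l is fixed; in the two other cases l is a multiple of eps and the
   barriers are exponentials of rate 1 / eps.  A singularity of w at -oo does not disturb
   upper bounds, nor one at +oo lower bounds. *)

Require Import Defs.
From HB Require Import structures.
From mathcomp Require Import all_boot all_order all_algebra.
From mathcomp Require Import all_classical all_reals all_analysis.
From mathcomp Require Import ring lra.
From mathcomp Require Import zify.

Set Implicit Arguments.
Unset Strict Implicit.
Unset Printing Implicit Defensive.

Import Order.TTheory GRing.Theory Num.Theory.
Import numFieldNormedType.Exports.

Local Open Scope classical_set_scope.
Local Open Scope ring_scope.

(** * Functions of class C^k *)

(** The function g is not monotone and decays like exp (- |t|) at both ends. The choice of tanh (w /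
    2) matches this decay: T' also behaves like exp (- |t|), and the factor T^2 supplies the
    vanishing at 0 that makes T^2 T' comparable with T g. In the barrier arguments, monotonicity is
    replaced by a linear bound on g on each side of 0. The energy bound survives the singularities
    because the primitive of T is 1-Lipschitz. On an annulus of radius r around a singular point it
    varies by a bounded amount, so a cutoff whose Laplacian has size r^-2 on an area of order r^2
    costs a constant independent of r. Hence r may be taken as small as each solution demands, after
    eps. The scale l = rho * eps makes the two signed cases uniform: an exponential of rate kappa /
    eps varies over such a cell by a factor independent of eps. Distances are measured in lattice
    coordinates by squared sines, which are smooth and periodic. The reflection w -> - w exchanges
    upper and lower bounds, so only one side of each estimate is proved directly. *)

Section Ck.
Context {R : realType}.
Implicit Types (U V : set (R * R)) (f g : R * R -> R) (k : nat).

Lemma Ck_continuous k U f x : Ck_on k U f -> U x -> {for x, continuous f}.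
Proof. by case: k => [|k] [h _]; exact: h. Qed.

Lemma Ck_subset k U V f : V `<=` U -> Ck_on k U f -> Ck_on k V f.
Proof.
move=> VU; elim: k f => [|k IH] f [cf]; first by split => // x /VU; exact: cf.
move=> [d1 d2 h1 h2]; split; first by move=> x /VU; exact: cf.
by split => [x /VU|x /VU||]; [exact: d1|exact: d2|exact: IH h1|exact: IH h2].
Qed.

(** [Ck_on] is a pointwise condition on derivatives of globally defined functions, so it glues along
    a union. This joins the smoothness away from the singular points to the vanishing of the cut-off
    fields near them. *)
Lemma Ck_setU k U V f : Ck_on k U f -> Ck_on k V f -> Ck_on k (U `|` V) f.
Proof.
elim: k f => [|k IH] f [cu hu] [cv hv].
  by split => [x [Ux|Vx]|]; [exact: cu|exact: cv|].
case: hu hv => [u1 u2 u3 u4] [v1 v2 v3 v4].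
split; first by move=> x [Ux|Vx]; [exact: cu|exact: cv].
split; [|
  | exact: IH u3 v3 | exact: IH u4 v4].
- by move=> x [Ux|Vx]; [exact: u1|exact: v1].
- by move=> x [Ux|Vx]; [exact: u2|exact: v2].
Qed.

Lemma eq_near_nbhs U f g x : open U -> {in U, f =1 g} -> U x ->
  {near x, f =1 g}.
Proof.
move=> oU fg Ux; near=> y; apply: fg; apply/mem_set.
by near: y; exact: open_nbhs_nbhs.
Unshelve. all: end_near. Qed.

Lemma near_eq_continuous f g x : {near x, f =1 g} ->
  {for x, continuous f} -> {for x, continuous g}.
Proof.
move=> fg; rewrite /prop_for /continuous_at -(nbhs_singleton fg).
by apply: cvg_trans; exact: near_eq_cvg.
Qed.

Lemma eq_Ck k U f g : open U -> {in U, f =1 g} -> Ck_on k U f -> Ck_on k U g.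
Proof.
move=> oU; elim: k f g => [|k IH] f g fg [cf].
  by split; [|by []] => x Ux; apply: near_eq_continuous (cf _ Ux); exact: eq_near_nbhs Ux.
move=> [d1 d2 h1 h2]; have nfg x (Ux : U x) := eq_near_nbhs oU fg Ux.
have e10 : ((1 : R), (0 : R)) != 0 by rewrite xpair_eqE oner_eq0.
have e01 : ((0 : R), (1 : R)) != 0 by rewrite xpair_eqE oner_eq0 andbF.
split; first by move=> x Ux; apply: near_eq_continuous (cf _ Ux); exact: nfg.
split.
- by move=> x Ux; apply: near_eq_derivable (d1 _ Ux) => //; exact: nfg.
- by move=> x Ux; apply: near_eq_derivable (d2 _ Ux) => //; exact: nfg.
- apply: IH h1 => x /set_mem Ux; apply: near_eq_derive => //; exact: nfg.
- apply: IH h2 => x /set_mem Ux; apply: near_eq_derive => //; exact: nfg.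
Qed.

Lemma Ck_pred k U f : Ck_on k.+1 U f -> Ck_on k U f.
Proof.
elim: k f => [|k IH] f [cf [d1 d2 h1 h2]]; split; [exact: cf|by []|exact: cf|].
by split; [exact: d1|exact: d2|exact: IH h1|exact: IH h2].
Qed.

Lemma Ck_cst k U (c : R) : Ck_on k U (fun=> c).
Proof.
have p1 (d : R) : partial1 (fun=> d) = fun=> 0 by apply/funext => x; exact: derive_cst.
have p2 (d : R) : partial2 (fun=> d) = fun=> 0 by apply/funext => x; exact: derive_cst.
elim: k c => [|k IH] c; first by split; [|by []] => x _; exact: cst_continuous.
split; first by move=> x _; exact: cst_continuous.
by rewrite p1 p2; split; [move=> x _; exact: derivable_cst
  |move=> x _; exact: derivable_cst|exact: IH|exact: IH].
Qed.

Lemma Ck_add k U f g : open U -> Ck_on k U f -> Ck_on k U g ->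
  Ck_on k U (fun x => f x + g x).
Proof.
move=> oU; elim: k f g => [|k IH] f g [cf hf] [cg hg].
  by split; [|by []] => x Ux; apply: continuousD; [exact: cf|exact: cg].
case: hf hg => [f1 f2 f3 f4] [g1 g2 g3 g4].
split; first by move=> x Ux; apply: continuousD; [exact: cf|exact: cg].
split.
- by move=> x Ux; apply: derivableD; [exact: f1|exact: g1].
- by move=> x Ux; apply: derivableD; [exact: f2|exact: g2].
- apply: eq_Ck (IH _ _ f3 g3) => // x /set_mem Ux.
  by rewrite /partial1 deriveD//; [exact: f1|exact: g1].
- apply: eq_Ck (IH _ _ f4 g4) => // x /set_mem Ux.
  by rewrite /partial2 deriveD//; [exact: f2|exact: g2].
Qed.

Lemma Ck_mul k U f g : open U -> Ck_on k U f -> Ck_on k U g ->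
  Ck_on k U (fun x => f x * g x).
Proof.
move=> oU; elim: k f g => [|k IH] f g hf hg.
  case: hf hg => [cf _] [cg _].
  by split; [|by []] => x Ux; apply: continuousM; [exact: cf|exact: cg].
have hf' := Ck_pred hf; have hg' := Ck_pred hg.
case: hf hg => [cf [f1 f2 f3 f4]] [cg [g1 g2 g3 g4]].
split; first by move=> x Ux; apply: continuousM; [exact: cf|exact: cg].
split.
- by move=> x Ux; apply: derivableM; [exact: f1|exact: g1].
- by move=> x Ux; apply: derivableM; [exact: f2|exact: g2].
- apply: eq_Ck (Ck_add oU (IH _ _ hf' g3) (IH _ _ hg' f3)) => // x /set_mem Ux.
  by rewrite /partial1 deriveM//; [exact: f1|exact: g1].
- apply: eq_Ck (Ck_add oU (IH _ _ hf' g4) (IH _ _ hg' f4)) => // x /set_mem Ux.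
  by rewrite /partial2 deriveM//; [exact: f2|exact: g2].
Qed.

Lemma Ck_scale k U (c : R) f : open U -> Ck_on k U f ->
  Ck_on k U (fun x => c * f x).
Proof. by move=> oU; apply: Ck_mul => //; exact: Ck_cst. Qed.

Lemma Ck_opp k U f : open U -> Ck_on k U f -> Ck_on k U (fun x => - f x).
Proof.
move=> oU /(Ck_scale (- 1) oU); apply: eq_Ck => // x _.
by rewrite mulN1r.
Qed.

Lemma Ck_sub k U f g : open U -> Ck_on k U f -> Ck_on k U g ->
  Ck_on k U (fun x => f x - g x).
Proof. by move=> oU hf hg; apply: Ck_add => //; exact: Ck_opp. Qed.

(** Along the line [t *: v + x] this is the one-variable chain rule applied to [h]. *)
Lemma derive_comp1 (V : normedModType R) (F : R -> R) (F' : R) (f : V -> R)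
    (x v : V) :
  is_derive (f x) 1 F F' -> derivable f x v -> is_derive x v (F \o f) (F' * 'D_v f x).
Proof.
move=> hF hf.
pose h := fun t : R => f (t *: v + x).
have dh : is_derive (0 : R) 1 h ('D_v f x).
  apply: DeriveDef; first exact: (proj1 (derivable1P f x v) hf).
  rewrite /derive /h; set g1 := fun t => t^-1 *: _; set g2 := fun t => t^-1 *: _.
  suff -> : g1 = g2 by [].
  by apply/funext => t; rewrite /g1 /g2 /= addr0 scale0r add0r [_%:A]mulr1.
have hF' : is_derive (h 0) 1 F F' by rewrite /h scale0r add0r.
have dc : is_derive (0 : R) 1 (F \o h) (F' * 'D_v f x).
  exact: (@is_derive1_comp _ F h 0 F' ('D_v f x)).
apply: DeriveDef; first exact: (proj2 (derivable1P (F \o f) x v) (@ex_derive _ _ _ _ _ _ _ dc)).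
rewrite -(@derive_val _ _ _ _ _ _ _ dc) /derive /h.
set g1 := fun t => t^-1 *: _; set g2 := fun t => t^-1 *: _.
suff -> : g1 = g2 by [].
by apply/funext => t; rewrite /g1 /g2 /= addr0 scale0r add0r [_%:A]mulr1.
Qed.

(** The regularity of [F' \o f] is left as a hypothesis: each use closes its own family of
    derivatives (sine and cosine, [flatE n], inverse, exponential, tanh) by induction on k. *)
Lemma Ck_comp k U (F F' : R -> R) f : open U ->
  (forall x, U x -> is_derive (f x) 1 F (F' (f x))) ->
  Ck_on k U (F' \o f) -> Ck_on k.+1 U f -> Ck_on k.+1 U (F \o f).
Proof.
move=> oU hF hF' [cf [d1 d2 h1 h2]].
split.
  move=> x Ux; apply: continuous_comp; first exact: cf.
  apply: differentiable_continuous; apply/derivable1_diffP.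
  by have := hF _ Ux => ?; exact: ex_derive.
split.
- by move=> x Ux; have := derive_comp1 (hF _ Ux) (d1 _ Ux) => ?; exact: ex_derive.
- by move=> x Ux; have := derive_comp1 (hF _ Ux) (d2 _ Ux) => ?; exact: ex_derive.
- apply: eq_Ck (Ck_mul oU hF' h1) => // x /set_mem Ux.
  by have := derive_comp1 (hF _ Ux) (d1 _ Ux) => ?; rewrite /partial1 derive_val.
- apply: eq_Ck (Ck_mul oU hF' h2) => // x /set_mem Ux.
  by have := derive_comp1 (hF _ Ux) (d2 _ Ux) => ?; rewrite /partial2 derive_val.
Qed.

Lemma Ck0_comp U (F F' : R -> R) f :
  (forall x, U x -> is_derive (f x) 1 F (F' (f x))) ->
  Ck_on 0 U f -> Ck_on 0 U (F \o f).
Proof.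
move=> hF [cf _]; split; [|by []] => x Ux; apply: continuous_comp; first exact: cf.
apply: differentiable_continuous; apply/derivable1_diffP.
by have := hF _ Ux => ?; exact: ex_derive.
Qed.

Lemma Ck_linear k U (p q c : R) : open U ->
  Ck_on k U (fun x : R * R => p * x.1 + q * x.2 + c).
Proof.
move=> oU.
have H (x v : R * R) : is_derive x v (fun x : R * R => p * x.1 + q * x.2 + c)
    (p * v.1 + q * v.2).
  have L : (fun h : R => h^-1 *: ((fun x : R * R => p * x.1 + q * x.2 + c)
      (h *: v + x) - (fun x : R * R => p * x.1 + q * x.2 + c) x)) @ 0^'
      --> p * v.1 + q * v.2.
    apply: cvg_near_cst; near=> h.
    have h0 : h != 0 by near: h; exact: nbhs_dnbhs_neq.
    rewrite /= /GRing.scale /=; field.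
    exact: h0.
  apply: DeriveDef; first by apply/cvg_ex; eexists; exact: L.
  exact: cvg_lim L.
have cf x : {for x, continuous (fun x : R * R => p * x.1 + q * x.2 + c)}.
  have d1 : {for x, continuous (fst : R * R -> R)} by exact: cvg_fst.
  have d2 : {for x, continuous (snd : R * R -> R)} by exact: cvg_snd.
  apply: continuousD; last exact: cst_continuous.
  by apply: continuousD; apply: continuousM => //; exact: cst_continuous.
have df x v := @ex_derive _ _ _ _ _ _ _ (H x v).
case: k => [|k]; (split; [by move=> x _; exact: cf|]); first by [].
split; [by move=> x _; exact: df|by move=> x _; exact: df| |].
- have -> : partial1 (fun x : R * R => p * x.1 + q * x.2 + c) = fun=> p * 1 + q * 0.
    by apply/funext => x; have := H x (1, 0) => ?; exact: derive_val.
  exact: Ck_cst.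
- have -> : partial2 (fun x : R * R => p * x.1 + q * x.2 + c) = fun=> p * 0 + q * 1.
    by apply/funext => x; have := H x (0, 1) => ?; exact: derive_val.
  exact: Ck_cst.
Unshelve. all: end_near. Qed.

Lemma Ck_sum k U (I : Type) (r : seq I) (f : I -> R * R -> R) : open U ->
  (forall i, Ck_on k U (f i)) -> Ck_on k U (fun x => \sum_(i <- r) f i x).
Proof.
move=> oU hf; elim: r => [|i r IH].
  apply: (eq_Ck _ _ (Ck_cst k U 0)) => // x _; by rewrite big_nil.
apply: eq_Ck (Ck_add oU (hf i) IH) => // x _; by rewrite big_cons.
Qed.

(** Simultaneous induction: each function is, up to sign, the derivative of the other. *)
Lemma Ck_sin_cos k U f : open U -> Ck_on k U f ->
  Ck_on k U (sin \o f) /\ Ck_on k U (cos \o f).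
Proof.
move=> oU; elim: k => [|k IH] hf.
  split; first by apply: (@Ck0_comp U sin cos).
  by apply: (@Ck0_comp U cos (fun y => - sin y)).
have [hs hc] := IH (Ck_pred hf); split; first exact: (@Ck_comp k U sin cos).
apply: (@Ck_comp k U cos (fun y => - sin y)) => //.
exact: (@Ck_opp k U (sin \o f)).
Qed.

End Ck.

(** * Derivatives along lines *)

Section lines.
Context {R : realType}.
Implicit Types (U : set (R * R)) (f : R * R -> R).

Lemma is_derive_to (V : normedModType R) (f : V -> R) (x v : V) (D D' : R) :
  is_derive x v f D -> D = D' -> is_derive x v f D'.
Proof. by move=> h <-. Qed.

Lemma is_derive1_compE (F g : R -> R) (x y D d : R) : g x = y ->
  is_derive y 1 F D -> is_derive x 1 g d -> is_derive x 1 (fun s => F (g s)) (D * d).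
Proof. by move=> <- hF hg; exact: (@is_derive1_comp _ F g x D d). Qed.

Lemma is_derive_line (V : normedModType R) (f : V -> R) (v c : V) (s D : R) :
  is_derive (s *: v + c) v f D -> is_derive s 1 (fun s => f (s *: v + c)) D.
Proof.
move=> [df <-].
have E : (fun h : R => h^-1 *: (f ((h *: 1 + s) *: v + c) - f (s *: v + c))) =
         (fun h : R => h^-1 *: (f (h *: v + (s *: v + c)) - f (s *: v + c))).
  by apply/funext => h; rewrite [h *: 1]mulr1 scalerDl addrA.
by apply: DeriveDef; rewrite /derivable /derive /= E.
Qed.

Lemma is_derive_slice1 f (x : R * R) : derivable f x (1, 0) ->
  is_derive x.1 1 (fun s => f (s, x.2)) (partial1 f x).
Proof.
case: x => x1 x2 /= df; have E : x1 *: ((1, 0) : R * R) + (0, x2) = (x1, x2).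
  by congr pair; rewrite /= /GRing.scale /= ?mulr1 ?mulr0 ?addr0 ?add0r.
have -> : (fun s => f (s, x2)) = (fun s => f (s *: ((1, 0) : R * R) + (0, x2))).
  apply/funext => s; congr f.
  by congr pair; rewrite /= /GRing.scale /= ?mulr1 ?mulr0 ?addr0 ?add0r.
by apply: is_derive_line; rewrite E; exact: derivableP.
Qed.

Lemma is_derive_slice2 f (x : R * R) : derivable f x (0, 1) ->
  is_derive x.2 1 (fun s => f (x.1, s)) (partial2 f x).
Proof.
case: x => x1 x2 /= df; have E : x2 *: ((0, 1) : R * R) + (x1, 0) = (x1, x2).
  by congr pair; rewrite /= /GRing.scale /= ?mulr1 ?mulr0 ?addr0 ?add0r.
have -> : (fun s => f (x1, s)) = (fun s => f (s *: ((0, 1) : R * R) + (x1, 0))).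
  apply/funext => s; congr f.
  by congr pair; rewrite /= /GRing.scale /= ?mulr1 ?mulr0 ?addr0 ?add0r.
by apply: is_derive_line; rewrite E; exact: derivableP.
Qed.

Lemma is_derive1_continuous (V : normedModType R) (f : R -> V) (x : R) D :
  is_derive x 1 f D -> {for x, continuous f}.
Proof. by move=> [df _]; apply: differentiable_continuous; apply/derivable1_diffP. Qed.

Lemma MVT0 (k dk : R -> R) (y : R) :
  (forall t : R, `|t| <= `|y| -> is_derive t 1 k (dk t)) ->
  exists2 c, `|c| <= `|y| & k y - k 0 = dk c * y.
Proof.
move=> dkk; have ck t : `|t| <= `|y| -> {for t, continuous k}.
  by move=> /dkk/is_derive1_continuous.
have itvN (a b : R) : `|a| <= `|y| -> `|b| <= `|y| ->
    forall t, t \in `[a, b] -> `|t| <= `|y|.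
  move=> ha hb t /itvP th; rewrite ler_norml; move: ha hb.
  rewrite !ler_norml => /andP[ha _] /andP[_ hb].
  by rewrite (le_trans ha) ?th //= (le_trans _ hb) ?th.
have n0 : `|0 : R| <= `|y| by rewrite normr0.
have [y0|y0|y0] := ltgtP 0 y; last by exists 0; rewrite -y0 ?normr0// subrr mulr0.
- have [||c cy ->] := @MVT _ k dk 0 y y0.
  + by move=> t ty; apply: dkk; apply: (itvN 0 y) => //; exact: subset_itv_oo_cc.
  + apply: continuous_in_subspaceT => t /set_mem ty; apply: ck.
    exact: (itvN 0 y).
  + exists c; last by rewrite subr0.
    by apply: (itvN 0 y) => //; exact: subset_itv_oo_cc.
- have [||c cy E] := @MVT _ k dk y 0 y0.
  + by move=> t ty; apply: dkk; apply: (itvN y 0) => //; exact: subset_itv_oo_cc.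
  + apply: continuous_in_subspaceT => t /set_mem ty; apply: ck.
    exact: (itvN y 0).
  + exists c; last by rewrite -opprB E sub0r mulrN opprK.
    by apply: (itvN y 0) => //; exact: subset_itv_oo_cc.
Qed.

(** The increment is split at the corner [(x.1, h * v.2 + x.2)]. Its vertical part is a derivative
    at [x] itself; the horizontal part starts from a point that moves with h, and is handled by the
    mean value theorem and the continuity of [partial1 f]. *)
Lemma C1_is_derive U f (x v : R * R) : open U -> Ck_on 1 U f -> U x ->
  is_derive x v f (v.1 * partial1 f x + v.2 * partial2 f x).
Proof.
move=> oU [cf [d1 d2 [c1 _] [c2 _]]] Ux.
suff L : (fun h : R => h^-1 *: (f (h *: v + x) - f x)) @ 0^'
      --> v.1 * partial1 f x + v.2 * partial2 f x.
  by apply: DeriveDef; [apply/cvg_ex; eexists; exact: L|exact: cvg_lim L].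
have L2 : (fun h : R => h^-1 * (f (x.1, h * v.2 + x.2) - f x)) @ 0^'
      --> v.2 * partial2 f x.
  have D2 : is_derive (0 : R) 1 (fun s => f (x.1, s * v.2 + x.2)) (v.2 * partial2 f x).
    have D3 : is_derive (0 : R) 1 (fun s : R => s * v.2 + x.2) v.2.
      by apply: is_derive_eq; rewrite scaler0 add0r addr0 [_ *: _]mulr1.
    rewrite mulrC; apply: is_derive1_compE (is_derive_slice2 (d2 _ Ux)) D3.
    by rewrite mul0r add0r.
  move: D2 => [dD2 <-]; have := dD2; rewrite /derivable /derive => /cvgP.
  set g1 := fun h => _; set g2 := fun h => _.
  have -> : g1 = g2; last by move=> /cvg_ex [l hl]; rewrite (cvg_lim _ hl).
  apply/funext => h; rewrite /g1 /g2 /= [h *: 1]mulr1 addr0 mul0r add0r.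
  by case: (x).
have L1 : (fun h : R => h^-1 * (f (h *: v + x) - f (x.1, h * v.2 + x.2))) @ 0^'
      --> v.1 * partial1 f x.
  apply/cvgrPdist_le => e e0.
  (* A positive majorant, since [v.1] may vanish and V1 is a divisor below. *)
  have [V1 V10] : exists2 V1 : R, 0 < V1 & `|v.1| <= V1.
    by exists (1 + `|v.1|); rewrite ?ltr_pwDl// lerDr.
  have e'0 : 0 < e / V1 by rewrite divr_gt0.
  have : \forall y \near x, U y /\ `|partial1 f x - partial1 f y| <= e / V1.
    near=> y; split; first by near: y; exact: open_nbhs_nbhs.
    by near: y; move/cvgrPdist_le: (c1 _ Ux); apply.
  case/nbhs_ballP => d d0 hd.
  have nh : \forall h \near (0 : R)^', [/\ h != 0, `|h * v.1| < d & `|h * v.2| < d].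
    have L0 (r : R) : (fun h : R => h * r) @ 0^' --> (0 : R).
      rewrite -[X in _ --> X](mul0r r); apply: cvgMl; apply: cvg_within.
    near=> h; split; near: h.
    - exact: nbhs_dnbhs_neq.
    - by move/cvgr0Pnorm_lt: (L0 v.1); apply.
    by move/cvgr0Pnorm_lt: (L0 v.2); apply.
  move=> hV1; apply: filterS nh => h [h0 hv1 hv2].
  have B (t : R) : `|t| <= `|h * v.1| -> ball x d (t + x.1, h * v.2 + x.2).
    move=> th; split; rewrite /ball /= opprD addrCA subrr addr0 normrN//.
    exact: le_lt_trans hv1.
  have [|c cv E] := @MVT0 (fun t => f (t + x.1, h * v.2 + x.2) - t * partial1 f x)
      (fun t => partial1 f (t + x.1, h * v.2 + x.2) - partial1 f x) (h * v.1).
    move=> t th; have [Ut _] := hd _ (B _ th).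
    have D1 := is_derive_slice1 (d1 _ Ut).
    have D2 : is_derive t 1 (fun t : R => t + x.1) 1.
      by apply: is_derive_eq; rewrite addr0.
    have D3 : is_derive t 1 (fun t : R => f (t + x.1, h * v.2 + x.2))
        (partial1 f (t + x.1, h * v.2 + x.2)).
      rewrite -[partial1 _ _]mulr1.
      exact: (@is_derive1_compE (fun s => f (s, h * v.2 + x.2)) (fun t => t + x.1)
        t (t + x.1) _ _ erefl D1 D2).
    have D4 : is_derive t 1 (fun t : R => t * partial1 f x) (partial1 f x).
      by apply: is_derive_eq; rewrite scaler0 add0r [_ *: _]mulr1.
    exact: is_deriveB.
  have -> : v.1 * partial1 f x - h^-1 * (f (h *: v + x) - f (x.1, h * v.2 + x.2))
     = - ((partial1 f (c + x.1, h * v.2 + x.2) - partial1 f x) * v.1).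
    have -> : h *: v + x = (h * v.1 + x.1, h * v.2 + x.2) by [].
    move: E; rewrite mul0r add0r subr0.
    set A := f _; set B' := f _; set C := partial1 _ _; set D := partial1 _ _ => E.
    have -> : A - B' = (D - C) * (h * v.1) + h * v.1 * C.
      by rewrite -E; ring.
    by field.
  rewrite normrN normrM; have [_ hc] := hd _ (B _ cv).
  rewrite distrC in hc; apply: (le_trans (ler_pM _ _ hc hV1)) => //.
  by rewrite divfK// gt_eqF.
apply: cvg_trans (cvgD L1 L2); apply: near_eq_cvg; near=> h.
by rewrite /= -mulrDr addrA subrK.
Unshelve. all: end_near. Qed.

End lines.

(** * Integration over rectangles *)

Section plane_integration.
Context {R : realType}.
Implicit Types (f h : R * R -> R).
Notation mu := (@lebesgue_measure R).
Notation mu2 := (mu \x mu)%E.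
Notation T2 := (measurableTypeR R * measurableTypeR R)%type.

Definition rect (a1 b1 a2 b2 : R) : set (R * R) :=
  `[a1, b1]%classic `*` `[a2, b2]%classic.

(** Measurability refers to the product sigma-algebra, so the open set is written as a countable
    union of boxes with rational corners; boxes that leave [W] are replaced by the empty set. *)
Lemma open_measurable2 (W : set (R * R)) : open W -> measurable (W : set T2).
Proof.
move=> oW.
pose B (q : (rat * rat) * (rat * rat)) : set T2 :=
  `]ratr q.1.1, ratr q.1.2[%classic `*` `]ratr q.2.1, ratr q.2.2[%classic.
pose F q : set T2 := if `[< B q `<=` W >] then B q else set0.
have -> : (W : set T2) = \bigcup_q F q.
  apply/seteqP; split => [x Wx|x [q _]]; last first.
    by rewrite /F; case: asboolP => // qW /qW.
  have /nbhs_ballP [e /= e0 eW] : nbhs (x : R * R) W by exact: open_nbhs_nbhs.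
  have lt1 (y : R) : y - e < y by rewrite ltrBlDr ltrDl.
  have lt2 (y : R) : y < y + e by rewrite ltrDl.
  have [q1] := rat_in_itvoo (lt1 x.1); rewrite in_itv /= => /andP[q1l q1r].
  have [q2] := rat_in_itvoo (lt2 x.1); rewrite in_itv /= => /andP[q2l q2r].
  have [q3] := rat_in_itvoo (lt1 x.2); rewrite in_itv /= => /andP[q3l q3r].
  have [q4] := rat_in_itvoo (lt2 x.2); rewrite in_itv /= => /andP[q4l q4r].
  exists ((q1, q2), (q3, q4)) => //; rewrite /F.
  case: asboolP => [_|]; first by split; rewrite /= in_itv /= ?q1r ?q3r.
  case=> y [/=]; rewrite !in_itv /= => /andP[y1l y1r] /andP[y2l y2r].
  apply: eW; split; rewrite /ball /= ltr_distl.
    by apply/andP; split; lra.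
  by apply/andP; split; lra.
apply: countable_bigcupT_measurable => // q; rewrite /F.
case: asboolP => // _; exact: measurableX.
Qed.

Lemma measurable_rect a1 b1 a2 b2 : measurable (rect a1 b1 a2 b2 : set T2).
Proof. exact: measurableX. Qed.

Lemma compact_rect a1 b1 a2 b2 : compact (rect a1 b1 a2 b2).
Proof. by apply: compact_setX; exact: segment_compact. Qed.

Lemma mu_segment (a b : R) : a <= b -> mu `[a, b]%classic = (b - a)%:E.
Proof.
move=> ab; rewrite lebesgue_measure_itv /= lte_fin.
by case: ltgtP ab => // -> _; rewrite subrr.
Qed.

Lemma mu2_rect_fin a1 b1 a2 b2 : (mu2 (rect a1 b1 a2 b2) < +oo)%E.
Proof.
rewrite product_measure1E //= !lebesgue_measure_itv /=.
by case: ifP; case: ifP; rewrite ?mule0 ?mul0e // => _ _; rewrite -!EFinB -EFinM ltry.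
Qed.

(** Continuity holds at the points of the rectangle with respect to the whole plane: within the
    rectangle, the preimage of an open interval therefore agrees with its interior, which is
    open. *)
Lemma measurable_fun_rect a1 b1 a2 b2 f :
  (forall x, rect a1 b1 a2 b2 x -> {for x, continuous f}) ->
  measurable_fun (rect a1 b1 a2 b2 : set T2) (f : T2 -> R).
Proof.
move=> cf; apply: (measurability _ (measurable_realfun.RGenOpens.measurableE R)).
move=> _ [_ [a [b ->] <-]].
set Q := rect _ _ _ _; pose V : set R := `]a, b[%classic.
have oV : open V by exact: interval_open.
suff -> : Q `&` f @^-1` V = Q `&` interior (f @^-1` V).
  by apply: measurableI; [exact: measurable_rect|apply: open_measurable2; exact: open_interior].
apply/seteqP; split => x [Qx]; last by move/interior_subset.
move=> Vx; split => //; apply: (cf _ Qx); exact: open_nbhs_nbhs.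
Qed.

Lemma integrable_rect a1 b1 a2 b2 f :
  (forall x, rect a1 b1 a2 b2 x -> {for x, continuous f}) ->
  mu2.-integrable (rect a1 b1 a2 b2 : set T2) (EFin \o (f : T2 -> R)).
Proof.
move=> cf; apply: measurable_bounded_integrable.
- exact: measurable_rect.
- exact: mu2_rect_fin.
- exact: measurable_fun_rect.
have cw : {within rect a1 b1 a2 b2, continuous f}.
  by apply: continuous_in_subspaceT => x /set_mem; exact: cf.
have /compact_bounded [M [_ mrt]] :=
  continuous_compact cw (@compact_rect a1 b1 a2 b2).
by exists M; split; rewrite ?num_real// => ? ? ? ?; exact: mrt.
Qed.

Lemma patch_rect a1 b1 a2 b2 f s t :
  (f \_ (rect a1 b1 a2 b2)) (s, t) =
  ((fun s => ((fun t => f (s, t)) \_ `[a2, b2]) t) \_ `[a1, b1]) s.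
Proof.
rewrite !patchE.
have -> : ((s, t) \in rect a1 b1 a2 b2) =
    (s \in `[a1, b1]%classic) && (t \in `[a2, b2]%classic).
  by apply/idP/andP => [/set_mem[h1 h2]|[/set_mem h1 /set_mem h2]];
    [split; exact: mem_set|apply: mem_set].
by case: (s \in _); case: (t \in _).
Qed.

Section Fubini_rect.
Variables (a1 b1 a2 b2 : R) (f : R * R -> R).
Hypothesis cf : forall x, rect a1 b1 a2 b2 x -> {for x, continuous f}.
Let Q := rect a1 b1 a2 b2.
(** Extension by zero, so that Fubini on the whole plane yields iterated integrals over the two
    segments. *)
Let g : T2 -> \bar R := EFin \o (f \_ Q).

Let ig : mu2.-integrable setT g.
Proof.
rewrite /g -restrict_EFin; apply/(integrable_mkcond _ (measurable_rect _ _ _ _)).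
exact: integrable_rect.
Qed.

Let Ef : (\int[mu2]_(x in (Q : set T2)) (f x)%:E = \int[mu2]_x g x)%E.
Proof. by rewrite integral_mkcond restrict_EFin. Qed.

Let Eg2 t : fubini_G mu g t =
  ((fun t => \int[mu]_(s in `[a1, b1]) (f (s, t))%:E) \_ `[a2, b2])%E t.
Proof.
rewrite /fubini_G patchE; case: ifPn => t1.
  rewrite [RHS]integral_mkcond; apply: eq_integral => s _.
  by rewrite /g /= patch_rect restrict_EFin /= !patchE t1.
rewrite integral0_eq// => s _.
by rewrite /g /= patch_rect !patchE (negbTE t1); case: ifP.
Qed.

Let Eg1 s : fubini_F mu g s =
  ((fun s => \int[mu]_(t in `[a2, b2]) (f (s, t))%:E) \_ `[a1, b1])%E s.
Proof.
rewrite /fubini_F patchE; case: ifPn => s1.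
  rewrite [RHS]integral_mkcond; apply: eq_integral => t _.
  by rewrite /g /= patch_rect restrict_EFin /= !patchE s1.
rewrite integral0_eq// => t _.
by rewrite /g /= patch_rect !patchE (negbTE s1).
Qed.

Lemma Fubini_rect1 : (\int[mu2]_(x in (Q : set T2)) (f x)%:E =
  \int[mu]_(s in `[a1, b1]) \int[mu]_(t in `[a2, b2]) (f (s, t))%:E)%E.
Proof.
rewrite Ef -(integral12_prod_meas1 ig) [RHS]integral_mkcond.
by apply: eq_integral => s _; rewrite Eg1.
Qed.

Lemma Fubini_rect2 : (\int[mu2]_(x in (Q : set T2)) (f x)%:E =
  \int[mu]_(t in `[a2, b2]) \int[mu]_(s in `[a1, b1]) (f (s, t))%:E)%E.
Proof.
rewrite Ef -(integral21_prod_meas1 ig) [RHS]integral_mkcond.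
by apply: eq_integral => s _; rewrite Eg2.
Qed.

Lemma Rintegral_rect : \int[mu2]_(x in (Q : set T2)) f x = fine (\int[mu2]_x g x)%E.
Proof. by rewrite /Rintegral Ef. Qed.

Let g0 : (forall x, Q x -> 0 <= f x) -> forall x, (0 <= g x)%E.
Proof.
by move=> f0 x; rewrite /g /= lee_fin patchE; case: ifP => // /set_mem; exact: f0.
Qed.

Let mG0 (c d beta : R) (B : set (measurableTypeR R)) : measurable B ->
  (mu B <= beta%:E)%E -> c <= d ->
  ((d - c - beta)%:E <= mu (`[c, d] `\` B))%E.
Proof.
move=> mB Bb cd.
have mA : measurable (`[c, d]%classic `\` B : set (measurableTypeR R)).
  exact: measurableD.
have : (mu `[c, d]%classic <= mu (`[c, d]%classic `\` B) + mu B)%E.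
  apply: le_trans (measureU2 _ mA mB); apply: le_measure; rewrite ?inE//.
  - exact: measurableU.
  - move=> t ct; have [Bt|nBt] := pselect (B t); first by right.
    by left.
rewrite mu_segment// => h.
have {}h : ((d - c)%:E <= mu (`[c, d]%classic `\` B) + beta%:E)%E.
  by apply: (le_trans h); rewrite leeD2l.
by rewrite EFinB leeBlDr.
Qed.

(** Chebyshev's inequality for slices, with an exceptional set [B] of parameters. It is used
    contrapositively: a small double integral leaves, in [[c, d]] and off [B], a line with a small
    integral. *)
Lemma slice_chebyshev2 (c d delta beta : R) (B : set (measurableTypeR R)) :
  0 <= delta -> (forall x, Q x -> 0 <= f x) -> measurable B ->
  (mu B <= beta%:E)%E -> a2 <= c -> c <= d -> d <= b2 ->
  (forall t, c <= t <= d -> ~ B t -> delta <= \int[mu]_(s in `[a1, b1]) f (s, t)) ->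
  delta * (d - c - beta) <= \int[mu2]_(x in (Q : set T2)) f x.
Proof.
move=> delta0 f0 mB Bb ac cd db H; rewrite Rintegral_rect.
have gfin := integrable_fin_num measurableT ig.
rewrite -lee_fin fineK//.
set A := (`[c, d]%classic `\` B : set (measurableTypeR R)).
have mA : measurable A by exact: measurableD.
have mG := measurable_fubini_G ig.
have G0 t : (0 <= fubini_G mu g t)%E by apply: integral_ge0 => s _; exact: g0.
have -> : (\int[mu2]_x g x = \int[mu]_t fubini_G mu g t)%E.
  by rewrite (integral21_prod_meas1 ig).
apply: (@le_trans _ _ (\int[mu]_(t in A) delta%:E)%E).
  rewrite integral_cst// EFinM lee_wpmul2l ?lee_fin//.
  exact: mG0.
apply: (@le_trans _ _ (\int[mu]_(t in A) fubini_G mu g t)%E).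
  apply: ge0_le_integral => //.
  - by apply: measurable_funS mG.
  - move=> t [/= tcd nB]; rewrite Eg2 patchE mem_set/=; last first.
      by move: tcd; rewrite !in_itv /= => /andP[h1 h2];
         rewrite (le_trans ac h1) (le_trans h2 db).
    have := H t _ nB; rewrite in_itv /= in tcd; rewrite /Rintegral => /(_ tcd).
    set I := (\int[_]_(_ in _) _)%E.
    have I0 : (0 <= I)%E.
      apply: integral_ge0 => s hs; rewrite lee_fin; apply: f0; split => //=.
      by move: tcd => /andP[h1 h2]; rewrite in_itv /= (le_trans ac h1) (le_trans h2 db).
    (* The hypothesis concerns the real number [fine I]; an infinite [I] is +oo, being nonnegative,
       and then the bound is trivial. *)
    by case: (I) I0 => [r _|_ _|] //=; rewrite ?lee_fin ?leey.
apply: ge0_subset_integral => //.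
Qed.

Lemma slice_chebyshev1 (c d delta beta : R) (B : set (measurableTypeR R)) :
  0 <= delta -> (forall x, Q x -> 0 <= f x) -> measurable B ->
  (mu B <= beta%:E)%E -> a1 <= c -> c <= d -> d <= b1 ->
  (forall s, c <= s <= d -> ~ B s -> delta <= \int[mu]_(t in `[a2, b2]) f (s, t)) ->
  delta * (d - c - beta) <= \int[mu2]_(x in (Q : set T2)) f x.
Proof.
move=> delta0 f0 mB Bb ac cd db H; rewrite Rintegral_rect.
have gfin := integrable_fin_num measurableT ig.
rewrite -lee_fin fineK//.
set A := (`[c, d]%classic `\` B : set (measurableTypeR R)).
have mA : measurable A by exact: measurableD.
have mG := measurable_fubini_F ig.
have G0 s : (0 <= fubini_F mu g s)%E by apply: integral_ge0 => t _; exact: g0.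
have -> : (\int[mu2]_x g x = \int[mu]_s fubini_F mu g s)%E.
  by rewrite (integral12_prod_meas1 ig).
apply: (@le_trans _ _ (\int[mu]_(s in A) delta%:E)%E).
  rewrite integral_cst// EFinM lee_wpmul2l ?lee_fin//.
  exact: mG0.
apply: (@le_trans _ _ (\int[mu]_(s in A) fubini_F mu g s)%E).
  apply: ge0_le_integral => //.
  - by apply: measurable_funS mG.
  - move=> s [/= scd nB]; rewrite Eg1 patchE mem_set/=; last first.
      by move: scd; rewrite !in_itv /= => /andP[h1 h2];
         rewrite (le_trans ac h1) (le_trans h2 db).
    have := H s _ nB; rewrite in_itv /= in scd; rewrite /Rintegral => /(_ scd).
    set I := (\int[_]_(_ in _) _)%E.
    have I0 : (0 <= I)%E.
      apply: integral_ge0 => t ht; rewrite lee_fin; apply: f0; split => //=.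
      by move: scd => /andP[h1 h2]; rewrite in_itv /= (le_trans ac h1) (le_trans h2 db).
    by case: (I) I0 => [r _|_ _|] //=; rewrite ?lee_fin ?leey.
apply: ge0_subset_integral => //.
Qed.

End Fubini_rect.

Lemma FTC_segment (F f : R -> R) (a b : R) : a < b ->
  (forall t, a <= t <= b -> is_derive t 1 F (f t)) ->
  (forall t, a <= t <= b -> {for t, continuous f}) ->
  \int[mu]_(t in `[a, b]) f t = F b - F a.
Proof.
move=> ab dF cf; rewrite /Rintegral (@continuous_FTC2 _ f F a b) //.
- apply: continuous_in_subspaceT => t /set_mem/=; rewrite in_itv/=; exact: cf.
- have cF t : a <= t <= b -> {for t, continuous F}.
    by move=> /dF/is_derive1_continuous.
  split.
  + move=> t; rewrite in_itv /= => /andP[/ltW h1 /ltW h2].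
    have := dF t; rewrite h1 h2 => /(_ isT) ?; exact: ex_derive.
  + by apply: cvg_at_right_filter; apply: cF; rewrite lexx ltW.
  + by apply: cvg_at_left_filter; apply: cF; rewrite lexx ltW.
- move=> t; rewrite in_itv /= => /andP[/ltW h1 /ltW h2].
  have := dF t; rewrite h1 h2 => /(_ isT) ?; rewrite derive1E; exact: derive_val.
Qed.

(** The condition on opposite sides covers both uses: fields periodic on a cell, and fields
    vanishing on the boundary of a small square. *)
Lemma rect_ibp1 (F f : R * R -> R) a1 b1 a2 b2 : a1 < b1 ->
  (forall x, rect a1 b1 a2 b2 x -> is_derive x.1 1 (fun s => F (s, x.2)) (f x)) ->
  (forall x, rect a1 b1 a2 b2 x -> {for x, continuous f}) ->
  (forall t, a2 <= t <= b2 -> F (b1, t) = F (a1, t)) ->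
  \int[mu2]_(x in (rect a1 b1 a2 b2 : set T2)) f x = 0.
Proof.
move=> ab dF cf E; rewrite /Rintegral Fubini_rect2// integral0_eq// => t.
rewrite /= in_itv /= => t2.
have rx s : a1 <= s <= b1 -> rect a1 b1 a2 b2 (s, t).
  by move=> s1; split; rewrite /= in_itv.
have cs s : a1 <= s <= b1 -> {for s, continuous (fun s => f (s, t))}.
  move=> s1; apply: (@continuous_comp _ _ _ (fun s => (s, t)) f); last exact: cf (rx _ s1).
  apply: (@cvg_pair _ _ _ (nbhs s) (nbhs s) (nbhs t) _ _ _ id (fun=> t)).
    exact: cvg_id.
  exact: cvg_cst.
have := @FTC_segment (fun s => F (s, t)) (fun s => f (s, t)) a1 b1 ab.
rewrite E// subrr => H.
rewrite -[LHS]fineK; first by apply/congr1/H => // s s1; exact: dF (rx _ s1).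
apply: integrable_fin_num => //.
apply: continuous_compact_integrable; first exact: segment_compact.
by apply: continuous_in_subspaceT => s /set_mem /=; rewrite in_itv /= => /cs.
Qed.

Lemma rect_ibp2 (F f : R * R -> R) a1 b1 a2 b2 : a2 < b2 ->
  (forall x, rect a1 b1 a2 b2 x -> is_derive x.2 1 (fun t => F (x.1, t)) (f x)) ->
  (forall x, rect a1 b1 a2 b2 x -> {for x, continuous f}) ->
  (forall s, a1 <= s <= b1 -> F (s, b2) = F (s, a2)) ->
  \int[mu2]_(x in (rect a1 b1 a2 b2 : set T2)) f x = 0.
Proof.
move=> ab dF cf E; rewrite /Rintegral Fubini_rect1// integral0_eq// => s.
rewrite /= in_itv /= => s1.
have rx t : a2 <= t <= b2 -> rect a1 b1 a2 b2 (s, t).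
  by move=> t2; split; rewrite /= in_itv.
have cs t : a2 <= t <= b2 -> {for t, continuous (fun t => f (s, t))}.
  move=> t2; apply: (@continuous_comp _ _ _ (fun t => (s, t)) f); last exact: cf (rx _ t2).
  apply: (@cvg_pair _ _ _ (nbhs t) (nbhs s) (nbhs t) _ _ _ (fun=> s) id).
    exact: cvg_cst.
  exact: cvg_id.
have := @FTC_segment (fun t => F (s, t)) (fun t => f (s, t)) a2 b2 ab.
rewrite E// subrr => H.
rewrite -[LHS]fineK; first by apply/congr1/H => // t t2; exact: dF (rx _ t2).
apply: integrable_fin_num => //.
apply: continuous_compact_integrable; first exact: segment_compact.
by apply: continuous_in_subspaceT => t /set_mem /=; rewrite in_itv /= => /cs.
Qed.

Lemma integrable_cst2 (D : set T2) (M : R) : measurable D -> (mu2 D < +oo)%E ->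
  mu2.-integrable D (EFin \o (fun=> M)).
Proof.
move=> mD fD; apply: measurable_bounded_integrable => //.
by exists `|M|; split; rewrite ?num_real// => y My x _ /=; exact: ltW.
Qed.

(** The support lies in a product of two small sets of coordinates. For a bump of radius r the area
    [alpha * beta] is of order r^2 and offsets the r^-2 contained in [M]. *)
Lemma Rintegral_rect_bound a1 b1 a2 b2 f (A B : set (measurableTypeR R)) (M alpha beta : R) :
  (forall x, rect a1 b1 a2 b2 x -> {for x, continuous f}) ->
  measurable A -> measurable B -> 0 <= M -> 0 <= alpha -> 0 <= beta ->
  (mu A <= alpha%:E)%E -> (mu B <= beta%:E)%E ->
  (forall x, rect a1 b1 a2 b2 x -> `|f x| <= M) ->
  (forall x, rect a1 b1 a2 b2 x -> ~ (A x.1 /\ B x.2) -> f x = 0) ->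
  `|\int[mu2]_(x in (rect a1 b1 a2 b2 : set T2)) f x| <= M * (alpha * beta).
Proof.
move=> cf mA mB M0 al0 be0 Aa Bb fM f0.
set Q := rect a1 b1 a2 b2.
have mQ : measurable (Q : set T2) by exact: measurable_rect.
have mAB : measurable (A `*` B : set T2) by exact: measurableX.
have mI : measurable (Q `&` (A `*` B) : set T2) by exact: measurableI.
have intf := integrable_rect cf.
have -> : \int[mu2]_(x in (Q : set T2)) f x =
    \int[mu2]_(x in (Q `&` (A `*` B) : set T2)) f x.
  rewrite [RHS]Rintegral_mkcondr; apply: eq_Rintegral => x /set_mem Qx.
  rewrite patchE; case: ifPn => // /negP nAB; apply: f0 => // -[Ax Bx].
  by apply: nAB; apply: mem_set.
have muI : (mu2 (Q `&` (A `*` B)) <= (alpha * beta)%:E)%E.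
  apply: (@le_trans _ _ (mu2 (A `*` B))).
    by apply: le_measure; rewrite ?inE //; exact: subIsetr.
  by rewrite product_measure1E// EFinM lee_pmul.
have muIfin : (mu2 (Q `&` (A `*` B)) < +oo)%E by exact: le_lt_trans muI (ltry _).
have intI : mu2.-integrable (Q `&` (A `*` B) : set T2) (EFin \o (f : T2 -> R)).
  by apply: integrableS intf => //; exact: subIsetl.
apply: le_trans (le_normr_Rintegral mI intI) _.
apply: (@le_trans _ _ (\int[mu2]_(x in (Q `&` (A `*` B) : set T2)) M)).
  apply: le_Rintegral => //.
  - exact: (integrable_abse intI).
  - exact: integrable_cst2.
  - by move=> x [Qx _]; exact: fM.
rewrite Rintegral_cst// ler_wpM2l//.
by rewrite -lee_fin fineK// ge0_fin_numE.
Qed.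

Lemma Rintegral_rect_gt0 a1 b1 a2 b2 f x0 :
  (forall x, rect a1 b1 a2 b2 x -> {for x, continuous f}) ->
  (forall x, rect a1 b1 a2 b2 x -> 0 <= f x) ->
  a1 < x0.1 < b1 -> a2 < x0.2 < b2 -> 0 < f x0 ->
  0 < \int[mu2]_(x in (rect a1 b1 a2 b2 : set T2)) f x.
Proof.
move=> cf f0 /andP[x1l x1r] /andP[x2l x2r] fx0.
set Q := rect a1 b1 a2 b2.
have Qx0 : Q x0 by split; rewrite /= in_itv /= !ltW.
have mQ : measurable (Q : set T2) by exact: measurable_rect.
have intf := integrable_rect cf.
have : \forall x \near x0, f x0 / 2 < f x.
  have := cf _ Qx0 => /cvgr_gt; apply; lra.
move=> /nbhs_ballP[d /= d0 hd].
pose e := Num.min (d / 2) (Num.min (Num.min (x0.1 - a1) (b1 - x0.1))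
  (Num.min (x0.2 - a2) (b2 - x0.2))).
have e0 : 0 < e by rewrite !lt_min !subr_gt0 x1l x1r x2l x2r divr_gt0.
have [ed e1 e2 e3 e4] : [/\ e <= d / 2, e <= x0.1 - a1, e <= b1 - x0.1,
    e <= x0.2 - a2 & e <= b2 - x0.2].
  by split; rewrite ge_min ?lexx// !ge_min ?lexx ?orbT.
set Q' := rect (x0.1 - e) (x0.1 + e) (x0.2 - e) (x0.2 + e).
have mQ' : measurable (Q' : set T2) by exact: measurable_rect.
have sub : Q' `<=` Q.
  move=> x [/=]; rewrite !in_itv /= => /andP[h1 h2] /andP[h3 h4].
  by split; rewrite /= in_itv /=; apply/andP; split; lra.
have fQ' x : Q' x -> f x0 / 2 <= f x.
  move=> [/=]; rewrite !in_itv /= => /andP[h1 h2] /andP[h3 h4].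
  apply/ltW/hd; split; rewrite /ball /= ltr_distl; apply/andP; split; lra.
have intf' : mu2.-integrable (Q' : set T2) (EFin \o (f : T2 -> R)).
  by apply: integrableS intf.
apply: (@lt_le_trans _ _ (\int[mu2]_(x in (Q' : set T2)) (f x0 / 2))).
  have E : mu2 Q' = ((x0.1 + e - (x0.1 - e)) * (x0.2 + e - (x0.2 - e)))%:E.
    by rewrite product_measure1E//= !mu_segment//; lra.
  rewrite Rintegral_cst// -[fine _]/(fine (mu2 Q')) E /=.
  by rewrite !mulr_gt0//; lra.
apply: (@le_trans _ _ (\int[mu2]_(x in (Q' : set T2)) f x)).
  apply: le_Rintegral => //.
  by apply: integrable_cst2 => //; exact: mu2_rect_fin.
have Efin (D : set T2) : measurable D -> D `<=` Q ->
    (\int[mu2]_(x in D) (f x)%:E \is a fin_num)%E.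
  move=> mD DQ; apply: integrable_fin_num => //.
  exact: integrableS intf.
rewrite /Rintegral fine_le ?Efin//.
by apply: ge0_subset_integral => //; case/integrableP : intf.
Qed.

End plane_integration.

(** * Periodic cutoffs *)

Section flat_exp.
Context {R : realType}.

(* The flat function [exp (-1/y)] on [y > 0]; the weights [y ^- n] close the family
   under differentiation. *)
Definition flatE (n : nat) (y : R) : R :=
  if 0 < y then y^-1 ^+ n * expR (- y^-1) else 0.

Lemma flatE_le0 n y : y <= 0 -> flatE n y = 0.
Proof. by rewrite /flatE ltNge => ->. Qed.

Lemma flatE_ge0 n y : 0 <= flatE n y.
Proof.
rewrite /flatE; case: ifP => // y0.
by rewrite mulr_ge0 ?expR_ge0// exprn_ge0// invr_ge0 ltW.
Qed.

(** For a positive exponent, raise [expR (x / n) >= x / n] to the power n. *)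
Lemma expn_expR_le n (x : R) : 0 <= x -> x ^+ n * expR (- x) <= n%:R ^+ n.
Proof.
move=> x0; case: n => [|n].
  by rewrite !expr0 mul1r -[leRHS]expR0 ler_expR oppr_le0.
have n0 : (0 : R) < n.+1%:R by rewrite ltr0n.
have : (x / n.+1%:R) ^+ n.+1 <= expR x.
  have -> : expR x = expR (x / n.+1%:R) ^+ n.+1.
    by rewrite -expRM_natr divfK// gt_eqF.
  rewrite lerXn2r ?nnegrE ?expR_ge0//; first by rewrite divr_ge0// ltW.
  by apply: le_trans (expR_ge1Dx _); rewrite lerDr.
rewrite expr_div_n ler_pdivrMr ?exprn_gt0// => h.
by rewrite expRN ler_pdivrMr ?expR_gt0// mulrC.
Qed.

Lemma flatE_bound n y : `|flatE n y| <= n%:R ^+ n.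
Proof.
rewrite ger0_norm ?flatE_ge0// /flatE; case: ifP => y0; last by rewrite exprn_ge0.
by apply: expn_expR_le; rewrite invr_ge0 ltW.
Qed.

Lemma is_derive_flatE n (y : R) :
  is_derive y 1 (flatE n) (- n%:R * flatE n.+1 y + flatE n.+2 y).
Proof.
have n10 : (1 : R) != 0 by rewrite oner_eq0.
have [y0|y0|y0] := ltgtP 0 y.
- have -> : - n%:R * flatE n.+1 y + flatE n.+2 y =
      (n%:R * y^-1 ^+ n.-1 * expR (- y^-1) - y^-1 ^+ n * expR (- y^-1)) * (- y ^- 2).
    rewrite /flatE y0; set z := y^-1; rewrite -exprVn -/z.
    by case: n => [|n] /=; rewrite ?mul0r ?oppr0 ?mul0r ?add0r !exprS ?expr0; ring.
  apply: (@near_eq_is_derive _ _ _ (fun y : R => (fun x => x ^+ n * expR (- x)) (y^-1))) => //.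
    near=> z; rewrite /flatE ifT//; near: z; exact: lt_nbhsr.
  have h1 : is_derive (y^-1) 1 (fun x => x ^+ n * expR (- x))
      (n%:R * y^-1 ^+ n.-1 * expR (- y^-1) - y^-1 ^+ n * expR (- y^-1)).
    have hX : is_derive (y^-1) 1 (fun x : R => x ^+ n) (n%:R * y^-1 ^+ n.-1).
      apply: DeriveDef; first exact: exprn_derivable.
      by rewrite exp_derive [_ *: _]mulr1.
    have hE : is_derive (y^-1) 1 (fun x : R => expR (- x)) (- expR (- y^-1)).
      by apply: is_derive_eq; rewrite /GRing.scale /= mulrN1.
    by apply: is_derive_to (is_deriveM hX hE) _; rewrite /GRing.scale /=; ring.
  have h2 : is_derive y 1 (fun y : R => y^-1) (- y ^- 2).
    have y0' : id y != 0 :> R by rewrite gt_eqF.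
    have did : derivable (@id R) y 1 by exact: derivable_id.
    apply: DeriveDef; first exact: (derivableV y0' did).
    by rewrite (deriveV y0' did) derive_id [_ *: _]mulr1.
  exact: (is_derive1_compE erefl h1 h2).
- rewrite !flatE_le0 ?ltW// mulr0 addr0.
  apply: (@near_eq_is_derive _ _ _ (fun=> 0)) => //.
  by near=> z; rewrite flatE_le0// ltW//; near: z; exact: lt_nbhsl.
- rewrite -y0 !flatE_le0// mulr0 addr0.
  suff L : (fun h : R => h^-1 *: (flatE n (h *: 1 + 0) - flatE n 0)) @ 0^' --> (0 : R).
    by apply: DeriveDef; [apply/cvg_ex; eexists; exact: L|exact: cvg_lim L].
  pose M : R := n.+2%:R ^+ n.+2.
  have M0 : 0 < M by rewrite exprn_gt0.
  apply/cvgr0Pnorm_le => e e0; near=> h.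
  have he : `|h| <= e / M.
    near: h; apply: dnbhs0_le; by rewrite divr_gt0.
  rewrite [h *: 1]mulr1 addr0 (@flatE_le0 n 0)// subr0.
  have -> : h^-1 *: flatE n h = h^-1 * flatE n h by [].
  have [h0|h0] := ltP 0 h; last first.
    by rewrite (flatE_le0 _ h0) [_ * 0]mulr0 normr0 ltW.
  (* The division by h is traded for two more powers of the inverse, leaving h times a bounded
     function. *)
  have -> : h^-1 * flatE n h = h * flatE n.+2 h.
    by rewrite /flatE h0 !exprS; field; rewrite gt_eqF.
  rewrite normrM (le_trans (ler_wpM2l _ (flatE_bound n.+2 h)))//.
  by rewrite -ler_pdivlMr.
Unshelve. all: end_near. Qed.

Lemma Ck_flatE k U n (f : R * R -> R) : open U -> Ck_on k U f ->
  Ck_on k U (flatE n \o f).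
Proof.
move=> oU; elim: k n => [|k IH] n hf.
  exact: (@Ck0_comp R U _ (fun y => - n%:R * flatE n.+1 y + flatE n.+2 y) f (fun x _ => is_derive_flatE n (f x))).
have hf' := Ck_pred hf.
apply: (@Ck_comp R k U _ (fun y => - n%:R * flatE n.+1 y + flatE n.+2 y) f oU
  (fun x _ => is_derive_flatE n (f x)) _ hf).
apply: (@Ck_add R k U (fun x => - n%:R * (flatE n.+1 \o f) x) (flatE n.+2 \o f)) => //.
  apply: Ck_scale => //; exact: IH.
exact: IH.
Qed.

(** Nesting the flat function avoids the usual quotient. As [flatE 0 1] is the inverse of [expR 1],
    the inner argument is 1 for y <= 1 and nonpositive for y >= 2. The derivatives [cutoff1] and
    [cutoff2] are polynomials in the bounded functions [flatE n]. *)
Definition cutoff (y : R) : R :=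
  expR 1 * flatE 0 (1 - expR 1 * flatE 0 (y - 1)).
Definition cutoff1 (y : R) : R :=
  - expR 1 ^+ 2 * (flatE 2 (1 - expR 1 * flatE 0 (y - 1)) * flatE 2 (y - 1)).
Definition cutoff2 (y : R) : R :=
  - expR 1 ^+ 2 *
  ((- 2 * flatE 3 (1 - expR 1 * flatE 0 (y - 1)) +
     flatE 4 (1 - expR 1 * flatE 0 (y - 1))) * (- expR 1 * flatE 2 (y - 1)) * flatE 2 (y - 1)
   + flatE 2 (1 - expR 1 * flatE 0 (y - 1)) *
     (- 2 * flatE 3 (y - 1) + flatE 4 (y - 1))).

Lemma flatE01 : flatE 0 1 = (expR 1)^-1.
Proof. by rewrite /flatE ltr01 expr0 mul1r invr1 expRN. Qed.

Lemma flatE0_homo x y : x <= y -> flatE 0 x <= flatE 0 y.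
Proof.
move=> xy; rewrite /flatE !expr0 !mul1r; case: ifPn => x0; last first.
  by case: ifP => // _; exact: expR_ge0.
rewrite (lt_le_trans x0 xy) ler_expR lerN2 lef_pV2// posrE.
exact: lt_le_trans xy.
Qed.

Let flatE0' (y : R) : is_derive y 1 (flatE 0) (flatE 2 y).
Proof. by have := is_derive_flatE 0 y; rewrite mulNr mul0r oppr0 add0r. Qed.

Let flatE_shift n (y D : R) : is_derive (y - 1) 1 (flatE n) D ->
  is_derive y 1 (fun y => flatE n (y - 1)) D.
Proof.
move=> h; rewrite -[D]mulr1; apply: is_derive1_compE h _ => //.
by apply: is_derive_eq; rewrite subr0.
Qed.

Let inner' (y : R) : is_derive y 1 (fun y => 1 - expR 1 * flatE 0 (y - 1))
  (- expR 1 * flatE 2 (y - 1)).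
Proof.
have h := flatE_shift (flatE0' (y - 1)).
by apply: is_derive_eq; rewrite /GRing.scale/=; ring.
Qed.

Lemma is_derive_cutoff (y : R) : is_derive y 1 cutoff (cutoff1 y).
Proof.
have h := @is_derive1_compE _ (flatE 0) (fun y => 1 - expR 1 * flatE 0 (y - 1))
  y _ _ _ erefl (flatE0' _) (inner' y).
rewrite /cutoff; apply: is_derive_eq; rewrite /cutoff1 /GRing.scale/=.
by ring.
Qed.

Lemma is_derive_cutoff1 (y : R) : is_derive y 1 cutoff1 (cutoff2 y).
Proof.
have h1 := @is_derive1_compE _ (flatE 2) (fun y => 1 - expR 1 * flatE 0 (y - 1))
  y _ _ _ erefl (is_derive_flatE 2 _) (inner' y).
have h2 := flatE_shift (is_derive_flatE 2 (y - 1)).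
rewrite /cutoff1; apply: is_derive_eq; rewrite /cutoff2 /GRing.scale/=.
by ring.
Qed.

Lemma cutoff_le1 y : y <= 1 -> [/\ cutoff y = 1, cutoff1 y = 0 & cutoff2 y = 0].
Proof.
move=> y1; rewrite /cutoff /cutoff1 /cutoff2 !(@flatE_le0 _ (y - 1)) ?subr_le0//.
by rewrite !(mulr0, mul0r, addr0, subr0) flatE01 mulfV ?gt_eqF ?expR_gt0.
Qed.

Lemma cutoff_ge2 y : 2 <= y -> [/\ cutoff y = 0, cutoff1 y = 0 & cutoff2 y = 0].
Proof.
move=> y2; have h : 1 - expR 1 * flatE 0 (y - 1) <= 0.
  rewrite subr_le0 -[leLHS](@mulfV _ (expR 1)) ?gt_eqF ?expR_gt0//.
  rewrite ler_wpM2l ?expR_ge0// -flatE01; apply: flatE0_homo; lra.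
rewrite /cutoff /cutoff1 /cutoff2 !(@flatE_le0 _ (1 - _))//.
by rewrite !(mulr0, mul0r, addr0).
Qed.

Lemma cutoff_01 y : 0 <= cutoff y <= 1.
Proof.
rewrite /cutoff mulr_ge0 ?expR_ge0 ?flatE_ge0//=.
rewrite -[leRHS](@mulfV _ (expR 1)) ?gt_eqF ?expR_gt0//.
rewrite ler_wpM2l ?expR_ge0// -flatE01; apply: flatE0_homo.
by rewrite gerBl mulr_ge0 ?expR_ge0 ?flatE_ge0.
Qed.

Lemma cutoff_bound : exists2 A : R, 0 < A &
  forall y, `|cutoff1 y| <= A /\ `|cutoff2 y| <= A.
Proof.
have B n : exists2 b : R, 0 <= b & forall y, `|flatE n y| <= b.
  by exists (n%:R ^+ n); [exact: exprn_ge0|exact: flatE_bound].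
have [b2 b20 h2] := B 2%N; have [b3 b30 h3] := B 3%N; have [b4 b40 h4] := B 4%N.
pose k : R := expR 1; have k0 : 0 < k by exact: expR_gt0.
pose A1 := k ^+ 2 * (b2 * b2).
pose A2 := k ^+ 2 * ((2 * b3 + b4) * (k * b2) * b2 + b2 * (2 * b3 + b4)).
have k20 : 0 <= k ^+ 2 by exact: sqr_ge0.
have b340 : 0 <= 2 * b3 + b4 by rewrite addr_ge0// mulr_ge0.
have kb0 : 0 <= k * b2 by rewrite mulr_ge0// ltW.
have A10 : 0 <= A1 by rewrite /A1 mulr_ge0// mulr_ge0.
have A20 : 0 <= A2.
  by rewrite /A2 mulr_ge0// addr_ge0// mulr_ge0// mulr_ge0.
have hk2 : `|- k ^+ 2| <= k ^+ 2 by rewrite normrN ger0_norm.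
have M (p q c d : R) : `|p| <= c -> `|q| <= d -> `|p * q| <= c * d.
  by move=> h1 h1'; rewrite normrM ler_pM.
have H y : `|- 2 * flatE 3 y + flatE 4 y| <= 2 * b3 + b4.
  apply: (le_trans (ler_normD _ _)); apply: lerD => //.
  by apply: (M) => //; rewrite normrN ger0_norm.
exists (1 + A1 + A2) => [|y]; first by rewrite -addrA ltr_pwDl// addr_ge0.
split.
- apply: (@le_trans _ _ A1); last lra.
  by rewrite /cutoff1; apply: (M) => //; apply: (M).
- apply: (@le_trans _ _ A2); last lra.
  rewrite /cutoff2; apply: (M) => //.
  rewrite (le_trans (ler_normD _ _))// lerD//; last by apply: (M).
  by apply: (M) => //; apply: (M) => //; apply: (M) => //; rewrite normrN gtr0_norm.
Qed.

End flat_exp.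

(** * A periodic stand-in for the squared distance to the integers *)

Section sin_square.
Context {R : realType}.
Implicit Types (s t r : R).

(** Smooth, 1-periodic, and lying between the squared distance to the integers and pi^2 times it. *)
Definition sin2pi s : R := sin (pi * s) ^+ 2.

Lemma sin2pi_ge0 s : 0 <= sin2pi s.
Proof. exact: sqr_ge0. Qed.

Lemma sin2pi0 : sin2pi 0 = 0.
Proof. by rewrite /sin2pi mulr0 sin0 expr0n. Qed.

Lemma sin_pi_nat (n : nat) : sin (pi * n%:R : R) = 0.
Proof.
elim: n => [|n IH]; first by rewrite mulr0 sin0.
by rewrite -natr1 mulrDr mulr1 sinD IH sinpi mulr0 mul0r addr0.
Qed.

Lemma sin_pi_int (k : int) : sin (pi * k%:~R : R) = 0.
Proof.
case: k => n; first by rewrite -pmulrn sin_pi_nat.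
by rewrite NegzE mulrNz mulrN sinN -pmulrn sin_pi_nat oppr0.
Qed.

Lemma sin2piD_int s (k : int) : sin2pi (s + k%:~R) = sin2pi s.
Proof.
rewrite /sin2pi mulrDr sinD sin_pi_int mulr0 addr0 exprMn.
by rewrite cos2sin2 sin_pi_int expr0n subr0 mulr1.
Qed.

Lemma sin2piN s : sin2pi (- s) = sin2pi s.
Proof. by rewrite /sin2pi mulrN sinN sqrrN. Qed.

(** A quasi-triangle inequality: the addition formula, cosines bounded by 1, and (p + q)^2 <= 2 p^2
    + 2 q^2. *)
Lemma sin2piD_le s t : sin2pi (s + t) <= 2 * sin2pi s + 2 * sin2pi t.
Proof.
rewrite /sin2pi mulrDr sinD.
set a := sin _; set c := cos _; set b := cos _; set d := sin _.
have c1 : c ^+ 2 + d ^+ 2 = 1 by rewrite /c /d cos2Dsin2.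
have a1 : b ^+ 2 + a ^+ 2 = 1 by rewrite /a /b cos2Dsin2.
have h1 : a ^+ 2 * c ^+ 2 <= a ^+ 2.
  by rewrite ler_piMr ?sqr_ge0//; have := sqr_ge0 d; lra.
have h2 : b ^+ 2 * d ^+ 2 <= d ^+ 2.
  by rewrite ler_piMl ?sqr_ge0//; have := sqr_ge0 a; lra.
have := sqr_ge0 (a * c - b * d); nra.
Qed.

Lemma sin2pi_le s : sin2pi s <= (pi * s) ^+ 2.
Proof.
have [c _] := @MVT0 R sin cos (pi * s) (fun t _ => is_derive_sin t).
rewrite sin0 subr0 /sin2pi => ->; rewrite exprMn ler_piMl ?sqr_ge0//.
Qed.

Lemma sin2pi_ge s : `|s| <= 2^-1 -> s ^+ 2 <= sin2pi s.
Proof.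
wlog s0 : s / 0 <= s => [H|].
  have [/H//|s0] := leP 0 s; rewrite -sin2piN -sqrrN -normrN.
  by apply: H; rewrite oppr_ge0 ltW.
rewrite ger0_norm// => sh.
have p0 := @pi_gt0 R; have p2 := @pi_ge2 R.
(* At [pi * s] the cosine may vanish; at half the angle, which is at most pi / 4, its square is at
   least 1 / 2. Both factors of sin (2 y) = 2 sin y cos y are then bounded below, and pi >= 2 gives
   [s <= y]. *)
pose y := pi * s / 2.
have y0 : 0 <= y by rewrite /y divr_ge0// mulr_ge0// ltW.
have yp : y <= pi / 4.
  by rewrite /y; have := ler_wpM2l (ltW p0) sh; lra.
have [c cy E] := @MVT0 R sin cos y (fun t _ => is_derive_sin t).
rewrite sin0 subr0 in E.
have cq : cos (pi / 4) ^+ 2 = 2^-1 :> R.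
  have E1 : cos (pi / 4 *+ 2) = cos (pi / 4) ^+ 2 *+ 2 - 1 :> R := cos_mulr2n _.
  have E2 : pi / 4 *+ 2 = pi / 2 :> R by rewrite -mulr_natr; field.
  by move: E1; rewrite E2 cos_pihalf => E1; lra.
have cpos (z : R) : `|z| <= pi / 4 -> 0 <= cos z /\ 2^-1 <= cos z ^+ 2.
  move=> hz.
  have hc : cos (pi / 4) <= cos z.
    rewrite -[cos z]cos_norm; have [->//|nz] := eqVneq `|z| (pi / 4).
    have nz0 := normr_ge0 z.
    apply/ltW; rewrite ltr_cos ?in_itv /=.
    - by rewrite lt_neqAle nz.
    - by apply/andP; split; lra.
    - by apply/andP; split; lra.
  have c0 : 0 <= cos (pi / 4) :> R by apply: cos_ge0_pihalf; apply/andP; split; lra.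
  split; first exact: le_trans hc.
  by rewrite -cq lerXn2r ?nnegrE// (le_trans c0).
have [cc0 cc] := cpos c ltac:(by rewrite (le_trans cy)// ger0_norm).
have [cy0 cyy] := cpos y ltac:(by rewrite ger0_norm).
have E3 : pi * s = y *+ 2 by rewrite /y -mulr_natr divfK// ?pnatr_eq0.
have sy : s <= y by rewrite /y; nra.
rewrite /sin2pi E3 sin_mulr2n E -mulr_natr.
rewrite (_ : (_ * _ * _) ^+ 2 = 4 * (cos y ^+ 2 * cos c ^+ 2) * y ^+ 2); last by ring.
have h1 : 1 <= 4 * (cos y ^+ 2 * cos c ^+ 2) by nra.
have h2 : s ^+ 2 <= y ^+ 2 by rewrite lerXn2r ?nnegrE.
by have := sqr_ge0 y; nra.
Qed.

Lemma near_int s : exists k : int, `|s - k%:~R| <= 2^-1.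
Proof.
exists (Num.floor (s + 2^-1)).
have /andP[] := floor_itv (s + 2^-1); rewrite intrD => h1 h2.
by rewrite ler_norml; apply/andP; split; lra.
Qed.

Lemma sin2pi_dist s : exists2 k : int, `|s - k%:~R| <= 2^-1 &
  (s - k%:~R) ^+ 2 <= sin2pi s.
Proof.
have [k hk] := near_int s; exists k => //.
by rewrite -(sin2piD_int s (- k)) mulrNz; exact: sin2pi_ge.
Qed.

Lemma sin2pi_eq0 s : sin2pi s = 0 -> exists k : int, s = k%:~R.
Proof.
have [k _ p] := sin2pi_dist s => E; rewrite E in p; exists k.
have : (s - k%:~R) ^+ 2 == 0 by rewrite eq_le p sqr_ge0.
by rewrite sqrf_eq0 subr_eq0 => /eqP.
Qed.

Definition theta r s : R := cutoff (sin2pi s / r ^+ 2).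

Let dsin2 r s : R := (2 * pi * (sin (pi * s) * cos (pi * s))) / r ^+ 2.
Let dsin22 r s : R := (2 * pi ^+ 2 * (cos (pi * s) ^+ 2 - sin (pi * s) ^+ 2)) / r ^+ 2.

Definition theta1 r s : R := cutoff1 (sin2pi s / r ^+ 2) * dsin2 r s.
Definition theta2 r s : R := cutoff2 (sin2pi s / r ^+ 2) * dsin2 r s ^+ 2 +
  cutoff1 (sin2pi s / r ^+ 2) * dsin22 r s.

Let is_derive_pi s : is_derive s 1 (fun s => pi * s) (pi : R).
Proof. by apply: is_derive_eq; rewrite /GRing.scale /=; ring. Qed.

Let is_derive_sinpi s : is_derive s 1 (fun s => sin (pi * s)) (cos (pi * s) * pi : R).
Proof. exact: (@is_derive1_compE _ sin (fun s => pi * s) _ _ _ _ erefl (is_derive_sin _)). Qed.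

Let is_derive_cospi s : is_derive s 1 (fun s => cos (pi * s)) (- sin (pi * s) * pi : R).
Proof. exact: (@is_derive1_compE _ cos (fun s => pi * s) _ _ _ _ erefl (is_derive_cos _)). Qed.

Let is_derive_arg r s : is_derive s 1 (fun s => sin2pi s / r ^+ 2) (dsin2 r s).
Proof.
have h := is_derive_sinpi s.
by rewrite /sin2pi; apply: is_derive_eq; rewrite /dsin2 /GRing.scale /=; ring.
Qed.

Let is_derive_dsin2 r s : is_derive s 1 (dsin2 r) (dsin22 r s).
Proof.
have h := is_derive_sinpi s; have h' := is_derive_cospi s.
by rewrite /dsin2; apply: is_derive_eq; rewrite /dsin22 /GRing.scale /=; ring.
Qed.

Lemma is_derive_theta r s : is_derive s 1 (theta r) (theta1 r s).
Proof.
exact: (@is_derive1_compE _ _ (fun s => sin2pi s / r ^+ 2) _ _ _ _ erefl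
  (is_derive_cutoff _) (is_derive_arg r s)).
Qed.

Lemma is_derive_theta1 r s : is_derive s 1 (theta1 r) (theta2 r s).
Proof.
have h := @is_derive1_compE _ _ (fun s => sin2pi s / r ^+ 2) _ _ _ _ erefl
  (is_derive_cutoff1 _) (is_derive_arg r s).
have h' := is_derive_dsin2 r s.
apply: is_derive_to (is_deriveM h h') _.
by rewrite /theta2 /GRing.scale /=; ring.
Qed.

Lemma theta_near r s : sin2pi s <= r ^+ 2 ->
  [/\ theta r s = 1, theta1 r s = 0 & theta2 r s = 0].
Proof.
move=> h; have h1 : sin2pi s / r ^+ 2 <= 1.
  (* The inverse of 0 is 0, so the quotient vanishes when [r = 0]. *)
  have [->|r0] := eqVneq r 0; first by rewrite expr0n invr0 mulr0.
  by rewrite ler_pdivrMr ?mul1r// exprn_even_gt0.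
have [c0 c1 c2] := cutoff_le1 h1.
by rewrite /theta /theta1 /theta2 c0 c1 c2 !mul0r addr0.
Qed.

Lemma theta_far r s : 0 < r -> 2 * r ^+ 2 <= sin2pi s ->
  [/\ theta r s = 0, theta1 r s = 0 & theta2 r s = 0].
Proof.
move=> r0 h; have h1 : 2 <= sin2pi s / r ^+ 2 by rewrite ler_pdivlMr ?exprn_gt0.
have [c0 c1 c2] := cutoff_ge2 h1.
by rewrite /theta /theta1 /theta2 c0 c1 c2 !mul0r addr0.
Qed.

Lemma theta_01 r s : 0 <= theta r s <= 1.
Proof. exact: cutoff_01. Qed.

Lemma thetaD_int r s (k : int) : theta r (s + k%:~R) = theta r s.
Proof. by rewrite /theta sin2piD_int. Qed.

(** The derivative of the argument is a multiple of sin (pi s) cos (pi s) / r^2. Where the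
    derivatives of the cutoff live, the sine is at most 2 r, which turns r^-2 into r^-1; elsewhere
    everything vanishes. *)
Lemma theta_bound : exists2 A : R, 0 < A & forall r s, 0 < r ->
  `|theta1 r s| <= A / r /\ `|theta2 r s| <= A / r ^+ 2.
Proof.
have [A A0 hA] := @cutoff_bound R; have p0 := @pi_gt0 R; have p0' := ltW p0.
pose B1 := A * (4 * pi); pose B2 := A * (4 * pi) ^+ 2 + A * (2 * pi ^+ 2).
have B10 : 0 < B1 by rewrite !mulr_gt0.
have B20 : 0 < B2 by rewrite addr_gt0// !mulr_gt0// ?exprn_gt0// mulr_gt0.
exists (B1 + B2) => [|r s r0]; first exact: addr_gt0.
have [h|h] := leP (2 * r ^+ 2) (sin2pi s).
  have [_ -> ->] := theta_far r0 h; rewrite normr0.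
  have B0 : 0 <= B1 + B2 by rewrite ltW// addr_gt0.
  by split; rewrite divr_ge0// ?sqr_ge0// ltW.
have hs : `|sin (pi * s)| <= 2 * r.
  rewrite -ler_sqr ?nnegrE ?mulr_ge0 ?(ltW r0)//.
  rewrite real_normK ?num_real// (le_trans (ltW h))// exprMn.
  by rewrite ler_wpM2r ?sqr_ge0//; lra.
have hc : `|cos (pi * s)| <= 1 := cos_max _.
have hd : `|dsin2 r s| <= 4 * pi / r.
  rewrite /dsin2 !normrM normfV (ger0_norm (sqr_ge0 r)) (ger0_norm (ltW p0)) ger0_norm//.
  rewrite (_ : 4 * pi / r = 2 * pi * (2 * r * 1) / r ^+ 2); last by field; rewrite gt_eqF.
  apply: ler_wpM2r; first by rewrite invr_ge0 sqr_ge0.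
  apply: ler_wpM2l; first by rewrite mulr_ge0// ltW.
  exact: ler_pM.
have hd2 : `|dsin22 r s| <= 2 * pi ^+ 2 / r ^+ 2.
  rewrite /dsin22 normrM normfV (ger0_norm (sqr_ge0 r)).
  apply: ler_wpM2r; first by rewrite invr_ge0 sqr_ge0.
  rewrite normrM ger0_norm ?mulr_ge0 ?sqr_ge0//.
  rewrite -[leRHS]mulr1; apply: ler_wpM2l; first by rewrite mulr_ge0 ?sqr_ge0.
  have := cos2Dsin2 (pi * s); have := sqr_ge0 (cos (pi * s)); have := sqr_ge0 (sin (pi * s)).
  by rewrite ler_norml => ? ? ?; apply/andP; split; lra.
have [hA1 hA2] := hA (sin2pi s / r ^+ 2).
have ri : 0 <= r^-1 by rewrite invr_ge0 ltW.
have ri2 : 0 <= r ^- 2 by rewrite invr_ge0 sqr_ge0.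
split.
  rewrite /theta1 normrM; apply: (le_trans (ler_pM _ _ hA1 hd)) => //.
  by rewrite mulrA; apply: ler_wpM2r => //; rewrite -/B1; lra.
apply: (le_trans (ler_normD _ _)).
apply: (@le_trans _ _ (B2 / r ^+ 2)); last first.
  by apply: ler_wpM2r => //; lra.
rewrite /B2 mulrDl lerD//.
  rewrite normrM normrX (_ : A * (4 * pi) ^+ 2 / r ^+ 2 = A * (4 * pi / r) ^+ 2); last first.
    by field; rewrite gt_eqF.
  apply: ler_pM => //.
  by rewrite lerXn2r// nnegrE ?(le_trans _ hd).
by rewrite normrM -mulrA; exact: ler_pM.
Qed.

Lemma Ck_theta k r (p q c : R) :
  Ck_on k setT (fun x : R * R => theta r (p * x.1 + q * x.2 + c)).
Proof.
have oT : open [set: R * R] := openT.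
have cP : Ck_on k setT (fun x : R * R => pi * p * x.1 + pi * q * x.2 + pi * c).
  exact: Ck_linear.
have cS := (Ck_sin_cos oT cP).1.
have cA : Ck_on k setT (fun x : R * R => r ^- 2 *
    (sin (pi * p * x.1 + pi * q * x.2 + pi * c) *
     sin (pi * p * x.1 + pi * q * x.2 + pi * c))).
  by apply: Ck_scale => //; exact: (Ck_mul oT cS cS).
have c1 := Ck_sub oT cA (Ck_cst k setT 1).
have c2 := Ck_sub oT (Ck_cst k setT 1) (Ck_scale (expR 1) oT (Ck_flatE 0 oT c1)).
have c3 := Ck_scale (expR 1) oT (Ck_flatE 0 oT c2).
apply: (eq_Ck oT _ c3) => x _; rewrite /theta /cutoff /sin2pi /=.
by congr (_ * flatE 0 (1 - _ * flatE 0 (_ - 1))); rewrite mulrC -expr2 !mulrDr !mulrA.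
Qed.

End sin_square.

Lemma continuous_scale (R : realType) (f : R * R -> R) (c : R) (z : R * R) :
  {for z, continuous f} -> {for z, continuous (fun z => c * f z)}.
Proof. by move=> cf; apply: continuousM => //; exact: cst_continuous. Qed.
Arguments continuous_scale {R f} c {z}.

Lemma continuous_add (R : realType) (f g : R * R -> R) (z : R * R) :
  {for z, continuous f} -> {for z, continuous g} ->
  {for z, continuous (fun z => f z + g z)}.
Proof. exact: continuousD. Qed.

Lemma continuous_mul (R : realType) (f g : R * R -> R) (z : R * R) :
  {for z, continuous f} -> {for z, continuous g} ->
  {for z, continuous (fun z => f z * g z)}.
Proof. exact: continuousM. Qed.

Section rect_linearity.
Context {R : realType}.
Variables (a1 b1 a2 b2 : R) (f g : R * R -> R).
Hypothesis cf : forall x, rect a1 b1 a2 b2 x -> {for x, continuous f}.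
Hypothesis cg : forall x, rect a1 b1 a2 b2 x -> {for x, continuous g}.
Notation mu2 := ((@lebesgue_measure R) \x (@lebesgue_measure R))%E.
Notation T2 := (measurableTypeR R * measurableTypeR R)%type.
Local Notation Q := (rect a1 b1 a2 b2 : set T2).

Lemma Rintegral_rectD : \int[mu2]_(x in Q) (f x + g x) =
  \int[mu2]_(x in Q) f x + \int[mu2]_(x in Q) g x.
Proof. by rewrite RintegralD//; [exact: measurable_rect|exact: integrable_rect..]. Qed.

Lemma Rintegral_rectZ k : \int[mu2]_(x in Q) (k * f x) = k * \int[mu2]_(x in Q) f x.
Proof. by rewrite RintegralZl//; [exact: measurable_rect|exact: integrable_rect]. Qed.

End rect_linearity.

Lemma Rintegral_rect_sum (R : realType) (a1 b1 a2 b2 : R) (I : Type) (r : seq I)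
    (f : I -> R * R -> R) :
  (forall i x, rect a1 b1 a2 b2 x -> {for x, continuous (f i)}) ->
  \int[((@lebesgue_measure R) \x (@lebesgue_measure R))%E]_(x in rect a1 b1 a2 b2)
     (\sum_(i <- r) f i x) =
  \sum_(i <- r)
  \int[((@lebesgue_measure R) \x (@lebesgue_measure R))%E]_(x in rect a1 b1 a2 b2) f i x.
Proof.
move=> cf.
have cs r' x : rect a1 b1 a2 b2 x ->
    {for x, continuous (fun x => \sum_(i <- r') f i x)}.
  move=> Qx; elim: r' => [|i r' IH].
    apply: (@near_eq_continuous _ (fun=> 0)); last exact: cst_continuous.
    by near=> y; rewrite big_nil.
  apply: (@near_eq_continuous _ (fun x => f i x + \sum_(j <- r') f j x)).
    by near=> y; rewrite big_cons.
  by apply: continuousD => //; exact: cf.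
elim: r => [|i r IH].
  rewrite big_nil; under eq_Rintegral do rewrite big_nil.
  by rewrite Rintegral_cst ?mul0r//; exact: measurable_rect.
rewrite big_cons -IH -Rintegral_rectD//; last by move=> x; exact: cs.
  by apply: eq_Rintegral => x _; rewrite big_cons.
exact: cf.
Unshelve. all: end_near. Qed.

(** * Lattice coordinates *)

Section lattice.
Context {R : realType}.
Variables (a b : R * R).
Hypothesis hab : lin_indep2 a b.
Notation mu2 := ((@lebesgue_measure R) \x (@lebesgue_measure R))%E.
Notation T2 := (measurableTypeR R * measurableTypeR R)%type.
Implicit Types (x y : R * R) (f h : R * R -> R).

(* Cramer's rule: [x = cs x *: a + ct x *: b], see [pt_cst]. *)
Definition ldet : R := a.1 * b.2 - a.2 * b.1.
Definition cs x : R := (x.1 * b.2 - x.2 * b.1) / ldet.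
Definition ct x : R := (a.1 * x.2 - a.2 * x.1) / ldet.
Definition pt (z : R * R) : R * R := z.1 *: a + z.2 *: b.
Definition lat (m n : int) : R * R := a *~ m + b *~ n.
Definition periodic2 (T : Type) (f : R * R -> T) :=
  forall x m n, f (x + lat m n) = f x.

Lemma pairE x y : x.1 = y.1 -> x.2 = y.2 -> x = y.
Proof. by case: x y => ? ? [? ?] /= -> ->. Qed.

Lemma pt1 z : (pt z).1 = z.1 * a.1 + z.2 * b.1. Proof. by []. Qed.
Lemma pt2 z : (pt z).2 = z.1 * a.2 + z.2 * b.2. Proof. by []. Qed.

Lemma csD x y : cs (x + y) = cs x + cs y.
Proof. by rewrite /cs /=; ring. Qed.
Lemma ctD x y : ct (x + y) = ct x + ct y.
Proof. by rewrite /ct /=; ring. Qed.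
Lemma csN x : cs (- x) = - cs x.
Proof. by rewrite /cs /=; ring. Qed.
Lemma ctN x : ct (- x) = - ct x.
Proof. by rewrite /ct /=; ring. Qed.
Lemma csB x y : cs (x - y) = cs x - cs y.
Proof. by rewrite /cs /=; ring. Qed.
Lemma ctB x y : ct (x - y) = ct x - ct y.
Proof. by rewrite /ct /=; ring. Qed.

Let ldet0 : ldet != 0. Proof. exact: hab. Qed.

Lemma cs_pt z : cs (pt z) = z.1.
Proof. by rewrite /cs pt1 pt2; move: ldet0; rewrite /ldet => ?; field. Qed.
Lemma ct_pt z : ct (pt z) = z.2.
Proof. by rewrite /ct pt1 pt2; move: ldet0; rewrite /ldet => ?; field. Qed.
Lemma pt_cst x : pt (cs x, ct x) = x.
Proof.
by apply: pairE; rewrite ?pt1 ?pt2 /cs /ct /=; move: ldet0; rewrite /ldet => ?; field.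
Qed.

Lemma lat_pt m n : lat m n = pt (m%:~R, n%:~R).
Proof. by rewrite /lat /pt /= !scaler_int. Qed.

Lemma lat_opp m n : - lat m n = lat (- m) (- n).
Proof. by rewrite /lat !mulrNz opprD. Qed.

Lemma lat00 : lat 0 0 = 0.
Proof. by rewrite /lat !mulr0z addr0. Qed.

Lemma cs_lat m n : cs (lat m n) = m%:~R. Proof. by rewrite lat_pt cs_pt. Qed.
Lemma ct_lat m n : ct (lat m n) = n%:~R. Proof. by rewrite lat_pt ct_pt. Qed.

Lemma pt_D z z' : pt (z + z') = pt z + pt z'.
Proof. by rewrite /pt /= !scalerDl addrACA. Qed.

Lemma coord_bound : exists2 L : R, 0 < L & forall x,
  sqnorm x <= L * (cs x ^+ 2 + ct x ^+ 2) /\ cs x ^+ 2 + ct x ^+ 2 <= L * sqnorm x.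
Proof.
pose S := a.1 ^+ 2 + a.2 ^+ 2 + b.1 ^+ 2 + b.2 ^+ 2.
pose L1 := 2 * S; pose L2 := 2 * S / ldet ^+ 2.
have S0 : 0 <= S by rewrite !addr_ge0 ?sqr_ge0.
have d2 : 0 < ldet ^+ 2 by rewrite exprn_even_gt0.
have L10 : 0 <= L1 by rewrite mulr_ge0.
have L20 : 0 <= L2 by apply: divr_ge0; [exact: mulr_ge0|exact: ltW].
have cs2 p q r s : (p * q + r * s) ^+ 2 <= 2 * (p ^+ 2 * q ^+ 2 + r ^+ 2 * s ^+ 2) :> R.
  by have := sqr_ge0 (p * q - r * s); nra.
exists (1 + L1 + L2) => [|x]; first lra.
split.
  apply: (@le_trans _ _ (L1 * (cs x ^+ 2 + ct x ^+ 2))); last first.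
    by apply: ler_wpM2r; [rewrite addr_ge0 ?sqr_ge0|lra].
  rewrite -{1}(pt_cst x) /sqnorm pt1 pt2 /=.
  have := cs2 (cs x) a.1 (ct x) b.1; have := cs2 (cs x) a.2 (ct x) b.2.
  rewrite /L1 /S; have := sqr_ge0 (cs x); have := sqr_ge0 (ct x).
  have := sqr_ge0 a.1; have := sqr_ge0 a.2; have := sqr_ge0 b.1; have := sqr_ge0 b.2.
  move: (cs x ^+ 2) (ct x ^+ 2) (a.1 ^+ 2) (a.2 ^+ 2) (b.1 ^+ 2) (b.2 ^+ 2).
  by move=> *; nra.
apply: (@le_trans _ _ (L2 * sqnorm x)); last first.
  by apply: ler_wpM2r; [rewrite addr_ge0 ?sqr_ge0|lra].
rewrite /cs /ct !expr_div_n -mulrDl /L2 -mulrA [_^-1 * _]mulrC mulrA.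
apply: ler_wpM2r; first by rewrite invr_ge0 ltW.
have := cs2 x.1 b.2 (- x.2) b.1; have := cs2 a.1 x.2 (- a.2) x.1.
rewrite !sqrrN !mulNr /sqnorm /S.
have := sqr_ge0 x.1; have := sqr_ge0 x.2.
have := sqr_ge0 a.1; have := sqr_ge0 a.2; have := sqr_ge0 b.1; have := sqr_ge0 b.2.
move: (x.1 ^+ 2) (x.2 ^+ 2) (a.1 ^+ 2) (a.2 ^+ 2) (b.1 ^+ 2) (b.2 ^+ 2).
by move=> *; nra.
Qed.

(* A smooth lattice-periodic substitute for the squared distance to the lattice. *)
Definition kap x : R := sin2pi (cs x) + sin2pi (ct x).

Lemma kap_ge0 x : 0 <= kap x.
Proof. by rewrite addr_ge0 ?sin2pi_ge0. Qed.

Lemma kap_lat : periodic2 kap.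
Proof.
by move=> x m n; rewrite /kap csD ctD cs_lat ct_lat !sin2piD_int.
Qed.

Lemma kapN x : kap (- x) = kap x.
Proof. by rewrite /kap csN ctN !sin2piN. Qed.

Lemma kapD_le x y : kap (x + y) <= 2 * kap x + 2 * kap y.
Proof.
rewrite /kap csD ctD.
have := sin2piD_le (cs x) (cs y); have := sin2piD_le (ct x) (ct y).
by move=> *; lra.
Qed.

Lemma kap_le x : kap x <= pi ^+ 2 * (cs x ^+ 2 + ct x ^+ 2).
Proof. by rewrite /kap mulrDr -!exprMn lerD// sin2pi_le. Qed.

Lemma kap_dist x : exists m n, [/\ `|cs (x - lat m n)| <= 2^-1, `|ct (x - lat m n)| <= 2^-1,
  cs (x - lat m n) ^+ 2 <= sin2pi (cs x) & ct (x - lat m n) ^+ 2 <= sin2pi (ct x)].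
Proof.
have [m hm m2] := sin2pi_dist (cs x); have [n hn n2] := sin2pi_dist (ct x).
by exists m, n; rewrite csB ctB cs_lat ct_lat.
Qed.

Lemma kap_eq0 x : kap x = 0 -> exists m n, x = lat m n.
Proof.
move=> h; have := sin2pi_ge0 (cs x); have := sin2pi_ge0 (ct x).
move: h; rewrite /kap => h h1 h2.
have /sin2pi_eq0[m hm] : sin2pi (cs x) = 0 by lra.
have /sin2pi_eq0[n hn] : sin2pi (ct x) = 0 by lra.
by exists m, n; rewrite lat_pt -hm -hn pt_cst.
Qed.

Lemma kap0 : kap 0 = 0.
Proof. by rewrite /kap /cs /ct /= !(mulr0, mul0r, subr0) sin2pi0 addr0. Qed.

Lemma cs_lin x : cs x = b.2 / ldet * x.1 + - b.1 / ldet * x.2 + 0.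
Proof. by rewrite /cs; ring. Qed.
Lemma ct_lin x : ct x = - a.2 / ldet * x.1 + a.1 / ldet * x.2 + 0.
Proof. by rewrite /ct; ring. Qed.

Lemma Ck_cs k (c : R) : Ck_on k setT (fun x => cs x + c).
Proof.
apply: (eq_Ck openT _ (Ck_linear k (b.2 / ldet) (- b.1 / ldet) c openT)) => x _.
by rewrite cs_lin addr0.
Qed.

Lemma Ck_ct k (c : R) : Ck_on k setT (fun x => ct x + c).
Proof.
apply: (eq_Ck openT _ (Ck_linear k (- a.2 / ldet) (a.1 / ldet) c openT)) => x _.
by rewrite ct_lin addr0.
Qed.

Lemma cs_continuous : continuous cs.
Proof.
move=> x; apply: (@near_eq_continuous _ (fun x => cs x + 0)).
  by near=> y; rewrite addr0.
exact: (Ck_continuous (Ck_cs 0 0)).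
Unshelve. all: end_near. Qed.

Lemma ct_continuous : continuous ct.
Proof.
move=> x; apply: (@near_eq_continuous _ (fun x => ct x + 0)).
  by near=> y; rewrite addr0.
exact: (Ck_continuous (Ck_ct 0 0)).
Unshelve. all: end_near. Qed.

Lemma sin2pi_continuous : continuous (@sin2pi R).
Proof.
move=> s; have h := is_derive_theta (1 : R) s.
have := @is_derive1_continuous R _ (@sin2pi R) s (2 * (sin (pi * s) * (cos (pi * s) * pi))).
apply.
have h1 : is_derive s 1 (fun s => pi * s) (pi : R).
  by apply: is_derive_eq; rewrite /GRing.scale /=; ring.
have h2 := @is_derive1_compE _ sin (fun s => pi * s) _ _ _ _ erefl (is_derive_sin _) h1.
by rewrite /sin2pi; apply: is_derive_eq; rewrite /GRing.scale /=; ring.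
Qed.

Lemma kap_continuous : continuous kap.
Proof.
move=> x; apply: (@continuousD _ _ _ (fun x => sin2pi (cs x)) (fun x => sin2pi (ct x))).
  apply: (@continuous_comp _ _ _ cs (@sin2pi R)); first exact: cs_continuous.
  exact: sin2pi_continuous.
apply: (@continuous_comp _ _ _ ct (@sin2pi R)); first exact: ct_continuous.
exact: sin2pi_continuous.
Qed.

Lemma subr_continuous (P : R * R) : continuous (fun x : R * R => x - P).
Proof. by move=> x; apply: cvgB; [exact: cvg_id|exact: cvg_cst]. Qed.

Lemma kapB_continuous (P : R * R) : continuous (fun x => kap (x - P)).
Proof.
move=> x; apply: (@continuous_comp _ _ _ (fun x => x - P) kap).
  exact: subr_continuous.
exact: kap_continuous.
Qed.

Lemma pt_continuous : continuous pt.
Proof.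
move=> z; apply: cvgD; apply: cvgZl; [exact: cvg_fst|exact: cvg_snd].
Qed.

Lemma comp_pt_continuous f z : {for pt z, continuous f} ->
  {for z, continuous (fun z => f (pt z))}.
Proof.
by move=> cf; apply: (@continuous_comp _ _ _ pt f) => //; exact: pt_continuous.
Qed.

Definition cell (s0 t0 : R) := rect s0 (s0 + 1) t0 (t0 + 1).
(** The constant Jacobian of the change of coordinates is dropped: the integrals serve only through
    their vanishing and through bounds up to a constant. *)
Definition Icell (s0 t0 : R) f : R :=
  \int[mu2]_(z in (cell s0 t0 : set T2)) f (pt z).

Lemma line_s_derive U h (z : R * R) : open U -> Ck_on 1 U h -> U (pt z) ->
  is_derive z.1 1 (fun s => h (pt (s, z.2)))
    (a.1 * partial1 h (pt z) + a.2 * partial2 h (pt z)).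
Proof.
move=> oU ch Uz; rewrite /pt /=.
by apply: (@is_derive_line R _ h a (z.2 *: b) z.1); exact: (C1_is_derive a oU ch).
Qed.

Lemma line_t_derive U h (z : R * R) : open U -> Ck_on 1 U h -> U (pt z) ->
  is_derive z.2 1 (fun t => h (pt (z.1, t)))
    (b.1 * partial1 h (pt z) + b.2 * partial2 h (pt z)).
Proof.
move=> oU ch Uz; rewrite /pt /=.
rewrite (_ : (fun t => h (z.1 *: a + t *: b)) = (fun t => h (t *: b + z.1 *: a))); last first.
  by apply/funext => t; rewrite addrC.
apply: (@is_derive_line R _ h b (z.1 *: a) z.2); rewrite addrC.
exact: (C1_is_derive b oU ch).
Qed.

(** By periodicity, the fundamental theorem of calculus along the sides of the cell kills the
    derivatives in the directions [a] and [b]; linear independence then recovers the two Cartesian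
    ones. *)
Lemma Icell_partial h s0 t0 : Ck_on 1 setT h -> periodic2 h ->
  Icell s0 t0 (partial1 h) = 0 /\ Icell s0 t0 (partial2 h) = 0.
Proof.
move=> ch ph; have [_ [_ _ [c1 _] [c2 _]]] := ch.
have k1 (z : R * R) : {for z, continuous (fun z => partial1 h (pt z))}.
  by apply: comp_pt_continuous; exact: c1.
have k2 (z : R * R) : {for z, continuous (fun z => partial2 h (pt z))}.
  by apply: comp_pt_continuous; exact: c2.
have Da : Icell s0 t0 (fun x => a.1 * partial1 h x + a.2 * partial2 h x) = 0.
  apply: (@rect_ibp1 R (fun z => h (pt z))
    (fun z => a.1 * partial1 h (pt z) + a.2 * partial2 h (pt z))).
  - by rewrite ltrDl.
  - by move=> z _; exact: line_s_derive openT ch _.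
  - move=> z _; apply: continuous_add; apply: continuous_scale; [exact: (k1 z)|exact: (k2 z)].
  - move=> t _; rewrite -[LHS](ph _ (- 1) 0); congr h.
    rewrite lat_pt -pt_D; congr pt.
    by apply: pairE; rewrite /= ?mulrN1z ?addrK ?addr0.
have Db : Icell s0 t0 (fun x => b.1 * partial1 h x + b.2 * partial2 h x) = 0.
  apply: (@rect_ibp2 R (fun z => h (pt z))
    (fun z => b.1 * partial1 h (pt z) + b.2 * partial2 h (pt z))).
  - by rewrite ltrDl.
  - by move=> z _; exact: line_t_derive openT ch _.
  - move=> z _; apply: continuous_add; apply: continuous_scale; [exact: (k1 z)|exact: (k2 z)].
  - move=> s _; rewrite -[LHS](ph _ 0 (- 1)); congr h.
    rewrite lat_pt -pt_D; congr pt.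
    by apply: pairE; rewrite /= ?mulrN1z ?addrK ?addr0.
pose I1 := Icell s0 t0 (partial1 h); pose I2 := Icell s0 t0 (partial2 h).
have Q (p q : R) : Icell s0 t0 (fun x => p * partial1 h x + q * partial2 h x) = p * I1 + q * I2.
  have k1' z (_ : cell s0 t0 z) := continuous_scale p (k1 z).
  have k2' z (_ : cell s0 t0 z) := continuous_scale q (k2 z).
  have k1'' z (_ : cell s0 t0 z) := k1 z; have k2'' z (_ : cell s0 t0 z) := k2 z.
  exact: (etrans (Rintegral_rectD k1' k2')
    (f_equal2 +%R (Rintegral_rectZ k1'' p) (Rintegral_rectZ k2'' q))).
rewrite Q in Da; rewrite Q in Db.
have E1 : ldet * I1 = 0.
  have -> : ldet * I1 = b.2 * (a.1 * I1 + a.2 * I2) - a.2 * (b.1 * I1 + b.2 * I2).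
    by rewrite /ldet; ring.
  by rewrite Da Db; ring.
have E2 : ldet * I2 = 0.
  have -> : ldet * I2 = a.1 * (b.1 * I1 + b.2 * I2) - b.1 * (a.1 * I1 + a.2 * I2).
    by rewrite /ldet; ring.
  by rewrite Da Db; ring.
split.
  by apply/eqP; move/eqP: E1; rewrite mulf_eq0 (negbTE ldet0).
by apply/eqP; move/eqP: E2; rewrite mulf_eq0 (negbTE ldet0).
Qed.

End lattice.

(** * Rules for the Laplacian *)

Section laplacian_rules.
Context {R : realType}.
Implicit Types (U : set (R * R)) (f g : R * R -> R).

Lemma Ck_partial1 k U f : Ck_on k.+1 U f -> Ck_on k U (partial1 f).
Proof. by move=> [_ [_ _ h _]]. Qed.

Lemma Ck_partial2 k U f : Ck_on k.+1 U f -> Ck_on k U (partial2 f).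
Proof. by move=> [_ [_ _ _ h]]. Qed.

Lemma Ck_derivable1 k U f x : Ck_on k.+1 U f -> U x -> derivable f x (1, 0).
Proof. by move=> [_ [h _ _ _]] Ux; exact: h. Qed.

Lemma Ck_derivable2 k U f x : Ck_on k.+1 U f -> U x -> derivable f x (0, 1).
Proof. by move=> [_ [_ h _ _]] Ux; exact: h. Qed.

Lemma Ck_laplacian k U f : open U -> Ck_on k.+2 U f -> Ck_on k U (laplacian f).
Proof.
move=> oU h; apply: (Ck_add oU (Ck_partial1 (Ck_partial1 h)) (Ck_partial2 (Ck_partial2 h))).
Qed.

Lemma eq_partial1 U f g x : open U -> {in U, f =1 g} -> U x ->
  partial1 f x = partial1 g x.
Proof.
move=> oU fg Ux; apply: near_eq_derive; last exact: eq_near_nbhs fg Ux.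
Qed.

Lemma eq_partial2 U f g x : open U -> {in U, f =1 g} -> U x ->
  partial2 f x = partial2 g x.
Proof.
move=> oU fg Ux; apply: near_eq_derive; last exact: eq_near_nbhs fg Ux.
Qed.

Lemma eq_laplacian U f g x : open U -> {in U, f =1 g} -> U x ->
  laplacian f x = laplacian g x.
Proof.
move=> oU fg Ux.
have e1 : partial1 (partial1 f) x = partial1 (partial1 g) x :=
  eq_partial1 oU (fun y hy => eq_partial1 oU fg (set_mem hy)) Ux.
have e2 : partial2 (partial2 f) x = partial2 (partial2 g) x :=
  eq_partial2 oU (fun y hy => eq_partial2 oU fg (set_mem hy)) Ux.
by rewrite /laplacian e1 e2.
Qed.

Section pointwise.
Variables (U : set (R * R)) (x : R * R).
Hypotheses (oU : open U) (Ux : U x).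

Lemma partial1D f g : Ck_on 1 U f -> Ck_on 1 U g ->
  partial1 (fun x => f x + g x) x = partial1 f x + partial1 g x.
Proof.
move=> hf hg.
exact: (deriveD (Ck_derivable1 hf Ux) (Ck_derivable1 hg Ux)).
Qed.

Lemma partial2D f g : Ck_on 1 U f -> Ck_on 1 U g ->
  partial2 (fun x => f x + g x) x = partial2 f x + partial2 g x.
Proof.
move=> hf hg.
exact: (deriveD (Ck_derivable2 hf Ux) (Ck_derivable2 hg Ux)).
Qed.

Lemma partial1M f g : Ck_on 1 U f -> Ck_on 1 U g ->
  partial1 (fun x => f x * g x) x = f x * partial1 g x + g x * partial1 f x.
Proof.
move=> hf hg.
exact: (deriveM (Ck_derivable1 hf Ux) (Ck_derivable1 hg Ux)).
Qed.

Lemma partial2M f g : Ck_on 1 U f -> Ck_on 1 U g ->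
  partial2 (fun x => f x * g x) x = f x * partial2 g x + g x * partial2 f x.
Proof.
move=> hf hg.
exact: (deriveM (Ck_derivable2 hf Ux) (Ck_derivable2 hg Ux)).
Qed.

Lemma partial1Z (c : R) f : Ck_on 1 U f ->
  partial1 (fun x => c * f x) x = c * partial1 f x.
Proof. by move=> hf; exact: (deriveZ c (Ck_derivable1 hf Ux)). Qed.

Lemma partial2Z (c : R) f : Ck_on 1 U f ->
  partial2 (fun x => c * f x) x = c * partial2 f x.
Proof. by move=> hf; exact: (deriveZ c (Ck_derivable2 hf Ux)). Qed.

Lemma partial1_comp (F : R -> R) (F' : R) f : Ck_on 1 U f ->
  is_derive (f x) 1 F F' -> partial1 (F \o f) x = F' * partial1 f x.
Proof.
move=> hf hF; have := derive_comp1 hF (Ck_derivable1 hf Ux) => h.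
by rewrite /partial1 derive_val.
Qed.

Lemma partial2_comp (F : R -> R) (F' : R) f : Ck_on 1 U f ->
  is_derive (f x) 1 F F' -> partial2 (F \o f) x = F' * partial2 f x.
Proof.
move=> hf hF; have := derive_comp1 hF (Ck_derivable2 hf Ux) => h.
by rewrite /partial2 derive_val.
Qed.

End pointwise.

Section laplacian_pointwise.
Variables (U : set (R * R)) (x : R * R).
Hypotheses (oU : open U) (Ux : U x).

Lemma laplacianD f g : Ck_on 2 U f -> Ck_on 2 U g ->
  laplacian (fun x => f x + g x) x = laplacian f x + laplacian g x.
Proof.
move=> hf hg; have hf1 := Ck_pred hf; have hg1 := Ck_pred hg.
rewrite /laplacian (@eq_partial1 U _ (fun x => partial1 f x + partial1 g x))//; last first.
  by move=> y /set_mem Uy; exact: (partial1D Uy hf1 hg1).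
rewrite (@eq_partial2 U (partial2 _) (fun x => partial2 f x + partial2 g x))//; last first.
  by move=> y /set_mem Uy; exact: (partial2D Uy hf1 hg1).
rewrite (partial1D Ux (Ck_partial1 hf) (Ck_partial1 hg)).
rewrite (partial2D Ux (Ck_partial2 hf) (Ck_partial2 hg)).
exact: addrACA.
Qed.

Lemma laplacianZ (c : R) f : Ck_on 2 U f ->
  laplacian (fun x => c * f x) x = c * laplacian f x.
Proof.
move=> hf; have hf1 := Ck_pred hf.
rewrite /laplacian (@eq_partial1 U _ (fun x => c * partial1 f x))//; last first.
  by move=> y /set_mem Uy; exact: (partial1Z Uy c hf1).
rewrite (@eq_partial2 U (partial2 _) (fun x => c * partial2 f x))//; last first.
  by move=> y /set_mem Uy; exact: (partial2Z Uy c hf1).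
by rewrite (partial1Z Ux _ (Ck_partial1 hf)) (partial2Z Ux _ (Ck_partial2 hf)) mulrDr.
Qed.

Lemma laplacianN f : Ck_on 2 U f -> laplacian (fun x => - f x) x = - laplacian f x.
Proof.
move=> hf; rewrite -mulN1r -(laplacianZ (- 1) hf); apply: eq_laplacian oU _ Ux => y _.
by rewrite mulN1r.
Qed.

Lemma laplacian_comp (F F1 F2 : R -> R) f : Ck_on 2 U f ->
  (forall y, U y -> is_derive (f y) 1 F (F1 (f y))) ->
  (forall y, U y -> is_derive (f y) 1 F1 (F2 (f y))) ->
  laplacian (F \o f) x =
  F2 (f x) * (partial1 f x ^+ 2 + partial2 f x ^+ 2) + F1 (f x) * laplacian f x.
Proof.
move=> hf dF dF1; have hf1 := Ck_pred hf.
have d1 y (Uy : U y) := derive_comp1 (dF1 _ Uy) (Ck_derivable1 hf1 Uy).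
have d2 y (Uy : U y) := derive_comp1 (dF1 _ Uy) (Ck_derivable2 hf1 Uy).
rewrite /laplacian (@eq_partial1 U _ (fun x => (F1 \o f) x * partial1 f x))//; last first.
  by move=> y /set_mem Uy; exact: (partial1_comp Uy hf1 (dF _ Uy)).
rewrite (@eq_partial2 U (partial2 _) (fun x => (F1 \o f) x * partial2 f x))//; last first.
  by move=> y /set_mem Uy; exact: (partial2_comp Uy hf1 (dF _ Uy)).
have p1 := d1 _ Ux; have p2 := d2 _ Ux.
have e1 : derivable (F1 \o f) x (1, 0) := @ex_derive _ _ _ _ _ _ _ p1.
have e2 : derivable (F1 \o f) x (0, 1) := @ex_derive _ _ _ _ _ _ _ p2.
have q1 : partial1 (fun x => (F1 \o f) x * partial1 f x) x =
    F1 (f x) * partial1 (partial1 f) x + partial1 f x * (F2 (f x) * partial1 f x).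
  rewrite -[F2 (f x) * _](@derive_val _ _ _ _ _ _ _ p1).
  exact: (deriveM e1 (Ck_derivable1 (Ck_partial1 hf) Ux)).
have q2 : partial2 (fun x => (F1 \o f) x * partial2 f x) x =
    F1 (f x) * partial2 (partial2 f) x + partial2 f x * (F2 (f x) * partial2 f x).
  rewrite -[F2 (f x) * _](@derive_val _ _ _ _ _ _ _ p2).
  exact: (deriveM e2 (Ck_derivable2 (Ck_partial2 hf) Ux)).
rewrite q1 q2.
move: (F1 _) (F2 _) (partial1 f x) (partial2 f x) (partial1 (partial1 f) x)
  (partial2 (partial2 f) x) => *; ring.
Qed.

Lemma green_divergence f g : Ck_on 2 U f -> Ck_on 2 U g ->
  partial1 (fun x => f x * partial1 g x - g x * partial1 f x) x +
  partial2 (fun x => f x * partial2 g x - g x * partial2 f x) x =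
  f x * laplacian g x - g x * laplacian f x.
Proof.
move=> hf hg; have hf1 := Ck_pred hf; have hg1 := Ck_pred hg.
have m1 := Ck_mul oU hf1 (Ck_partial1 hg); have m2 := Ck_mul oU hg1 (Ck_partial1 hf).
have m3 := Ck_mul oU hf1 (Ck_partial2 hg); have m4 := Ck_mul oU hg1 (Ck_partial2 hf).
rewrite (partial1D Ux m1 (Ck_opp oU m2)) (partial2D Ux m3 (Ck_opp oU m4)).
have -> : partial1 (fun x => - (g x * partial1 f x)) x = - partial1 (fun x => g x * partial1 f x) x.
  exact: (deriveN (Ck_derivable1 m2 Ux)).
have -> : partial2 (fun x => - (g x * partial2 f x)) x = - partial2 (fun x => g x * partial2 f x) x.
  exact: (deriveN (Ck_derivable2 m4 Ux)).
rewrite (partial1M Ux hf1 (Ck_partial1 hg)) (partial1M Ux hg1 (Ck_partial1 hf)).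
rewrite (partial2M Ux hf1 (Ck_partial2 hg)) (partial2M Ux hg1 (Ck_partial2 hf)).
rewrite /laplacian.
move: (f x) (g x) (partial1 f x) (partial1 g x) (partial2 f x) (partial2 g x)
  (partial1 (partial1 f) x) (partial2 (partial2 f) x)
  (partial1 (partial1 g) x) (partial2 (partial2 g) x) => *; ring.
Qed.

End laplacian_pointwise.

Lemma is_deriveV1 (y : R) : y != 0 -> is_derive y 1 (fun y => y^-1) (- (y^-1 * y^-1)).
Proof.
move=> y0; have did : derivable (@id R) y 1 by exact: derivable_id.
have y0' : id y != 0 by [].
apply: DeriveDef; first exact: (derivableV y0' did).
by rewrite (deriveV y0' did) derive_id [_ *: _]mulr1 expr2 invfM.
Qed.

Lemma Ck_inv k U f : open U -> (forall x, U x -> f x != 0) -> Ck_on k U f ->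
  Ck_on k U (fun x => (f x)^-1).
Proof.
move=> oU f0; elim: k => [|k IH] hf.
  exact: (@Ck0_comp R U (fun y => y^-1) (fun y => - (y^-1 * y^-1)) f
    (fun x Ux => is_deriveV1 (f0 x Ux)) hf).
have hi := IH (Ck_pred hf).
exact: (@Ck_comp R k U (fun y => y^-1) (fun y => - (y^-1 * y^-1)) f oU
  (fun x Ux => is_deriveV1 (f0 x Ux)) (Ck_opp oU (Ck_mul oU hi hi)) hf).
Qed.

Lemma Ck_ln k U f : open U -> (forall x, U x -> 0 < f x) -> Ck_on k U f ->
  Ck_on k U (fun x => ln (f x)).
Proof.
move=> oU f0 hf.
have d x (Ux : U x) : is_derive (f x) 1 (@ln R) (f x)^-1 := is_derive1_ln (f0 x Ux).
case: k hf => [|k] hf; first exact: (@Ck0_comp R U _ _ f d hf).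
apply: (@Ck_comp R k U (@ln R) (fun y => y^-1) f oU d _ hf).
apply: (Ck_inv oU _ (Ck_pred hf)) => x Ux; by rewrite gt_eqF ?f0.
Qed.

(** At the maximum the first derivative vanishes. A positive [d2] would make it positive just to the
    right, and the mean value theorem would produce a value above the maximum. *)
Lemma second_derivative_max (f f' : R -> R) (x d2 : R) :
  (\forall t \near x, is_derive (t : R) 1 f (f' t)) -> is_derive x 1 f' d2 ->
  (\forall t \near x, f t <= f x) -> d2 <= 0.
Proof.
move=> df df' fmax; rewrite leNgt; apply/negP => d20.
have /nbhs_ballP [e /= e0 he] : \forall t \near x, is_derive (t : R) 1 f (f' t) /\ f t <= f x.
  by near=> t; split; near: t.
have hb (t : R) : `|t - x| < e -> is_derive t 1 f (f' t) /\ f t <= f x.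
  by move=> h; apply: he; rewrite /ball /= distrC.
have f'x0 : f' x = 0.
  have xe : x - e < x + e by lra.
  have dd : {in `]x - e, x + e[, forall t, derivable f t 1}.
    move=> t; rewrite in_itv /= => /andP[h1 h2].
    have [|dt _] := hb t; first by rewrite ltr_distl; apply/andP; split; lra.
    exact: ex_derive.
  have xin : x \in `]x - e, x + e[ by rewrite in_itv /=; apply/andP; split; lra.
  have mx t : t \in `]x - e, x + e[ -> f t <= f x.
    rewrite in_itv /= => /andP[h1 h2].
    by have [|_ ->] := hb t; first by rewrite ltr_distl; apply/andP; split; lra.
  have h0 := derive1_at_max (ltW xe) dd xin mx.
  have [|dx _] := hb x; first by rewrite subrr normr0.
  by rewrite -(@derive_val _ _ _ _ _ _ _ dx) (@derive_val _ _ _ _ _ _ _ h0).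
have : (fun h : R => h^-1 *: (f' (h *: 1 + x) - f' x)) @ 0^' --> d2.
  by case: df' => dd <-; exact: dd.
move=> /cvgr_gt /(_ 0 d20) /nbhs_ballP [r /= r0 hr].
have f'pos t : x < t < x + r -> 0 < f' t.
  move=> /andP[t1 t2]; have := hr (t - x).
  rewrite /ball /= sub0r normrN [(t - x) *: 1]mulr1 subrK f'x0 subr0.
  rewrite [_ *: _](_ : _ = (t - x)^-1 * f' t)//.
  have tx : 0 < t - x by rewrite subr_gt0.
  rewrite pmulr_rgt0 ?invr_gt0//; apply; last by rewrite gt_eqF.
  by rewrite gtr0_norm// ltrBlDl.
pose h := Num.min e r / 2.
have h0 : 0 < h by rewrite divr_gt0// lt_min e0.
have [he' hr'] : h < e /\ h < r.
  have m1 : Num.min e r <= e by rewrite ge_min lexx.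
  have m2 : Num.min e r <= r by rewrite ge_min lexx orbT.
  by rewrite /h; split; lra.
have xh : x < x + h by rewrite ltrDl.
have dxh (t : R) : x <= t <= x + h -> is_derive t 1 f (f' t).
  move=> /andP[t1 t2]; have [|//] := hb t.
  by rewrite ger0_norm ?subr_ge0// ltrBlDl (le_lt_trans t2)// ltrD2l.
have [||c + E] := @MVT R f f' x (x + h) xh.
- by move=> t; rewrite in_itv /= => /andP[t1 t2]; apply: dxh; rewrite !ltW.
- apply: continuous_in_subspaceT => t /set_mem/=; rewrite in_itv/=.
  by move=> /dxh/is_derive1_continuous.
rewrite in_itv /= => /andP[c1 c2].
have : 0 < f' c by apply: f'pos; rewrite c1 (lt_trans c2)// ltrD2l.
have [|_] := hb (x + h); first by rewrite addrAC subrr add0r gtr0_norm.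
rewrite -subr_le0 E addrAC subrr add0r => h1 h2.
by move: h1; apply/negP; rewrite -ltNge mulr_gt0.
Unshelve. all: end_near. Qed.

End laplacian_rules.

(** * Maximum principle at isolated singularities *)

Section comparison.
Context {R : realType}.
Implicit Types (U : set (R * R)) (f g z : R * R -> R) (P x y : R * R).

Lemma laplacian_max_le0 U z y : open U -> Ck_on 2 U z -> U y ->
  (\forall x \near y, z x <= z y) -> laplacian z y <= 0.
Proof.
move=> oU hz Uy mz; have hz1 := Ck_pred hz.
have nU : \forall x \near y, U x by exact: open_nbhs_nbhs.
have c1 : {for y.1, continuous (fun t : R => (t, y.2))}.
  apply: (@cvg_pair _ _ _ (nbhs y.1) (nbhs y.1) (nbhs y.2) _ _ _ id (fun=> y.2)).
    exact: cvg_id.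
  exact: cvg_cst.
have c2 : {for y.2, continuous (fun t : R => (y.1, t))}.
  apply: (@cvg_pair _ _ _ (nbhs y.2) (nbhs y.1) (nbhs y.2) _ _ _ (fun=> y.1) id).
    exact: cvg_cst.
  exact: cvg_id.
have yE : (y.1, y.2) = y by case: (y).
have n1 (A : set (R * R)) : nbhs y A -> \forall t \near y.1, A (t, y.2).
  by move=> nA; apply: c1; rewrite yE.
have n2 (A : set (R * R)) : nbhs y A -> \forall t \near y.2, A (y.1, t).
  by move=> nA; apply: c2; rewrite yE.
have h1 : partial1 (partial1 z) y <= 0.
  apply: (@second_derivative_max R (fun t => z (t, y.2)) (fun t => partial1 z (t, y.2)) y.1).
  - apply: filterS (n1 _ nU) => t Ut.
    exact: (is_derive_slice1 (Ck_derivable1 hz1 Ut)).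
  - exact: (is_derive_slice1 (Ck_derivable1 (Ck_partial1 hz) Uy)).
  - by apply: filterS (n1 _ mz) => t; rewrite yE.
have h2 : partial2 (partial2 z) y <= 0.
  apply: (@second_derivative_max R (fun t => z (y.1, t)) (fun t => partial2 z (y.1, t)) y.2).
  - apply: filterS (n2 _ nU) => t Ut.
    exact: (is_derive_slice2 (Ck_derivable2 hz1 Ut)).
  - exact: (is_derive_slice2 (Ck_derivable2 (Ck_partial2 hz) Uy)).
  - by apply: filterS (n2 _ mz) => t; rewrite yE.
have := lerD h1 h2; rewrite (addr0 (0 : R)) => h; exact: h.
Qed.

Lemma laplacian_cst (c : R) x : laplacian (fun=> c) x = 0.
Proof.
have p1 (d : R) : partial1 (fun=> d) = fun=> 0 by apply/funext => y; exact: derive_cst.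
have p2 (d : R) : partial2 (fun=> d) = fun=> 0 by apply/funext => y; exact: derive_cst.
by rewrite /laplacian p1 p2 p1 p2 addr0.
Qed.

Lemma sqnorm_ge0 x : 0 <= sqnorm x.
Proof. by rewrite addr_ge0 ?sqr_ge0. Qed.

Lemma sqnorm_gt0 x : x != 0 -> 0 < sqnorm x.
Proof.
move=> x0; rewrite lt_neqAle sqnorm_ge0 andbT eq_sym.
apply: contra x0; rewrite /sqnorm paddr_eq0 ?sqr_ge0// !sqrf_eq0 => /andP[/eqP h1 /eqP h2].
by apply/eqP; exact: pairE.
Qed.

Lemma Ck_sqnormB k U P : open U -> Ck_on k U (fun x => sqnorm (x - P)).
Proof.
move=> oU.
have l1 := Ck_linear k 1 0 (- P.1) oU; have l2 := Ck_linear k 0 1 (- P.2) oU.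
apply: (eq_Ck oU _ (Ck_add oU (Ck_mul oU l1 l1) (Ck_mul oU l2 l2))) => x _.
by rewrite /sqnorm /=; ring.
Qed.

Definition logdist P x : R := ln (sqnorm (x - P)).

Lemma open_punctured P : open [set x : R * R | x != P].
Proof.
have -> : [set x : R * R | x != P] = ~` [set P].
  by apply/seteqP; split => x /= /eqP.
apply: closed_openC; apply: accessible_closed_set1.
exact: hausdorff_accessible (@norm_hausdorff _ _).
Qed.

Lemma Ck_logdist k P : Ck_on k [set x | x != P] (logdist P).
Proof.
have oU := @open_punctured P.
apply: (@Ck_ln R k _ (fun x => sqnorm (x - P)) oU _ (Ck_sqnormB k P oU)) => x xP.
by rewrite sqnorm_gt0 ?subr_eq0.
Qed.

Lemma laplacian_logdist P x : x != P -> laplacian (logdist P) x = 0.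
Proof.
move=> xP; have oU := @open_punctured P; set U := [set x : R * R | x != P] in oU *.
have q0 y : U y -> 0 < sqnorm (y - P).
  by move=> yP; rewrite sqnorm_gt0 ?subr_eq0.
have d1 (p q s : R) (t : R) : is_derive t 1 (fun t => (t - q) ^+ 2 + s) (2 * (t - q)).
  by apply: is_derive_eq; rewrite /GRing.scale /=; ring.
have d2 (q s : R) (t : R) : is_derive t 1 (fun t => s + (t - q) ^+ 2) (2 * (t - q)).
  by apply: is_derive_eq; rewrite /GRing.scale /=; ring.
have hC1 := Ck_logdist 2 P; have hC := Ck_pred hC1.
have e1 y : U y -> partial1 (logdist P) y = 2 * (y.1 - P.1) / sqnorm (y - P).
  move=> Uy; have := is_derive_slice1 (Ck_derivable1 hC Uy) => h.
  have h' : is_derive y.1 1 (fun s => logdist P (s, y.2)) ((sqnorm (y - P))^-1 * (2 * (y.1 - P.1))).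
    exact: (@is_derive1_compE _ (@ln R) (fun s => (s - P.1) ^+ 2 + (y.2 - P.2) ^+ 2)
      _ _ _ _ erefl (is_derive1_ln (q0 _ Uy)) (d1 0 P.1 _ y.1)).
  rewrite -(@derive_val _ _ _ _ _ _ _ h) (@derive_val _ _ _ _ _ _ _ h').
  by rewrite mulrC.
have e2 y : U y -> partial2 (logdist P) y = 2 * (y.2 - P.2) / sqnorm (y - P).
  move=> Uy; have := is_derive_slice2 (Ck_derivable2 hC Uy) => h.
  have h' : is_derive y.2 1 (fun s => logdist P (y.1, s)) ((sqnorm (y - P))^-1 * (2 * (y.2 - P.2))).
    exact: (@is_derive1_compE _ (@ln R) (fun s => (y.1 - P.1) ^+ 2 + (s - P.2) ^+ 2)
      _ _ _ _ erefl (is_derive1_ln (q0 _ Uy)) (d2 P.2 _ y.2)).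
  rewrite -(@derive_val _ _ _ _ _ _ _ h) (@derive_val _ _ _ _ _ _ _ h').
  by rewrite mulrC.
have Ux : U x := xP.
pose q := sqnorm (x - P); have qn0 : q != 0 by rewrite gt_eqF ?q0.
have f1 : partial1 (partial1 (logdist P)) x = 2 / q - 4 * (x.1 - P.1) ^+ 2 / q ^+ 2.
  rewrite (@eq_partial1 R U _ (fun y => 2 * (y.1 - P.1) / sqnorm (y - P)))//; last first.
    by move=> y /set_mem Uy; exact: e1.
  have hF : Ck_on 1 U (fun y => 2 * (y.1 - P.1) / sqnorm (y - P)).
    apply: (eq_Ck oU _ (Ck_partial1 hC1)) => y /set_mem Uy; exact: e1.
  have := is_derive_slice1 (Ck_derivable1 hF Ux) => h.
  have hq : is_derive x.1 1 (fun s => ((s - P.1) ^+ 2 + (x.2 - P.2) ^+ 2)^-1)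
      (- (q^-1 * q^-1) * (2 * (x.1 - P.1))).
    exact: (@is_derive1_compE _ (fun u => u^-1) (fun s => (s - P.1) ^+ 2 + (x.2 - P.2) ^+ 2)
      x.1 q _ _ erefl (is_deriveV1 qn0) (d1 0 P.1 _ x.1)).
  have hl : is_derive x.1 1 (fun s => 2 * (s - P.1)) 2.
    by apply: is_derive_eq; rewrite /GRing.scale /=; ring.
  have h' := is_deriveM hl hq.
  rewrite -(@derive_val _ _ _ _ _ _ _ h) (@derive_val _ _ _ _ _ _ _ h').
  rewrite /GRing.scale /= -/(sqnorm (x - P)) -/q.
  by field.
have f2 : partial2 (partial2 (logdist P)) x = 2 / q - 4 * (x.2 - P.2) ^+ 2 / q ^+ 2.
  rewrite (@eq_partial2 R U _ (fun y => 2 * (y.2 - P.2) / sqnorm (y - P)))//; last first.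
    by move=> y /set_mem Uy; exact: e2.
  have hF : Ck_on 1 U (fun y => 2 * (y.2 - P.2) / sqnorm (y - P)).
    apply: (eq_Ck oU _ (Ck_partial2 hC1)) => y /set_mem Uy; exact: e2.
  have := is_derive_slice2 (Ck_derivable2 hF Ux) => h.
  have hq : is_derive x.2 1 (fun s => ((x.1 - P.1) ^+ 2 + (s - P.2) ^+ 2)^-1)
      (- (q^-1 * q^-1) * (2 * (x.2 - P.2))).
    exact: (@is_derive1_compE _ (fun u => u^-1) (fun s => (x.1 - P.1) ^+ 2 + (s - P.2) ^+ 2)
      x.2 q _ _ erefl (is_deriveV1 qn0) (d2 P.2 _ x.2)).
  have hl : is_derive x.2 1 (fun s => 2 * (s - P.2)) 2.
    by apply: is_derive_eq; rewrite /GRing.scale /=; ring.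
  have h' := is_deriveM hl hq.
  rewrite -(@derive_val _ _ _ _ _ _ _ h) (@derive_val _ _ _ _ _ _ _ h').
  rewrite /GRing.scale /= -/(sqnorm (x - P)) -/q.
  by field.
rewrite /laplacian f1 f2.
have E : (x.1 - P.1) ^+ 2 + (x.2 - P.2) ^+ 2 = q by [].
move: E; clear -qn0; clearbody q.
move: ((x.1 - P.1) ^+ 2) ((x.2 - P.2) ^+ 2) => u v E.
have -> : 2 / q - 4 * u / q ^+ 2 + (2 / q - 4 * v / q ^+ 2) =
  4 / q - 4 * (u + v) / q ^+ 2 by field.
by rewrite E; field.
Qed.

(* The term [d * ln |x - P|^2], harmonic off [P], sends [z] to -oo at [P]; this
   makes the isolated point [P], where nothing is known of [z] but an upper
   bound, invisible to the maximum principle. *)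
Lemma punctured_maximum (K U : set (R * R)) P z :
  compact K -> open U -> (forall x, K x -> x != P -> U x) -> Ck_on 2 U z ->
  (forall x, K x -> x != P -> 0 < z x -> (interior K) x /\ 0 < laplacian z x) ->
  (K P -> exists M, \forall x \near P^', z x <= M) ->
  forall x, K x -> x != P -> z x <= 0.
Proof.
move=> cK oU KU hz hpos hP x0 Kx0 x0P; rewrite leNgt; apply/negP => zx0.
have oV := @open_punctured P; set V := [set x : R * R | x != P] in oV *.
have cq : continuous (fun x => sqnorm (x - P)).
  by move=> x; apply: (Ck_continuous (Ck_sqnormB 0 P openT)).
have [D D0 hD] : exists2 D : R, 0 < D & forall x, K x -> sqnorm (x - P) <= D.
  have cw : {within K, continuous (fun x => sqnorm (x - P))}.
    by apply: continuous_in_subspaceT => x _; exact: cq.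
  have /compact_bounded [M [_ hM]] := continuous_compact cw cK.
  exists (`|M| + 1) => [|x Kx]; first by rewrite ltr_wpDl.
  have /hM : M < `|M| + 1 by rewrite (le_lt_trans (ler_norm _))// ltrDl.
  move=> /(_ (sqnorm (x - P))) /=; rewrite ger0_norm ?sqnorm_ge0//; apply.
  by exists x.
(* [d] is so small that the correction costs at most half of [z x0]; subtracting [ln D] makes the
   correction nonpositive on all of [K]. *)
have [d d0 hd] : exists2 d : R, 0 < d & 0 < z x0 + d * (logdist P x0 - ln D).
  pose l := `|logdist P x0 - ln D| + 1.
  have l0 : 0 < l by rewrite ltr_wpDl.
  exists (z x0 / (2 * l)); first by rewrite divr_gt0// mulr_gt0.
  have : - l <= logdist P x0 - ln D.
    by rewrite lerNl (le_trans (ler_norm _))// normrN lerDl.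
  move=> h; have z2 : 0 <= z x0 / (2 * l) by rewrite divr_ge0 ?mulr_ge0 ?ltW.
  have := ler_wpM2l z2 h; rewrite mulrN (_ : z x0 / (2 * l) * l = z x0 / 2); last first.
    by field; rewrite gt_eqF.
  by move=> *; lra.
pose zd x := z x + d * (logdist P x - ln D).
have zdle x : K x -> x != P -> zd x <= z x.
  move=> Kx xP; rewrite /zd gerDl pmulr_rle0// subr_le0 /logdist.
  by rewrite ler_ln ?posrE ?sqnorm_gt0 ?subr_eq0// hD.
have [rho rho0 hrho] : exists2 rho : R, 0 < rho &
    forall x, K x -> ball P rho x -> x != P -> zd x < 0.
  have [KP|nKP] := pselect (K P); last first.
    have cl : closed K by apply: compact_closed cK; exact: norm_hausdorff.
    have /nbhs_ballP[r /= r0 hr] : nbhs P (~` K).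
      by apply: open_nbhs_nbhs; split => //; exact: closed_openC.
    by exists r => // x Kx /hr.
  have [M /nbhs_ballP[r /= r0 hr]] := hP KP.
  (* Where |x - P|^2 <= c, the correction is at most - (|M| + 1), which overcomes the bound [M] on
     [z]. *)
  pose c := expR (ln D - (`|M| + 1) / d).
  have c0 : 0 < c by exact: expR_gt0.
  exists (Num.min r (Num.min 1 (c / 2))).
    by rewrite !lt_min r0 ltr01 divr_gt0.
  move=> x Kx [h1 h2] xP.
  have zM : z x <= M.
    apply: hr => //; split.
      by apply: (lt_le_trans h1); rewrite ge_min lexx.
    by apply: (lt_le_trans h2); rewrite ge_min lexx.
  pose m := Num.min 1 (c / 2).
  have mh (u : R) : u < Num.min r m -> u <= 1 /\ u <= c / 2.
    rewrite lt_min => /andP[_]; rewrite /m lt_min => /andP[v1 v2].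
    by rewrite !ltW.
  have q1 : sqnorm (x - P) <= c.
    rewrite /sqnorm /= -[(x.1 - P.1) ^+ 2]real_normK ?num_real//.
    rewrite -[(x.2 - P.2) ^+ 2]real_normK ?num_real//.
    move: h1 h2; rewrite /ball /= (distrC P.1) (distrC P.2) => /mh[a1 a2] /mh[b1 b2].
    have := normr_ge0 (x.1 - P.1); have := normr_ge0 (x.2 - P.2).
    by move=> *; nra.
  have : logdist P x <= ln D - (`|M| + 1) / d.
    rewrite -[leRHS]expRK /logdist ler_ln ?posrE//.
    by rewrite sqnorm_gt0 ?subr_eq0.
  move=> hl; have : d * (logdist P x - ln D) <= - (`|M| + 1).
    rewrite -ler_pdivlMl// mulrC.
    by rewrite mulNr; lra.
  by rewrite /zd; have := ler_norm M => *; lra.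
pose K' := K `&` ~` (ball P rho).
have cK' : compact K'.
  apply: compact_closedI => //.
  by apply: open_closedC; exact: ball_open.
have K'P x : K' x -> x != P.
  by move=> [_ nb]; apply/eqP => xP; apply: nb; rewrite xP; exact: ballxx.
have K'x0 : K' x0.
  split => // hb; have := hrho _ Kx0 hb x0P.
  by apply/negP; rewrite -leNgt ltW.
pose W := U `&` V.
have oW : open W by exact: openI.
have hzd : Ck_on 2 W zd.
  have h1 : Ck_on 2 W z by apply: Ck_subset hz => x [].
  have h2 : Ck_on 2 W (logdist P) by apply: Ck_subset (Ck_logdist 2 P) => x [].
  exact: (Ck_add oW h1 (Ck_scale d oW (Ck_sub oW h2 (Ck_cst 2 W (ln D))))).
have K'W x : K' x -> W x.
  by move=> K'x; split; [apply: KU (K'P _ K'x); case: K'x|exact: K'P].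
have czd : {within K', continuous zd}.
  apply: continuous_in_subspaceT => x /set_mem /K'W Wx.
  exact: (Ck_continuous hzd Wx).
have [y K'y ymax] : exists2 y, y \in K' & forall t, t \in K' -> zd t <= zd y.
  by apply: compact_EVT_max => //; exists x0.
have {}K'y := set_mem K'y.
have zdy : 0 < zd y by apply: (lt_le_trans hd); apply: ymax; exact: mem_set.
have [Ky nby] := K'y; have yP := K'P _ K'y.
have [iKy ly] := hpos _ Ky yP (lt_le_trans zdy (zdle _ Ky yP)).
have Wy := K'W _ K'y.
(* Removing the ball is harmless: [zd] is negative on it while [zd y] is positive, so [y] is a local
   maximum in the plane and not only within [K']. *)
have lmax : \forall x \near y, zd x <= zd y.
  near=> x.
  have Kx : K x by near: x; exact: iKy.
  have xP : x != P by near: x; exact: open_nbhs_nbhs.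
  have [bx|nbx] := pselect (ball P rho x).
    by apply: ltW; apply: lt_trans zdy; exact: hrho.
  by apply: ymax; apply: mem_set.
have := laplacian_max_le0 oW hzd Wy lmax.
have h1 : Ck_on 2 W z by apply: Ck_subset hz => x [].
have h2 : Ck_on 2 W (logdist P) by apply: Ck_subset (Ck_logdist 2 P) => x [].
have h3 := Ck_cst 2 W (- ln D).
have h4 := Ck_scale d oW (Ck_add oW h2 h3).
rewrite (laplacianD oW Wy h1 h4) (laplacianZ oW Wy d (Ck_add oW h2 h3)).
rewrite (laplacianD oW Wy h2 h3) (laplacian_logdist yP) add0r.
by rewrite laplacian_cst mulr0 addr0 leNgt ly.
Unshelve. all: end_near. Qed.

End comparison.

(** * Lattice-periodic bumps and their Laplacians *)

Section pointwise_equation.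
Context {R : realType}.
Variables (a b : R * R).
Hypothesis hab : lin_indep2 a b.
Notation cs := (cs a b).
Notation ct := (ct a b).
Notation lat := (lat a b).
Notation ldet := (ldet a b).
Notation periodic2 := (periodic2 a b).

Lemma periodic_partial (f : R * R -> R) : periodic2 f ->
  periodic2 (partial1 f) /\ periodic2 (partial2 f).
Proof.
move=> pf.
have H v x m n : 'D_v f (x + lat m n) = 'D_v f x.
  rewrite /derive; set g1 := fun h => h^-1 *: _; set g2 := fun h => h^-1 *: _.
  suff -> : g1 = g2 by [].
  by apply/funext => h; rewrite /g1 /g2 /= addrA !pf.
by split => x m n; exact: H.
Qed.

Lemma periodic_laplacian (f : R * R -> R) : periodic2 f -> periodic2 (laplacian f).
Proof.
move=> /periodic_partial[/periodic_partial[h1 _] /periodic_partial[_ h2]] x m n.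
by rewrite /laplacian h1 h2.
Qed.

(* Equal to 1 near the lattice translates of [x0], and to 0 away from them. *)
Definition bump (r : R) (x0 x : R * R) : R :=
  theta r (cs (x - x0)) * theta r (ct (x - x0)).

Lemma Ck_bump k r x0 : Ck_on k setT (bump r x0).
Proof.
have h1 := Ck_theta k r (b.2 / ldet) (- b.1 / ldet) (- cs x0).
have h2 := Ck_theta k r (- a.2 / ldet) (a.1 / ldet) (- ct x0).
apply: (eq_Ck openT _ (Ck_mul openT h1 h2)) => x _.
by rewrite /bump csB ctB [cs x]cs_lin [ct x]ct_lin !addr0.
Qed.

Lemma bump_periodic r x0 : periodic2 (bump r x0).
Proof.
move=> x m n; have -> : bump r x0 (x + lat m n) =
    theta r (cs (x - x0) + m%:~R) * theta r (ct (x - x0) + n%:~R).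
  by rewrite /bump -(cs_lat hab m n) -(ct_lat hab m n) -csD -ctD [x - x0 + _]addrAC.
by rewrite !thetaD_int.
Qed.

Lemma bump_01 r x0 x : 0 <= bump r x0 x <= 1.
Proof.
rewrite /bump; have /andP[h1 h2] := theta_01 r (cs (x - x0)).
have /andP[h3 h4] := theta_01 r (ct (x - x0)).
by apply/andP; split; [exact: (mulr_ge0 h1 h3)|exact: (mulr_ile1 h1 h3 h2 h4)].
Qed.

(** [(c1, c2)] and [(d1, d2)] are the gradients of the coordinates [cs] and [ct]. *)
Let c1 := b.2 / ldet.
Let c2 := - b.1 / ldet.
Let d1 := - a.2 / ldet.
Let d2 := a.1 / ldet.

Let slice_theta (F F' : R -> R) (p q c : R) x :
  (forall s : R, is_derive s 1 F (F' s)) ->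
  partial1 (fun x : R * R => F (p * x.1 + q * x.2 + c)) x = F' (p * x.1 + q * x.2 + c) * p /\
  partial2 (fun x : R * R => F (p * x.1 + q * x.2 + c)) x = F' (p * x.1 + q * x.2 + c) * q.
Proof.
move=> dF; pose l := fun x : R * R => p * x.1 + q * x.2 + c.
have hl : Ck_on 1 setT l := Ck_linear 1 p q c openT.
have h1 := partial1_comp I hl (dF (l x)); have h2 := partial2_comp I hl (dF (l x)).
have e1 : partial1 l x = p.
  have h' : is_derive x.1 1 (fun s => p * s + q * x.2 + c) p.
    by apply: is_derive_eq; rewrite /GRing.scale /=; ring.
  have h := is_derive_slice1 (Ck_derivable1 hl (I : setT x)).
  by rewrite -(@derive_val _ _ _ _ _ _ _ h) (@derive_val _ _ _ _ _ _ _ h').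
have e2 : partial2 l x = q.
  have h' : is_derive x.2 1 (fun s => p * x.1 + q * s + c) q.
    by apply: is_derive_eq; rewrite /GRing.scale /=; ring.
  have h := is_derive_slice2 (Ck_derivable2 hl (I : setT x)).
  by rewrite -(@derive_val _ _ _ _ _ _ _ h) (@derive_val _ _ _ _ _ _ _ h').
by rewrite e1 in h1; rewrite e2 in h2.
Qed.

Let csE x0 : (fun x => cs (x - x0)) = (fun x => c1 * x.1 + c2 * x.2 + - cs x0).
Proof. by apply/funext => x; rewrite csB [cs x]cs_lin addr0. Qed.

Let ctE x0 : (fun x => ct (x - x0)) = (fun x => d1 * x.1 + d2 * x.2 + - ct x0).
Proof. by apply/funext => x; rewrite ctB [ct x]ct_lin addr0. Qed.

Let comp_cs (F F' : R -> R) x0 x : (forall s : R, is_derive s 1 F (F' s)) ->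
  partial1 (fun x => F (cs (x - x0))) x = F' (cs (x - x0)) * c1 /\
  partial2 (fun x => F (cs (x - x0))) x = F' (cs (x - x0)) * c2.
Proof.
move=> dF; have := slice_theta c1 c2 (- cs x0) x dF.
rewrite -[_ + - cs x0]/((fun x => c1 * x.1 + c2 * x.2 + - cs x0) x) -csE.
rewrite (_ : (fun x => F (c1 * x.1 + c2 * x.2 + - cs x0)) = (fun x => F (cs (x - x0)))) //.
by apply/funext => y; rewrite -[_ + - cs x0]/((fun x => c1 * x.1 + c2 * x.2 + - cs x0) y) -csE.
Qed.

Let comp_ct (F F' : R -> R) x0 x : (forall s : R, is_derive s 1 F (F' s)) ->
  partial1 (fun x => F (ct (x - x0))) x = F' (ct (x - x0)) * d1 /\
  partial2 (fun x => F (ct (x - x0))) x = F' (ct (x - x0)) * d2.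
Proof.
move=> dF; have := slice_theta d1 d2 (- ct x0) x dF.
rewrite -[_ + - ct x0]/((fun x => d1 * x.1 + d2 * x.2 + - ct x0) x) -ctE.
rewrite (_ : (fun x => F (d1 * x.1 + d2 * x.2 + - ct x0)) = (fun x => F (ct (x - x0)))) //.
by apply/funext => y; rewrite -[_ + - ct x0]/((fun x => d1 * x.1 + d2 * x.2 + - ct x0) y) -ctE.
Qed.

Lemma bump_partial r x0 x :
  partial1 (bump r x0) x = theta1 r (cs (x - x0)) * theta r (ct (x - x0)) * c1
    + theta r (cs (x - x0)) * theta1 r (ct (x - x0)) * d1 /\
  partial2 (bump r x0) x = theta1 r (cs (x - x0)) * theta r (ct (x - x0)) * c2
    + theta r (cs (x - x0)) * theta1 r (ct (x - x0)) * d2.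
Proof.
have k1 : Ck_on 1 setT (fun x => theta r (cs (x - x0))).
  apply: (eq_Ck openT _ (Ck_theta 1 r c1 c2 (- cs x0))) => y _.
  by rewrite csB [cs y]cs_lin addr0.
have k2 : Ck_on 1 setT (fun x => theta r (ct (x - x0))).
  apply: (eq_Ck openT _ (Ck_theta 1 r d1 d2 (- ct x0))) => y _.
  by rewrite ctB [ct y]ct_lin addr0.
have [e1 e2] := comp_cs x0 x (is_derive_theta r).
have [e3 e4] := comp_ct x0 x (is_derive_theta r).
split.
  apply: (etrans (partial1M (I : setT x) k1 k2)).
  apply: (etrans (f_equal2 (fun u v => _ * u + _ * v) e3 e1)).
  move: (theta r (cs _)) (theta r (ct _)) (theta1 r (cs _)) (theta1 r (ct _)) => *; ring.
apply: (etrans (partial2M (I : setT x) k1 k2)).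
apply: (etrans (f_equal2 (fun u v => _ * u + _ * v) e4 e2)).
move: (theta r (cs _)) (theta r (ct _)) (theta1 r (cs _)) (theta1 r (ct _)) => *; ring.
Qed.

Lemma bump_laplacian r x0 x : laplacian (bump r x0) x =
  theta2 r (cs (x - x0)) * theta r (ct (x - x0)) * (c1 ^+ 2 + c2 ^+ 2) +
  2 * (theta1 r (cs (x - x0)) * theta1 r (ct (x - x0))) * (c1 * d1 + c2 * d2) +
  theta r (cs (x - x0)) * theta2 r (ct (x - x0)) * (d1 ^+ 2 + d2 ^+ 2).
Proof.
have kl1 : Ck_on 1 setT (fun x => cs (x - x0)) by rewrite csE; exact: Ck_linear openT.
have kl2 : Ck_on 1 setT (fun x => ct (x - x0)) by rewrite ctE; exact: Ck_linear openT.
have D (F F' : R -> R) (l : R * R -> R) y v : (forall s : R, is_derive s 1 F (F' s)) ->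
    derivable l y v -> derivable (fun x => F (l x)) y v.
  by move=> dF dl; have := derive_comp1 (dF (l y)) dl => ?; exact: ex_derive.
have dc1 y := Ck_derivable1 kl1 (I : setT y); have dc2 y := Ck_derivable2 kl1 (I : setT y).
have dd1 y := Ck_derivable1 kl2 (I : setT y); have dd2 y := Ck_derivable2 kl2 (I : setT y).
have t0 := is_derive_theta r; have t1 := is_derive_theta1 r.
pose A y := theta r (cs (y - x0)); pose A1 y := theta1 r (cs (y - x0)).
pose B y := theta r (ct (y - x0)); pose B1 y := theta1 r (ct (y - x0)).
have P1 : partial1 (bump r x0) = fun y => c1 * (A1 y * B y) + d1 * (A y * B1 y).
  by apply/funext => y; rewrite (bump_partial r x0 y).1 -/(A y) -/(A1 y) -/(B y) -/(B1 y);
    move: (A y) (A1 y) (B y) (B1 y) => *; ring.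
have P2 : partial2 (bump r x0) = fun y => c2 * (A1 y * B y) + d2 * (A y * B1 y).
  by apply/funext => y; rewrite (bump_partial r x0 y).2 -/(A y) -/(A1 y) -/(B y) -/(B1 y);
    move: (A y) (A1 y) (B y) (B1 y) => *; ring.
have L v (p q dA dA1 dB dB1 : R) :
  derivable A x v -> derivable A1 x v -> derivable B x v -> derivable B1 x v ->
  'D_v A x = dA -> 'D_v A1 x = dA1 -> 'D_v B x = dB -> 'D_v B1 x = dB1 ->
  'D_v (fun y => p * (A1 y * B y) + q * (A y * B1 y)) x =
   p * (A1 x * dB + B x * dA1) + q * (A x * dB1 + B1 x * dA).
  move=> hA hA1 hB hB1 <- <- <- <-.
  have m1 := derivableM hA1 hB; have m2 := derivableM hA hB1.
  have n1 : derivable (fun y => p * (A1 y * B y)) x v by exact: (@derivableZ _ _ _ _ p _ _ m1).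
  have n2 : derivable (fun y => q * (A y * B1 y)) x v by exact: (@derivableZ _ _ _ _ q _ _ m2).
  have -> : 'D_v (fun y => p * (A1 y * B y) + q * (A y * B1 y)) x =
    'D_v (fun y => p * (A1 y * B y)) x + 'D_v (fun y => q * (A y * B1 y)) x.
    exact: (deriveD n1 n2).
  have -> : 'D_v (fun y => p * (A1 y * B y)) x = p * 'D_v (fun y => A1 y * B y) x.
    exact: (deriveZ p m1).
  have -> : 'D_v (fun y => q * (A y * B1 y)) x = q * 'D_v (fun y => A y * B1 y) x.
    exact: (deriveZ q m2).
  have -> : 'D_v (fun y => A1 y * B y) x = A1 x * 'D_v B x + B x * 'D_v A1 x.
    exact: (deriveM hA1 hB).
  have -> : 'D_v (fun y => A y * B1 y) x = A x * 'D_v B1 x + B1 x * 'D_v A x.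
    exact: (deriveM hA hB1).
  by [].
rewrite /laplacian P1 P2 {1}/partial1 {1}/partial2.
rewrite (L _ _ _ _ _ _ _ (D _ _ _ _ _ t0 (dc1 x)) (D _ _ _ _ _ t1 (dc1 x))
  (D _ _ _ _ _ t0 (dd1 x)) (D _ _ _ _ _ t1 (dd1 x))
  (comp_cs x0 x t0).1 (comp_cs x0 x t1).1 (comp_ct x0 x t0).1 (comp_ct x0 x t1).1).
rewrite (L _ _ _ _ _ _ _ (D _ _ _ _ _ t0 (dc2 x)) (D _ _ _ _ _ t1 (dc2 x))
  (D _ _ _ _ _ t0 (dd2 x)) (D _ _ _ _ _ t1 (dd2 x))
  (comp_cs x0 x t0).2 (comp_cs x0 x t1).2 (comp_ct x0 x t0).2 (comp_ct x0 x t1).2).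
rewrite /A /A1 /B /B1.
move: (theta r (cs _)) (theta r (ct _)) (theta1 r (cs _)) (theta1 r (ct _))
  (theta2 r (cs _)) (theta2 r (ct _)) => *; ring.
Qed.

Lemma bump_far r x0 x : 0 < r ->
  2 * r ^+ 2 <= sin2pi (cs (x - x0)) \/ 2 * r ^+ 2 <= sin2pi (ct (x - x0)) ->
  [/\ bump r x0 x = 0, partial1 (bump r x0) x = 0, partial2 (bump r x0) x = 0 &
   laplacian (bump r x0) x = 0].
Proof.
move=> r0 [] h; have [e0 e1 e2] := theta_far r0 h;
  have [p1 p2] := bump_partial r x0 x; rewrite p1 p2 bump_laplacian /bump e0 e1 e2.
  by split; ring.
by split; ring.
Qed.

Lemma bump_near r x0 x : sin2pi (cs (x - x0)) <= r ^+ 2 ->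
  sin2pi (ct (x - x0)) <= r ^+ 2 ->
  [/\ bump r x0 x = 1, partial1 (bump r x0) x = 0, partial2 (bump r x0) x = 0 &
   laplacian (bump r x0) x = 0].
Proof.
move=> /theta_near[e0 e1 e2] /theta_near[f0 f1 f2].
have [p1 p2] := bump_partial r x0 x; rewrite p1 p2 bump_laplacian /bump e0 e1 e2 f0 f1 f2.
by split; ring.
Qed.

Lemma bump_laplacian_bound : exists2 A : R, 0 < A & forall r x0 x, 0 < r ->
  `|laplacian (bump r x0) x| <= A / r ^+ 2.
Proof.
have [A A0 hA] := @theta_bound R.
pose k1 := c1 ^+ 2 + c2 ^+ 2; pose k2 := `|c1 * d1 + c2 * d2|; pose k3 := d1 ^+ 2 + d2 ^+ 2.
have k10 : 0 <= k1 by rewrite addr_ge0 ?sqr_ge0.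
have k30 : 0 <= k3 by rewrite addr_ge0 ?sqr_ge0.
have k20 : 0 <= k2 by exact: normr_ge0.
have AA : 0 <= A * A by rewrite mulr_ge0 ?ltW.
pose B := A * k1 + 2 * (A * A) * k2 + A * k3.
have B0 : 0 <= B.
  rewrite /B; have := mulr_ge0 (ltW A0) k10; have := mulr_ge0 (ltW A0) k30.
  by have := mulr_ge0 AA k20; lra.
exists (B + 1) => [|r x0 x r0]; first lra.
have ri2 : 0 <= r ^- 2 by rewrite invr_ge0 sqr_ge0.
apply: (@le_trans _ _ (B / r ^+ 2)); last by apply: ler_wpM2r => //; lra.
have [s1 s2] := hA r (cs (x - x0)) r0; have [t1 t2] := hA r (ct (x - x0)) r0.
have n1 s : `|theta r s| <= 1.
  by have /andP[h1 h2] := theta_01 r s; rewrite ger0_norm.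
rewrite bump_laplacian.
have -> : B / r ^+ 2 = A / r ^+ 2 * 1 * k1 + 2 * (A / r * (A / r)) * k2 + 1 * (A / r ^+ 2) * k3.
  by rewrite /B; field; rewrite gt_eqF.
rewrite (le_trans (ler_normD _ _))// lerD//.
  rewrite (le_trans (ler_normD _ _))// lerD//.
    by rewrite normrM (ger0_norm k10) ler_wpM2r// normrM ler_pM.
  by rewrite 3!normrM -/k2 ler_wpM2r// normr_nat ler_wpM2l// ler_pM.
by rewrite normrM (ger0_norm k30) ler_wpM2r// normrM ler_pM.
Qed.

Lemma bump_support rho x0 : 0 < rho -> exists2 r : R, 0 < r &
  forall x, (2 * r ^+ 2 <= sin2pi (cs (x - x0)) \/ 2 * r ^+ 2 <= sin2pi (ct (x - x0)))
   \/ exists m n, ball x0 rho (x - lat m n).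
Proof.
move=> rho0; have [L L0 hL] := coord_bound hab.
(* With r <= 1 one has r^2 <= r, and the second bound then gives L * 4 r^2 <= rho^2 / 2: the support
   of the bump fits into translates of the ball. *)
pose r := Num.min 1 (rho ^+ 2 / (8 * L)).
have rho2 : 0 < rho ^+ 2 by rewrite exprn_gt0.
have r0 : 0 < r by rewrite lt_min ltr01 divr_gt0// mulr_gt0.
exists r => // x.
have [h|h1] := leP (2 * r ^+ 2) (sin2pi (cs (x - x0))); first by left; left.
have [h|h2] := leP (2 * r ^+ 2) (sin2pi (ct (x - x0))); first by left; right.
right; have [m [n [_ _ m2 n2]]] := kap_dist hab (x - x0); exists m, n.
have E : x - x0 - lat m n = x - lat m n - x0 by rewrite addrAC.
rewrite E in m2 n2; have [hq _] := hL (x - lat m n - x0).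
have hr : L * (4 * r ^+ 2) < rho ^+ 2.
  have r1 : r <= 1 by rewrite /r ge_min lexx.
  have : r <= rho ^+ 2 / (8 * L) by rewrite /r ge_min lexx orbT.
  rewrite ler_pdivlMr ?mulr_gt0// => h.
  have : r ^+ 2 <= r by rewrite expr2 ler_piMl// ltW.
  move=> h'; have := ler_wpM2l (ltW L0) h'; nra.
have hq2 : sqnorm (x - lat m n - x0) < rho ^+ 2.
  apply: (le_lt_trans hq); apply: le_lt_trans hr; rewrite ler_pM2l//; lra.
have [q1 q2] : (x - lat m n - x0).1 ^+ 2 < rho ^+ 2 /\ (x - lat m n - x0).2 ^+ 2 < rho ^+ 2.
  move: hq2; rewrite /sqnorm; have := sqr_ge0 (x - lat m n - x0).1.
  have := sqr_ge0 (x - lat m n - x0).2 => *; split; lra.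
have nlt (t : R) : t ^+ 2 < rho ^+ 2 -> `|t| < rho.
  by rewrite -[t ^+ 2]real_normK ?num_real// ltr_sqr ?nnegrE// ltW.
by split; rewrite /ball /= distrC; [exact: nlt q1|exact: nlt q2].
Qed.

End pointwise_equation.

(** * From the weak to the pointwise equation *)

Section weak_to_pointwise.
Context {R : realType}.
Variables (a b : R * R).
Hypothesis hab : lin_indep2 a b.
Notation mu2 := ((@lebesgue_measure R) \x (@lebesgue_measure R))%E.
Notation T2 := (measurableTypeR R * measurableTypeR R)%type.
Notation cs := (cs a b).
Notation ct := (ct a b).
Notation lat := (lat a b).
Notation kap := (kap a b).
Notation bump := (bump a b).
Notation periodic2 := (periodic2 a b).

Variables (I : finType) (P : I -> R * R).

Definition regular_set : set (R * R) := [set x | forall i, kap (x - P i) != 0].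

Lemma open_regular_set : open regular_set.
Proof.
rewrite openE => x Ux.
apply: (@filter_forall _ I (fun i y => kap (y - P i) != 0) (nbhs x)) => i.
have k0 : 0 < kap (x - P i) by rewrite lt_neqAle eq_sym Ux kap_ge0.
have := @kapB_continuous R a b (P i) x.
move=> /cvgr_gt /(_ 0 k0); apply: filterS => y h; by rewrite gt_eqF.
Qed.

Lemma regular_set_lat x m n : regular_set x -> regular_set (x + lat m n).
Proof. by move=> Ux i; rewrite addrAC (kap_lat hab). Qed.

Lemma regular_set_latB x m n : regular_set x -> regular_set (x - lat m n).
Proof.
move=> Ux; have -> : x - lat m n = x + lat (- m) (- n).
  by rewrite lat_opp.
exact: regular_set_lat.
Qed.

Variables (w : R * R -> R) (f : R -> R) (c : R).
Hypotheses (pw : periodic2 w) (sw : smooth_on regular_set w) (cf : continuous f).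
(** Test functions vanishing at the points [P i] do not see the Dirac masses, which are then
    remembered only through the logarithmic singularities. *)
Hypothesis weak : forall phi, smooth_on setT phi -> periodic2 phi ->
  (forall i, phi (P i) = 0) ->
  \int[mu2]_(x in (fund_domain a b : set T2))
    (w x * laplacian phi x + c * (f (w x) * phi x)) = 0.

Let H x := laplacian w x + c * f (w x).

Let cH x : regular_set x -> {for x, continuous H}.
Proof.
move=> Ux; apply: continuous_add.
  exact: (Ck_continuous (Ck_laplacian open_regular_set (sw 2)) Ux).
apply: continuous_scale; apply: (@continuous_comp _ _ _ w f); last exact: cf.
exact: (Ck_continuous (sw 0) Ux).
Qed.

Let pH : periodic2 H.
Proof. by move=> x m n; rewrite /H (periodic_laplacian pw) pw. Qed.

(** The fundamental lemma of the calculus of variations: a bump supported where [sg * H] is positive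
    would give a positive integral after Green's formula. As [x0] is interior to the fundamental
    domain, the bump meets this domain only in a small square around [x0]. *)
Lemma pointwise_interior (sg : R) x0 : regular_set x0 -> 0 < cs x0 < 1 -> 0 < ct x0 < 1 ->
  sg * H x0 <= 0.
Proof.
move=> Ux0 /andP[s0 s1] /andP[t0 t1]; rewrite leNgt; apply/negP => Gx0.
have cG x : regular_set x -> {for x, continuous (fun x => sg * H x)}.
  by move=> Ux; apply: continuous_scale; exact: cH.
have : \forall x \near x0, [/\ regular_set x, 0 < sg * H x, 0 < cs x < 1 & 0 < ct x < 1].
  near=> x; split.
  - by near: x; apply: open_nbhs_nbhs; split => //; exact: open_regular_set.
  - by near: x; have := cG _ Ux0 => /cvgr_gt; apply.
  - apply/andP; split; near: x.
      by have := @cs_continuous R a b x0 => /cvgr_gt; apply.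
    by have := @cs_continuous R a b x0 => /cvgr_lt; apply.
  - apply/andP; split; near: x.
      by have := @ct_continuous R a b x0 => /cvgr_gt; apply.
    by have := @ct_continuous R a b x0 => /cvgr_lt; apply.
move=> /nbhs_ballP[d /= d0 hd]; pose rho := d / 2.
have rho0 : 0 < rho by rewrite divr_gt0.
have [r r0 hr] := bump_support hab x0 rho0.
pose phi := bump r x0.
pose Q := rect (x0.1 - rho) (x0.1 + rho) (x0.2 - rho) (x0.2 + rho).
have x01 : x0.1 - rho < x0.1 < x0.1 + rho by rewrite ltrBlDr ltrDl rho0.
have x02 : x0.2 - rho < x0.2 < x0.2 + rho by rewrite ltrBlDr ltrDl rho0.
have lrho1 : x0.1 - rho < x0.1 + rho by move/andP: x01 => [+ +]; exact: lt_trans.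
have lrho2 : x0.2 - rho < x0.2 + rho by move/andP: x02 => [+ +]; exact: lt_trans.
have Qx0 : Q x0.
  by move/andP: x01 => [? ?]; move/andP: x02 => [? ?]; split; rewrite /= in_itv /= !ltW.
have Qd x : Q x -> ball x0 d x.
  move=> [/=]; rewrite !in_itv /= => /andP[h1 h2] /andP[h3 h4].
  have hd2 : d = rho + rho by rewrite /rho; field.
  by split; rewrite /ball /= distrC ltr_norml; apply/andP; split; lra.
have QU x : Q x -> regular_set x by move=> /Qd /hd[].
have hB x : ball x0 rho x -> ball x0 d x.
  by apply: le_ball; rewrite /rho; lra.
have fd x : fund_domain a b x <-> 0 <= cs x < 1 /\ 0 <= ct x < 1.
  split => [[s [t [hs ht ->]]]|[hs ht]].
    by rewrite -[_ + _]/(pt a b (s, t)) (cs_pt hab) (ct_pt hab).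
  by exists (cs x), (ct x); split => //; rewrite -[RHS]/(pt a b (cs x, ct x)) (pt_cst hab).
have Qfd x : Q x -> fund_domain a b x.
  by move=> /Qd /hd[_ _ /andP[h1 h2] /andP[h3 h4]]; apply/fd; rewrite h2 h4 !ltW.
(* Among the lattice translates of the ball only the trivial one meets the fundamental domain: an
   integer shift between two points with coordinates in the unit interval is 0. *)
have int0 (k j : int) (v : R) : 0 <= v < 1 -> 0 < v - k%:~R < 1 -> k = 0.
  move=> /andP[v0 v1] /andP[k0 k1].
  have h1 : k%:~R < 1%:~R :> R by rewrite mulr1z; lra.
  have h2 : (- 1)%:~R < k%:~R :> R by rewrite mulrN1z; lra.
  move: h1 h2; rewrite !ltr_int; clear => h1 h2; lia.
have far x : fund_domain a b x -> ~ ball x0 rho x ->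
    [/\ phi x = 0, partial1 phi x = 0, partial2 phi x = 0 & laplacian phi x = 0].
  move=> /fd[hs ht] nb; apply: bump_far => //.
  case: (hr x) => // -[m [n hb]]; exfalso; apply: nb.
  have [_ _ h1 h2] := hd _ (hB _ hb).
  rewrite csB (cs_lat hab) in h1; rewrite ctB (ct_lat hab) in h2.
  by move: hb; rewrite (int0 m 0 _ hs h1) (int0 n 0 _ ht h2) lat00 subr0.
have smphi k : Ck_on k setT phi by exact: Ck_bump.
have phiU k : Ck_on k regular_set phi by apply: Ck_subset (smphi k).
have phiP i : phi (P i) = 0.
  have [h|[m [n hb]]] := hr (P i); first by have [] := bump_far r0 h.
  (* Otherwise a translate of [P i] would be a regular point, although [kap] vanishes on its
     difference with [P i]. *)
  have [hU _ _ _] := hd _ (hB _ hb).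
  by have := hU i; rewrite addrAC subrr add0r kapN -[lat m n]add0r (kap_lat hab) kap0 eqxx.
have W := weak smphi (bump_periodic hab r x0) phiP.
pose J x := w x * laplacian phi x + c * (f (w x) * phi x).
have J0 : \int[mu2]_(x in (Q : set T2)) J x = 0.
  rewrite -W.
  have -> : (Q : set T2) = (fund_domain a b : set T2) `&` Q.
    by apply/seteqP; split => x //; [move=> Qx; split => //; exact: Qfd|case].
  rewrite Rintegral_mkcondr; apply: eq_Rintegral => x /set_mem fx.
  rewrite patchE; case: ifPn => // nQ.
  have [|-> _ _ ->] := far x fx; last by rewrite !mulr0 addr0.
  move=> [h1 h2]; move/negP: nQ; apply; apply: mem_set.
  move: h1 h2; rewrite /ball /= => h1 h2.
  rewrite distrC ltr_distl in h1; rewrite distrC ltr_distl in h2.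
  by split; rewrite /= in_itv /=; move/andP: h1 => [? ?]; move/andP: h2 => [? ?];
    rewrite !ltW.
have cJ x : Q x -> {for x, continuous J}.
  move=> /QU Ux; apply: continuous_add.
    apply: continuous_mul; first exact: (Ck_continuous (sw 0) Ux).
    exact: (Ck_continuous (Ck_laplacian open_regular_set (phiU 2)) Ux).
  apply: continuous_scale; apply: continuous_mul; last exact: (Ck_continuous (phiU 0) Ux).
  apply: (@continuous_comp _ _ _ w f); last exact: cf.
  exact: (Ck_continuous (sw 0) Ux).
(* Green's field phi grad w - w grad phi. It vanishes on the sides of [Q], so adding its divergence
   moves the Laplacian from [phi] to [w] without changing the integral. *)
pose h1 x := phi x * partial1 w x - w x * partial1 phi x.
pose h2 x := phi x * partial2 w x - w x * partial2 phi x.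
have oU := open_regular_set.
have Ch1 : Ck_on 1 regular_set h1.
  exact: (Ck_sub oU (Ck_mul oU (phiU 1) (Ck_partial1 (sw 2)))
    (Ck_mul oU (sw 1) (Ck_partial1 (phiU 2)))).
have Ch2 : Ck_on 1 regular_set h2.
  exact: (Ck_sub oU (Ck_mul oU (phiU 1) (Ck_partial2 (sw 2)))
    (Ck_mul oU (sw 1) (Ck_partial2 (phiU 2)))).
have bd x : Q x -> ~ ball x0 rho x -> h1 x = 0 /\ h2 x = 0.
  move=> /Qfd fx nb; have [e0 e1 e2 _] := far x fx nb.
  by rewrite /h1 /h2 e0 e1 e2 !mul0r !mulr0 !subrr.
have I1 : \int[mu2]_(x in (Q : set T2)) partial1 h1 x = 0.
  apply: (@rect_ibp1 R h1 (partial1 h1) _ _ _ _ lrho1).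
  - by move=> x /QU Ux; exact: (is_derive_slice1 (Ck_derivable1 Ch1 Ux)).
  - by move=> x /QU Ux; exact: (Ck_continuous (Ck_partial1 Ch1) Ux).
  - move=> t ht.
    have q1 : Q (x0.1 + rho, t).
      by split; rewrite /= in_itv //= lexx ltW.
    have q2 : Q (x0.1 - rho, t).
      by split; rewrite /= in_itv //= lexx ltW.
    have [|-> _] := bd _ q1.
      by case; rewrite /ball /= opprD addrA subrr add0r normrN gtr0_norm// ltxx.
    have [|-> _] := bd _ q2; last by [].
    by case; rewrite /ball /= opprB addrC subrK gtr0_norm// ltxx.
have I2 : \int[mu2]_(x in (Q : set T2)) partial2 h2 x = 0.
  apply: (@rect_ibp2 R h2 (partial2 h2) _ _ _ _ lrho2).
  - by move=> x /QU Ux; exact: (is_derive_slice2 (Ck_derivable2 Ch2 Ux)).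
  - by move=> x /QU Ux; exact: (Ck_continuous (Ck_partial2 Ch2) Ux).
  - move=> s hs.
    have q1 : Q (s, x0.2 + rho).
      by split; rewrite /= in_itv //= lexx ltW.
    have q2 : Q (s, x0.2 - rho).
      by split; rewrite /= in_itv //= lexx ltW.
    have [|_ ->] := bd _ q1.
      by case=> _; rewrite /ball /= opprD addrA subrr add0r normrN gtr0_norm// ltxx.
    have [|_ ->] := bd _ q2; last by [].
    by case=> _; rewrite /ball /= opprB addrC subrK gtr0_norm// ltxx.
have cp1 x : Q x -> {for x, continuous (partial1 h1)}.
  by move=> /QU Ux; exact: (Ck_continuous (Ck_partial1 Ch1) Ux).
have cp2 x : Q x -> {for x, continuous (partial2 h2)}.
  by move=> /QU Ux; exact: (Ck_continuous (Ck_partial2 Ch2) Ux).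
have cp12 x : Q x -> {for x, continuous (fun x => partial1 h1 x + partial2 h2 x)}.
  by move=> Qx; exact: (continuous_add (cp1 _ Qx) (cp2 _ Qx)).
have K0 : \int[mu2]_(x in (Q : set T2)) (J x + (partial1 h1 x + partial2 h2 x)) = 0.
  apply: (etrans (Rintegral_rectD cJ cp12)).
  apply: (etrans (congr2 +%R J0 (etrans (Rintegral_rectD cp1 cp2) (congr2 +%R I1 I2)))).
  by rewrite !addr0.
have cS x : Q x -> {for x, continuous (fun x => J x + (partial1 h1 x + partial2 h2 x))}.
  by move=> Qx; exact: (continuous_add (cJ _ Qx) (cp12 _ Qx)).
have KE x : Q x -> J x + (partial1 h1 x + partial2 h2 x) = phi x * H x.
  move=> /QU Ux; rewrite (green_divergence oU Ux (phiU 2) (sw 2)) /J /H.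
  move: (laplacian phi x) (laplacian w x) (phi x) (f (w x)) (w x) => *; ring.
have : 0 < \int[mu2]_(x in (Q : set T2)) (sg * (J x + (partial1 h1 x + partial2 h2 x))).
  apply: (@Rintegral_rect_gt0 R _ _ _ _
    (fun x => sg * (J x + (partial1 h1 x + partial2 h2 x))) x0).
  - by move=> x Qx; apply: continuous_scale; exact: cS.
  - move=> x Qx; rewrite (KE _ Qx) mulrCA.
    have [_ G0 _ _] := hd _ (Qd _ Qx); have /andP[b0 _] := bump_01 a b r x0 x.
    exact: (mulr_ge0 b0 (ltW G0)).
  - exact: x01.
  - exact: x02.
  - rewrite (KE _ Qx0) mulrCA /phi.
    have z1 : cs (x0 - x0) = 0 by rewrite csB subrr.
    have z2 : ct (x0 - x0) = 0 by rewrite ctB subrr.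
    have [||-> _ _ _] := @bump_near R a b r x0 x0; last by rewrite mul1r.
      by rewrite z1 sin2pi0 sqr_ge0.
    by rewrite z2 sin2pi0 sqr_ge0.
have E0 : \int[mu2]_(x in (Q : set T2)) (sg * (J x + (partial1 h1 x + partial2 h2 x))) = 0.
  by apply: (etrans (Rintegral_rectZ cS sg)); rewrite K0 mulr0.
by rewrite E0 ltxx.
Unshelve. all: end_near. Qed.

(** A point with an integer coordinate lies on the boundary of a cell. By continuity it may be
    pushed inside along [a + b], and by periodicity then be brought into the fundamental domain. *)
Lemma weak_pointwise x : regular_set x -> H x = 0.
Proof.
have Hint y : regular_set y -> 0 < cs y < 1 -> 0 < ct y < 1 -> H y = 0.
  move=> Uy hs ht; have := pointwise_interior (- 1) Uy hs ht.
  have := pointwise_interior 1 Uy hs ht.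
  by rewrite mul1r mulN1r oppr_le0 => h1 h2; apply/eqP; rewrite eq_le h1.
move=> Ux; apply/eqP/negPn/negP => Hx.
have : \forall y \near x, regular_set y /\ H y != 0.
  near=> y; split.
    by near: y; apply: open_nbhs_nbhs; split => //; exact: open_regular_set.
  near: y; apply: (@cvgr_neq0 _ _ _ _ _ H (H x)) => //; exact: (cH Ux).
move=> /nbhs_ballP[d /= d0 hd].
pose m := Num.floor (cs x); pose n := Num.floor (ct x).
have /andP[m1 m2] := floor_itv (cs x); have /andP[n1 n2] := floor_itv (ct x).
rewrite -/m intrD mulr1z in m1 m2; rewrite -/n intrD mulr1z in n1 n2.
pose N := 1 + (`|a.1| + `|a.2| + `|b.1| + `|b.2|).
have N0 : 0 < N by rewrite ltr_pwDl// !addr_ge0.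
(* The first bound keeps x + h (a + b) in the ball of radius d; the other two keep its coordinates
   below the next integers. *)
pose h := Num.min (d / (2 * N)) (Num.min ((m%:~R + 1 - cs x) / 2) ((n%:~R + 1 - ct x) / 2)).
have h0 : 0 < h.
  by rewrite !lt_min !divr_gt0 ?subr_gt0 ?mulr_gt0.
have hN : h * N < d.
  have : h <= d / (2 * N) by rewrite /h ge_min lexx.
  by rewrite ler_pdivlMr ?mulr_gt0//; nra.
have hm : h <= (m%:~R + 1 - cs x) / 2 by rewrite /h !ge_min lexx ?orbT.
have hn : h <= (n%:~R + 1 - ct x) / 2 by rewrite /h !ge_min lexx ?orbT.
pose y := x + pt a b (h, h).
have hy : ball x d y.
  have A (p q : R) : `|p| + `|q| <= N -> `|h * p + h * q| < d.
    move=> hpq; apply: le_lt_trans hN; rewrite -mulrDr normrM gtr0_norm// ler_pM2l//.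
    exact: le_trans (ler_normD _ _) hpq.
  have := normr_ge0 a.1; have := normr_ge0 a.2; have := normr_ge0 b.1; have := normr_ge0 b.2.
  by move=> *; split; rewrite /ball /= opprD addrA subrr add0r normrN; apply: A; rewrite /N; lra.
have [Uy Hy] := hd _ hy.
have csy : cs (y - lat m n) = cs x + h - m%:~R by rewrite csB csD (cs_pt hab) (cs_lat hab).
have cty : ct (y - lat m n) = ct x + h - n%:~R by rewrite ctB ctD (ct_pt hab) (ct_lat hab).
move/negP: Hy; apply; apply/eqP.
have -> : H y = H (y - lat m n) by rewrite -(pH (y - lat m n) m n) subrK.
apply: Hint; first exact: regular_set_latB.
  by rewrite csy; apply/andP; split; lra.
by rewrite cty; apply/andP; split; lra.
Unshelve. all: end_near. Qed.

End weak_to_pointwise.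

(** * The energy estimate *)

Section tanh_half.
Context {R : realType}.
Implicit Types s t : R.

(* [tanh2 t] is tanh (t / 2) and [ltanh2] its primitive 2 ln cosh (t / 2) + 2 ln 2. *)
Definition tanh2 t : R := (expR t - 1) / (expR t + 1).
Definition ltanh2 t : R := 2 * ln (expR t + 1) - t.

Let e1 t : 0 < expR t + 1. Proof. by rewrite addr_gt0 ?expR_gt0. Qed.

Lemma is_derive_tanh2 t : is_derive t 1 tanh2 ((1 - tanh2 t ^+ 2) / 2).
Proof.
have n0 : expR t + 1 != 0 by rewrite gt_eqF.
have h1 : is_derive t 1 (fun t => expR t + 1) (expR t).
  by apply: is_derive_eq; rewrite addr0.
have h2 : is_derive t 1 (fun t => expR t - 1) (expR t).
  by apply: is_derive_eq; rewrite subr0.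
have h3 := @is_derive1_compE _ (fun u => u^-1) (fun t => expR t + 1) t _ _ _ erefl (is_deriveV1 n0) h1.
apply: is_derive_to (is_deriveM h2 h3) _.
by rewrite /tanh2 /GRing.scale /=; field.
Qed.

Lemma is_derive_ltanh2 t : is_derive t 1 ltanh2 (tanh2 t).
Proof.
have n0 : expR t + 1 != 0 by rewrite gt_eqF.
have h1 : is_derive t 1 (fun t => expR t + 1) (expR t).
  by apply: is_derive_eq; rewrite addr0.
have h3 := @is_derive1_compE _ (@ln R) (fun t => expR t + 1) t _ _ _ erefl (is_derive1_ln (e1 t)) h1.
apply: is_derive_to (is_deriveB (is_deriveZ 2 h3) (is_derive_id t 1)) _.
by rewrite /tanh2 /GRing.scale /=; field.
Qed.

Lemma tanh2N t : tanh2 (- t) = - tanh2 t.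
Proof.
rewrite /tanh2 expRN; have := expR_gt0 t; have := e1 t; move: (expR t) => y y1 y0.
by field; rewrite !gt_eqF// addrC.
Qed.

Lemma tanh2_lt1 t : -1 < tanh2 t < 1.
Proof.
rewrite /tanh2 ltr_pdivlMr// ltr_pdivrMr//.
by have := expR_gt0 t => ?; apply/andP; split; lra.
Qed.

Lemma tanh2_sqr t : tanh2 t ^+ 2 < 1.
Proof. by have /andP[h1 h2] := tanh2_lt1 t; nra. Qed.

Lemma tanh2_ltP s t : s < t -> tanh2 s < tanh2 t.
Proof.
rewrite -ltr_expR => h; rewrite /tanh2.
rewrite -subr_gt0 (_ : _ - _ = 2 * (expR t - expR s) / ((expR t + 1) * (expR s + 1))).
  by rewrite divr_gt0 ?mulr_gt0// subr_gt0.
by field; rewrite !gt_eqF.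
Qed.

Lemma tanh20 : tanh2 0 = 0.
Proof. by rewrite /tanh2 expR0 subrr mul0r. Qed.

Lemma tanh2_le_id t : 0 <= t -> tanh2 t <= t.
Proof.
move=> t0; have [c _] := @MVT0 R tanh2 (fun t => (1 - tanh2 t ^+ 2) / 2) t
  (fun t _ => is_derive_tanh2 t).
rewrite tanh20 subr0 => ->; have := sqr_ge0 (tanh2 c); have := tanh2_sqr c => *; nra.
Qed.

(** The derivative [tanh2] lies in ]-1, 1[. The oscillation of [ltanh2 \o w] on an annulus is thus
    at most that of [w], which stays bounded as the annulus shrinks to a logarithmic singularity. *)
Lemma ltanh2_lip s t : `|ltanh2 s - ltanh2 t| <= `|s - t|.
Proof.
have [|c _] := @MVT0 R (fun u => ltanh2 (u + t)) (fun u => tanh2 (u + t)) (s - t).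
  move=> u _; rewrite -[tanh2 _]mulr1.
  apply: (@is_derive1_compE _ ltanh2 (fun u => u + t) _ _ _ _ erefl (is_derive_ltanh2 _)).
  by apply: is_derive_eq; rewrite addr0.
rewrite subrK add0r => ->; rewrite normrM -[leRHS]mul1r ler_wpM2r//.
by have /andP[h1 h2] := tanh2_lt1 (c + t); rewrite ler_norml !ltW.
Qed.

Lemma Ck_tanh2 k U (f : R * R -> R) : open U -> Ck_on k U f -> Ck_on k U (tanh2 \o f).
Proof.
move=> oU; elim: k => [|k IH] hf.
  exact: (@Ck0_comp R U tanh2 (fun y => (1 - tanh2 y ^+ 2) / 2) f
    (fun x _ => is_derive_tanh2 (f x)) hf).
have hi := IH (Ck_pred hf).
apply: (@Ck_comp R k U tanh2 (fun y => (1 - tanh2 y ^+ 2) / 2) f oU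
  (fun x _ => is_derive_tanh2 (f x)) _ hf).
apply: (eq_Ck oU _ (Ck_scale 2^-1 oU (Ck_sub oU (Ck_cst k U 1) (Ck_mul oU hi hi)))) => x _.
by rewrite /= mulrC expr2.
Qed.

Lemma Ck_ltanh2 k U (f : R * R -> R) : open U -> Ck_on k U f -> Ck_on k U (ltanh2 \o f).
Proof.
move=> oU; case: k => [|k] hf.
  exact: (@Ck0_comp R U ltanh2 tanh2 f (fun x _ => is_derive_ltanh2 (f x)) hf).
exact: (@Ck_comp R k U ltanh2 tanh2 f oU (fun x _ => is_derive_ltanh2 (f x))
  (Ck_tanh2 oU (Ck_pred hf)) hf).
Qed.

Lemma osc_le_int (F F' h : R -> R) (p q : R) : p < q ->
  (forall t, p <= t <= q -> is_derive t 1 F (F' t)) ->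
  (forall t, p <= t <= q -> {for t, continuous F'}) ->
  (forall t, p <= t <= q -> {for t, continuous h}) ->
  (forall t, p <= t <= q -> `|F' t| <= h t) ->
  forall s t, p <= s <= q -> p <= t <= q ->
  `|F s - F t| <= \int[@lebesgue_measure R]_(u in `[p, q]) h u.
Proof.
move=> pq dF cF ch Fh.
have ii (k : R -> R) u v : (forall t, p <= t <= q -> {for t, continuous k}) ->
    p <= u -> v <= q -> (@lebesgue_measure R).-integrable `[u, v] (EFin \o k).
  move=> ck pu vq; apply: continuous_compact_integrable; first exact: segment_compact.
  apply: continuous_in_subspaceT => t /set_mem /=; rewrite in_itv /= => /andP[ut tv].
  by apply: ck; rewrite (le_trans pu ut) (le_trans tv vq).
have sub u v : p <= u -> v <= q ->
    \int[@lebesgue_measure R]_(x in `[u, v]) h x <= \int[@lebesgue_measure R]_(x in `[p, q]) h x.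
  move=> pu vq; rewrite /Rintegral fine_le//; try exact: integrable_fin_num (ii _ _ _ ch _ _).
  apply: ge0_subset_integral => //.
  - by case/integrableP : (ii h p q ch (lexx _) (lexx _)).
  - move=> x /=; rewrite in_itv /= => xpq; rewrite lee_fin.
    by apply: le_trans (Fh _ xpq).
  - by apply: subset_itvScc.
move=> s t hs ht.
wlog st : s t hs ht / s <= t.
  move=> H; have [/H|/ltW ts] := leP s t; first exact.
  by rewrite distrC; exact: H.
move: st; rewrite le_eqVlt => /predU1P[->|st].
  by rewrite subrr normr0; apply: Rintegral_ge0 => x /=; rewrite in_itv /= => /Fh; exact: le_trans.
have [/andP[ps sq] /andP[pt' tq]] := (hs, ht).
have in' u : s <= u <= t -> p <= u <= q.
  by move=> /andP[su ut]; rewrite (le_trans ps su) (le_trans ut tq).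
rewrite distrC -(@FTC_segment _ F F' s t st (fun u hu => dF u (in' u hu)) (fun u hu => cF u (in' u hu))).
apply: le_trans (sub s t ps tq).
apply: le_trans (le_normr_Rintegral _ (ii _ _ _ cF ps tq)) _ => //.
apply: le_Rintegral => //.
- exact: (integrable_abse (ii _ _ _ cF ps tq)).
- exact: ii.
- by move=> x /=; rewrite in_itv /= => /in' /Fh.
Qed.

End tanh_half.

(** * Cutting out the singular points *)

Section energy.
Context {R : realType}.
Variables (a b : R * R).
Hypothesis hab : lin_indep2 a b.
Notation mu := (@lebesgue_measure R).
Notation mu2 := ((@lebesgue_measure R) \x (@lebesgue_measure R))%E.
Notation T2 := (measurableTypeR R * measurableTypeR R)%type.
Notation cs := (cs a b).
Notation ct := (ct a b).
Notation pt := (pt a b).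
Notation kap := (kap a b).
Notation bump := (bump a b).
Notation periodic2 := (periodic2 a b).

Variables (I : finType) (P : I -> R * R) (c : I -> R).
Hypothesis hP : forall i j, i != j -> kap (P i - P j) != 0.

Notation regular_set := (regular_set a b P).

Lemma kap_le_dist x y z : kap (x - y) <= 2 * kap (x - z) + 2 * kap (y - z).
Proof.
have -> : x - y = (x - z) + - (y - z) by rewrite opprB addrA subrK.
by rewrite -[kap (y - z)]kapN; exact: kapD_le.
Qed.

Lemma separation : exists2 d : R, 0 < d & forall i j, i != j -> d <= kap (P i - P j).
Proof.
(* On the diagonal [kap] vanishes, so a dummy 1 takes its place in the minimum. *)
pose F (ij : I * I) := if ij.1 == ij.2 then 1 else kap (P ij.1 - P ij.2).
have F0 ij : 0 < F ij.
  rewrite /F; case: ifPn => // h.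
  by rewrite lt_neqAle eq_sym hP//= kap_ge0.
pose d := \big[Num.min/1]_(ij : I * I) F ij.
exists d; first by apply: lt_bigmin.
move=> i j ij; have : d <= F (i, j) by apply: bigmin_le.
by rewrite /F /= (negbTE ij).
Qed.

(* The parameter range in which the bumps around the singular points are
   disjointly supported. *)
Definition small_radius (r : R) := 0 < r /\ forall i j, i != j -> 20 * r ^+ 2 < kap (P i - P j).

Lemma small_radius_near : \forall r \near 0^'+, small_radius r.
Proof.
have [d d0 hd] := separation.
have m0 : 0 < Num.min 1 (d / 20) by rewrite lt_min ltr01 divr_gt0.
near=> r.
have r0 : 0 < r by near: r; exact: nbhs_right_gt.
have : r < Num.min 1 (d / 20) by near: r; exact: nbhs_right_lt.
rewrite lt_min => /andP[r1 rd]; split => // i j ij.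
apply: lt_le_trans (hd _ _ ij).
have : r ^+ 2 <= r by rewrite expr2 ler_piMl// ltW.
by lra.
Unshelve. all: end_near. Qed.

Definition cutout (r : R) (x : R * R) : R := 1 - \sum_(i : I) bump r (P i) x.

Lemma bump_far_kap r x0 x : 0 < r -> 4 * r ^+ 2 <= kap (x - x0) ->
  [/\ bump r x0 x = 0, partial1 (bump r x0) x = 0, partial2 (bump r x0) x = 0 &
   laplacian (bump r x0) x = 0].
Proof.
move=> r0 h; apply: bump_far => //.
have [h1|h1] := leP (2 * r ^+ 2) (sin2pi (cs (x - x0))); first by left.
by right; move: h; rewrite /kap; lra.
Qed.

Lemma bump_near_kap r x0 x : kap (x - x0) <= r ^+ 2 ->
  [/\ bump r x0 x = 1, partial1 (bump r x0) x = 0, partial2 (bump r x0) x = 0 &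
   laplacian (bump r x0) x = 0].
Proof.
rewrite /kap => h; have := sin2pi_ge0 (cs (x - x0)); have := sin2pi_ge0 (ct (x - x0)).
by move=> h1 h2; apply: bump_near; lra.
Qed.

(** If this failed, the quasi-triangle inequality would give [kap (P i - P j)] below 8 r^2 + 8 r^2 =
    16 r^2, against the 20 r^2 of [small_radius]. *)
Lemma bump_other r i j x : small_radius r -> i != j -> kap (x - P i) < 4 * r ^+ 2 ->
  4 * r ^+ 2 <= kap (x - P j).
Proof.
move=> [r0 hr] ij hx; have := hr _ _ ij.
have -> : kap (P i - P j) = kap (P j - P i) by rewrite -kapN opprB.
have := kap_le_dist (P j) (P i) x; have := sqr_ge0 r.
by rewrite -[kap (P j - x)]kapN -[kap (P i - x)]kapN !opprB; lra.
Qed.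

Lemma cutout_01 r x : small_radius r -> 0 <= cutout r x <= 1.
Proof.
move=> sr; have r0 := sr.1.
have b0 i : 0 <= bump r (P i) x by have /andP[] := bump_01 a b r (P i) x.
rewrite /cutout lerBlDr lerDl sumr_ge0 ?andbT; last by move=> i _; exact: b0.
rewrite subr_ge0; have [[i hi]|hn] := pselect (exists i, kap (x - P i) < 4 * r ^+ 2).
  rewrite (bigD1 i)//= big1 ?addr0; first by have /andP[] := bump_01 a b r (P i) x.
  move=> j ji; have [] // := @bump_far_kap r (P j) x r0.
  by apply: (@bump_other r i j) => //; rewrite eq_sym.
rewrite big1 ?ler01// => i _; have [] // := @bump_far_kap r (P i) x r0.
by rewrite leNgt; apply/negP => h; apply: hn; exists i.
Qed.

Lemma cutout_near r i x : small_radius r -> kap (x - P i) <= r ^+ 2 -> cutout r x = 0.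
Proof.
move=> sr h; have r0 := sr.1; rewrite /cutout (bigD1 i)//= big1 ?addr0.
  by have [-> _ _ _] := bump_near_kap h; rewrite subrr.
move=> j ji; have [] // := @bump_far_kap r (P j) x r0.
apply: (@bump_other r i j) => //; first by rewrite eq_sym.
by apply: (le_lt_trans h); rewrite ltr_pMl ?exprn_gt0//; lra.
Qed.

Lemma Ck_cutout k r : Ck_on k setT (cutout r).
Proof.
apply: (Ck_sub openT (Ck_cst k setT 1)).
by apply: Ck_sum => [|i]; [exact: openT|exact: Ck_bump].
Qed.

Lemma cutout_periodic r : periodic2 (cutout r).
Proof.
move=> x m n; have E i : bump r (P i) (x + lat a b m n) = bump r (P i) x.
  exact: (bump_periodic hab r (P i) x m n).
have E' : \sum_(i : I) bump r (P i) (x + lat a b m n) = \sum_(i : I) bump r (P i) x.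
  by apply: eq_bigr => i _; exact: E.
exact: (f_equal (fun s => 1 - s) E').
Qed.

Lemma laplacian_sum (r : seq I) (f : I -> R * R -> R) x : (forall i, Ck_on 2 setT (f i)) ->
  laplacian (fun x => \sum_(i <- r) f i x) x = \sum_(i <- r) laplacian (f i) x.
Proof.
move=> hf; elim: r => [|i r IH].
  rewrite big_nil (_ : (fun x => \sum_(i <- [::]) f i x) = fun=> 0) ?laplacian_cst//.
  by apply/funext => y; rewrite big_nil.
rewrite (_ : (fun x => \sum_(j <- i :: r) f j x) = fun x => f i x + \sum_(j <- r) f j x).
  rewrite (@laplacianD R setT x openT Logic.I _ _ (hf i)).
    by rewrite IH big_cons.
  exact: Ck_sum openT hf.
by apply/funext => y; rewrite big_cons.
Qed.

Lemma laplacian_cutout r x : laplacian (cutout r) x = - \sum_i laplacian (bump r (P i)) x.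
Proof.
have hb i : Ck_on 2 setT (bump r (P i)) by exact: Ck_bump.
have hs : Ck_on 2 setT (fun x => \sum_i bump r (P i) x) by apply: Ck_sum openT hb.
rewrite (@laplacianD R setT x openT Logic.I (fun=> 1) (fun x => - \sum_i bump r (P i) x)).
- by rewrite laplacian_cst add0r (@laplacianN R setT x openT Logic.I _ hs) laplacian_sum.
- exact: Ck_cst.
- exact: (Ck_opp openT hs).
Qed.

Definition near_set (r : R) : set (R * R) := [set x | exists i, kap (x - P i) < r ^+ 2].

Lemma open_near_set r : open (near_set r).
Proof.
rewrite openE => x [i hi]; have := @kapB_continuous R a b (P i) x.
move=> /cvgr_lt /(_ _ hi); apply: filterS => y hy; by exists i.
Qed.

Lemma regular_or_near r x : 0 < r -> regular_set x \/ near_set r x.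
Proof.
move=> r0; have [h|h] := pselect (regular_set x); first by left.
right; apply: contrapT => hn; apply: h => i; apply/eqP => k0; apply: hn; exists i.
by rewrite k0 exprn_gt0.
Qed.

(* [A] gathers the lines of a fundamental cell that meet the support of a bump. *)
Lemma bad_set_bound (s0 sigma r : R) : 0 < r -> exists A : set (measurableTypeR R),
  [/\ measurable A, (mu A <= (12 * r)%:E)%E &
  forall s, s0 <= s <= s0 + 1 -> sin2pi (s - sigma) < 2 * r ^+ 2 -> A s].
Proof.
move=> r0; pose m := Num.floor (s0 - sigma).
have /andP[m1 m2] := floor_itv (s0 - sigma).
rewrite -/m intrD mulr1z in m1 m2.
(* As s - sigma lies in [m, m + 2[, an integer at distance at most 1 / 2 is m, m + 1 or m + 2. Each
   carries an interval of half-width 2 r, which exceeds sqrt 2 * r; together they measure at most 12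
   r. *)
pose J (k : R) : set (measurableTypeR R) := `[sigma + m%:~R + k - 2 * r, sigma + m%:~R + k + 2 * r]%classic.
exists (J 0 `|` (J 1 `|` J 2)); have mJ k : measurable (J k) by exact: measurable_itv.
have muJ k : mu (J k) = (4 * r)%:E by rewrite mu_segment; [congr _%:E; ring|lra].
split.
- by do 2 (apply: measurableU => //).
- apply: (le_trans (measureU2 _ (mJ 0) (measurableU _ _ (mJ 1) (mJ 2)))).
  apply: (@le_trans _ _ (mu (J 0%R) + (mu (J 1%R) + mu (J 2%R)))%E).
    by apply: leeD2l; exact: measureU2.
  by rewrite !muJ -!EFinD lee_fin; lra.
- move=> s /andP[s1 s2] h; have [k hk k2] := sin2pi_dist (s - sigma).
  have hr : `|s - sigma - k%:~R| <= 2 * r.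
    rewrite -ler_sqr ?nnegrE ?mulr_ge0 ?(ltW r0)// real_normK ?num_real//.
    by rewrite exprMn; have := sqr_ge0 r; lra.
  move: hk hr; rewrite !ler_norml => /andP[k3 k4] /andP[k5 k6].
  have h1 : (m - 1 < k)%R by rewrite -(ltr_int R) intrB mulr1z; lra.
  have h2 : (k < m + 3)%R by rewrite -(ltr_int R) intrD; lra.
  have : k = m \/ (k = m + 1 \/ k = m + 2) by move: h1 h2; clear; lia.
  have E j : k = m + j -> J j%:~R s.
    move=> kE; rewrite /J /= in_itv /=.
    by move: k5 k6; rewrite kE intrD => k5 k6; apply/andP; split; lra.
  case=> [k0|[k1|k1]]; [left|right;left|right;right].
  + by apply: (E 0); rewrite addr0.
  + exact: (E 1).
  + exact: (E 2).
Qed.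

Variables (g : R -> R) (C0 : R).
Hypothesis hC0 : 0 < C0.
Hypothesis hg : forall t, tanh2 t ^+ 2 * ((1 - tanh2 t ^+ 2) / 2) <= C0 * (tanh2 t * g t).

(** Off the singular points the equation is pointwise, and the masses survive as the coefficients
    [c i] of the logarithms: a positive [c i] means that w tends to -oo at [P i], a negative one
    that it tends to +oo. *)
Record solves (eps : R) (w : R * R -> R) : Prop := Solves {
  solves_eps : 0 < eps ;
  solves_periodic : periodic2 w ;
  solves_smooth : smooth_on regular_set w ;
  solves_eqn : forall x, regular_set x -> laplacian w x = eps ^- 2 * g (w x) ;
  solves_sing : forall i, exists l : R,
    w x - c i * ln (sqnorm (x - P i)) @[x --> (P i)^'] --> l }.

Section one_solution.
Variables (eps : R) (w : R * R -> R).
Hypothesis sol : solves eps w.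

Let S := ltanh2 \o w.
Let oU : open regular_set := @open_regular_set R a b I P.
Let sw k : Ck_on k regular_set w := solves_smooth sol k.
Let Sw k : Ck_on k regular_set S. Proof. exact: (Ck_ltanh2 oU (sw k)). Qed.

(** As [S] is a primitive of tanh composed with [w], its Laplacian is the whole energy density:
    testing the equation against T amounts to integrating [laplacian S]. *)
Lemma laplacian_S x : regular_set x -> laplacian S x =
  (1 - tanh2 (w x) ^+ 2) / 2 * (partial1 w x ^+ 2 + partial2 w x ^+ 2) +
  eps ^- 2 * (tanh2 (w x) * g (w x)).
Proof.
move=> Ux; rewrite (@laplacian_comp R regular_set x oU Ux ltanh2 tanh2
  (fun t => (1 - tanh2 t ^+ 2) / 2) w (sw 2)
  (fun y _ => is_derive_ltanh2 (w y)) (fun y _ => is_derive_tanh2 (w y))).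
by rewrite (solves_eqn sol Ux) [tanh2 _ * (_ * _)]mulrCA.
Qed.

Lemma Tg_ge0 t : 0 <= tanh2 t * g t.
Proof.
have : 0 <= C0 * (tanh2 t * g t).
  apply: le_trans (hg t); apply: mulr_ge0; first exact: sqr_ge0.
  by have := tanh2_sqr t; lra.
by rewrite pmulr_rge0.
Qed.

Lemma laplacian_S_ge0 x : regular_set x -> 0 <= laplacian S x.
Proof.
move=> Ux; rewrite laplacian_S//; apply: addr_ge0; last first.
  by apply: mulr_ge0 (Tg_ge0 _); rewrite invr_ge0 sqr_ge0.
apply: mulr_ge0; first by have := tanh2_sqr (w x); lra.
by rewrite addr_ge0 ?sqr_ge0.
Qed.

Let S_periodic : periodic2 S.
Proof. by move=> x m n; rewrite /S /= (solves_periodic sol). Qed.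

(** The field cutout grad S - S grad cutout vanishes near the singular points, so it is periodic and
    of class C^1 on the whole plane, whatever [S] does there; its divergence integrates to 0 over a
    cell. *)
Lemma energy_identity r s0 t0 : small_radius r ->
  Icell a b s0 t0 (fun x => cutout r x * laplacian S x - S x * laplacian (cutout r) x) = 0.
Proof.
move=> sr; have r0 := sr.1.
have chi0 x : near_set r x -> cutout r x = 0.
  by move=> [i /ltW]; exact: cutout_near.
have oN := @open_near_set r.
have chi_eq0 : {in near_set r, cutout r =1 fun=> 0} by move=> x /set_mem /chi0.
have N0 := Ck_cst 2 (near_set r) (0 : R).
pose h1 x := cutout r x * partial1 S x - S x * partial1 (cutout r) x.
pose h2 x := cutout r x * partial2 S x - S x * partial2 (cutout r) x.
have pz (x : R * R) : partial1 (fun=> 0 : R) x = 0 /\ partial2 (fun=> 0 : R) x = 0.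
  by split; exact: derive_cst.
have p0 x : near_set r x -> partial1 (cutout r) x = 0 /\ partial2 (cutout r) x = 0.
  move=> Nx; rewrite (eq_partial1 oN chi_eq0 Nx) (eq_partial2 oN chi_eq0 Nx).
  exact: pz.
have h10 x : near_set r x -> h1 x = 0.
  by move=> Nx; rewrite /h1 chi0// (p0 x Nx).1 mul0r mulr0 subrr.
have h20 x : near_set r x -> h2 x = 0.
  by move=> Nx; rewrite /h2 chi0// (p0 x Nx).2 mul0r mulr0 subrr.
have cU k : Ck_on k regular_set (cutout r).
  by apply: Ck_subset (Ck_cutout k r).
have UN : setT = regular_set `|` near_set r.
  by apply/seteqP; split => // x _; exact: regular_or_near.
have Ch1 : Ck_on 1 setT h1.
  rewrite UN; apply: Ck_setU.
    exact: (Ck_sub oU (Ck_mul oU (cU 1) (Ck_partial1 (Sw 2)))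
      (Ck_mul oU (Sw 1) (Ck_partial1 (cU 2)))).
  by apply: (eq_Ck oN _ (Ck_cst 1 _ 0)) => x /set_mem Nx; rewrite h10.
have Ch2 : Ck_on 1 setT h2.
  rewrite UN; apply: Ck_setU.
    exact: (Ck_sub oU (Ck_mul oU (cU 1) (Ck_partial2 (Sw 2)))
      (Ck_mul oU (Sw 1) (Ck_partial2 (cU 2)))).
  by apply: (eq_Ck oN _ (Ck_cst 1 _ 0)) => x /set_mem Nx; rewrite h20.
have [pS1 pS2] := periodic_partial S_periodic.
have [pc1 pc2] := periodic_partial (cutout_periodic r).
have ph1 : periodic2 h1.
  by move=> x m n; rewrite /h1 cutout_periodic S_periodic pS1 pc1.
have ph2 : periodic2 h2.
  by move=> x m n; rewrite /h2 cutout_periodic S_periodic pS2 pc2.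
have [I1 _] := Icell_partial hab s0 t0 Ch1 ph1.
have [_ I2] := Icell_partial hab s0 t0 Ch2 ph2.
have c1 z (_ : cell s0 t0 z) : {for z, continuous (fun z => partial1 h1 (pt z))}.
  by apply: comp_pt_continuous; exact: (Ck_continuous (Ck_partial1 Ch1) (Logic.I : setT (pt z))).
have c2 z (_ : cell s0 t0 z) : {for z, continuous (fun z => partial2 h2 (pt z))}.
  by apply: comp_pt_continuous; exact: (Ck_continuous (Ck_partial2 Ch2) (Logic.I : setT (pt z))).
have E x : cutout r x * laplacian S x - S x * laplacian (cutout r) x =
    partial1 h1 x + partial2 h2 x.
  have [Ux|Nx] := regular_or_near x r0.
    by rewrite (green_divergence oU Ux (cU 2) (Sw 2)).
  rewrite chi0// (eq_laplacian oN chi_eq0 Nx) laplacian_cst mul0r mulr0 subrr.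
  have h1z : {in near_set r, h1 =1 fun=> 0} by move=> y /set_mem /h10.
  have h2z : {in near_set r, h2 =1 fun=> 0} by move=> y /set_mem /h20.
  by rewrite (eq_partial1 oN h1z Nx) (eq_partial2 oN h2z Nx) (pz x).1 (pz x).2 addr0.
rewrite /Icell; transitivity (\int[mu2]_(z in (cell s0 t0 : set T2))
    (partial1 h1 (pt z) + partial2 h2 (pt z))).
  by apply: eq_Rintegral => z _; rewrite E.
apply: (etrans (Rintegral_rectD c1 c2)).
by apply: (etrans (congr2 +%R I1 I2)); rewrite addr0.
Qed.

End one_solution.

End energy.

(** * The energy bound, uniform in eps *)

Section energy_bound.
Context {R : realType}.
Variables (a b : R * R).
Hypothesis hab : lin_indep2 a b.
Notation mu2 := ((@lebesgue_measure R) \x (@lebesgue_measure R))%E.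
Notation T2 := (measurableTypeR R * measurableTypeR R)%type.
Notation cs := (cs a b).
Notation ct := (ct a b).
Notation pt := (pt a b).
Notation lat := (lat a b).
Notation kap := (kap a b).
Notation bump := (bump a b).

Variables (I : finType) (P : I -> R * R) (c : I -> R).
Hypothesis hP : forall i j, i != j -> kap (P i - P j) != 0.
Variables (g : R -> R).

Notation regular_set := (regular_set a b P).
Notation near_set := (near_set a b P).
Notation small_radius := (small_radius a b P).
Notation cutout := (cutout a b P).
Notation solves := (solves a b P c g).

Lemma continuous_vanishing r (F : R * R -> R) : 0 < r ->
  (forall x, regular_set x -> {for x, continuous F}) ->
  (forall x, near_set r x -> F x = 0) -> continuous F.
Proof.
move=> r0 hF F0 x; have [Ux|Nx] := @regular_or_near R a b I P r x r0; first exact: hF.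
apply: (@near_eq_continuous _ (fun=> 0)); last exact: cst_continuous.
have oN := @open_near_set R a b I P r.
by apply: (@eq_near_nbhs _ (near_set r)) => // y /set_mem /F0.
Qed.

(* The derivatives of the bump of radius [r] live on this annulus. *)
Lemma bump_annulus : exists2 B : R, 1 < B & forall r x0 x, 0 < r ->
  r ^+ 2 < kap (x - x0) < 4 * r ^+ 2 ->
  exists m n, r ^+ 2 / B <= sqnorm (x - lat m n - x0) <= B * r ^+ 2.
Proof.
have [L L0 hL] := coord_bound hab; have p2 := @pi_ge2 R.
have p0 : 0 < (pi : R) ^+ 2 by rewrite exprn_gt0// pi_gt0.
pose B := 1 + 4 * L + L * pi ^+ 2.
have Lp : 0 < L * pi ^+ 2 by rewrite mulr_gt0.
have B0 : 0 < B by rewrite /B; lra.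
exists B => [|r x0 x r0 /andP[h1 h2]]; first by rewrite /B; lra.
have [m [n [_ _ m2 n2]]] := kap_dist hab (x - x0); exists m, n.
have E : x - x0 - lat m n = x - lat m n - x0 by rewrite addrAC.
rewrite E in m2 n2; have [q1 q2] := hL (x - lat m n - x0).
have hk : kap (x - lat m n - x0) = kap (x - x0).
  by rewrite -E lat_opp (kap_lat hab).
have k1 : cs (x - lat m n - x0) ^+ 2 + ct (x - lat m n - x0) ^+ 2 <= kap (x - x0).
  by rewrite /kap; exact: lerD m2 n2.
have k2 := kap_le a b (x - lat m n - x0); rewrite hk in k2.
move: (cs _ ^+ 2 + ct _ ^+ 2) q1 q2 k1 k2 => u q1 q2 k1 k2.
have r20 : 0 < r ^+ 2 by rewrite exprn_gt0.
apply/andP; split.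
  rewrite ler_pdivrMr//.
  have : r ^+ 2 <= pi ^+ 2 * (L * sqnorm (x - lat m n - x0)).
    apply: (le_trans (ltW h1)); apply: (le_trans k2); rewrite ler_pM2l//.
  have := sqnorm_ge0 (x - lat m n - x0); rewrite /B => q0 h.
  by nra.
apply: (le_trans q1); rewrite /B.
by have := mulr_ge0 (ltW Lp) (ltW r20); nra.
Qed.

(** Mean zero allows a constant to be subtracted from [S] in the integrals of
    [S * laplacian (bump r (P i))]. *)
Lemma bump_laplacian_cell r x0 s0 t0 :
  Icell a b s0 t0 (laplacian (bump r x0)) = 0.
Proof.
have hb := Ck_bump a b 2 r x0; have hp := @bump_periodic R a b hab r x0.
have [pp1 pp2] := periodic_partial hp.
have [I1 _] := Icell_partial hab s0 t0 (Ck_partial1 hb) pp1.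
have [_ I2] := Icell_partial hab s0 t0 (Ck_partial2 hb) pp2.
have c1 z (_ : cell s0 t0 z) : {for z, continuous (fun z => partial1 (partial1 (bump r x0)) (pt z))}.
  by apply: comp_pt_continuous; exact: (Ck_continuous (Ck_partial1 (Ck_partial1 hb)) (Logic.I : setT (pt z))).
have c2 z (_ : cell s0 t0 z) : {for z, continuous (fun z => partial2 (partial2 (bump r x0)) (pt z))}.
  by apply: comp_pt_continuous; exact: (Ck_continuous (Ck_partial2 (Ck_partial2 hb)) (Logic.I : setT (pt z))).
apply: (etrans (Rintegral_rectD c1 c2)).
by apply: (etrans (congr2 +%R I1 I2)); rewrite addr0.
Qed.

Lemma bump_near_set r i x : small_radius r -> near_set r x -> laplacian (bump r (P i)) x = 0.
Proof.
move=> sr [j hj]; have r0 := sr.1; have [ij|ij] := eqVneq j i.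
  by rewrite ij in hj; have [_ _ _ ->] := bump_near_kap (ltW hj).
have [] // := @bump_far_kap R a b r (P i) x r0.
apply: (@bump_other R a b I P r j i) => //; apply: (lt_trans hj).
by rewrite ltr_pMl ?exprn_gt0//; lra.
Qed.

Lemma S_bump_continuous eps w r i : solves eps w -> small_radius r ->
  continuous (fun x => (ltanh2 \o w) x * laplacian (bump r (P i)) x).
Proof.
move=> sol sr; apply: (continuous_vanishing sr.1).
  move=> x Ux; apply: continuous_mul.
    exact: (Ck_continuous (Ck_ltanh2 (@open_regular_set R a b I P) (solves_smooth sol 0)) Ux).
  exact: (Ck_continuous (Ck_laplacian openT (Ck_bump a b 2 r (P i))) (Logic.I : setT x)).
by move=> x Nx; rewrite bump_near_set// mulr0.
Qed.

(** Once the constant [S0] is subtracted, |S - S0| is at most 1 + |c i| ln B on the annulus, by the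
    Lipschitz bound and the logarithmic asymptotics. The Laplacian of the bump is at most A / r^2
    and lives on an area (12 r)^2, so the powers of r cancel. How small r must be depends on [w];
    the bound does not. *)
Lemma bump_energy_bound : exists2 E : I -> R, (forall i, 0 <= E i) &
  forall eps w, solves eps w -> forall i, \forall r \near 0^'+, forall s0 t0,
  `|Icell a b s0 t0 (fun x => (ltanh2 \o w) x * laplacian (bump r (P i)) x)| <= E i.
Proof.
have [B B1 hB] := bump_annulus; have [A A0 hA] := @bump_laplacian_bound R a b.
have B0 : 0 < B by apply: lt_trans B1.
have lB0 : 0 <= ln B by rewrite ln_ge0// ltW.
pose Mi i := 1 + `|c i| * ln B.
have Mi0 i : 0 <= Mi i by rewrite addr_ge0// mulr_ge0.
(* 144 = 12^2 comes from the two sets of measure at most 12 r that contain the coordinates of the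
   support. *)
exists (fun i => Mi i * A * 144) => [i|eps w sol i].
  by rewrite !mulr_ge0// ltW.
have [l hl] := solves_sing sol i.
have : \forall y \near (P i)^', `|w y - c i * ln (sqnorm (y - P i)) - l| <= 1.
  by move/cvgrPdist_le: hl => /(_ 1 ltr01); apply: filterS => y; rewrite distrC.
move=> /nbhs_ballP[rho /= rho0 hrho].
have m0 : 0 < Num.min 1 (rho ^+ 2 / B) by rewrite lt_min ltr01 divr_gt0// exprn_gt0.
near=> r => s0 t0.
have sr : small_radius r by near: r; exact: small_radius_near.
have r0 := sr.1; have r20 : 0 < r ^+ 2 by rewrite exprn_gt0.
have : r < Num.min 1 (rho ^+ 2 / B) by near: r; exact: nbhs_right_lt.
rewrite lt_min ltr_pdivlMr// => /andP[r1 rrho].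
have rB : B * r ^+ 2 < rho ^+ 2.
  have : r ^+ 2 <= r by rewrite expr2 ler_piMl// ltW.
  by move=> h; have := ler_wpM2l (ltW B0) h; lra.
pose S := ltanh2 \o w.
(* The value of [S] expected at distance r from [P i], where [w] is close to c ln r^2 + l. *)
pose S0 := ltanh2 (c i * ln (r ^+ 2) + l).
pose F x := (S x - S0) * laplacian (bump r (P i)) x.
have cL : continuous (laplacian (bump r (P i))).
  move=> x; exact: (Ck_continuous (Ck_laplacian openT (Ck_bump a b 2 r (P i))) (Logic.I : setT x)).
have cSL := S_bump_continuous (i:=i) sol sr.
have cF : continuous F.
  move=> x; apply: (@near_eq_continuous _ (fun x => S x * laplacian (bump r (P i)) x
      + - S0 * laplacian (bump r (P i)) x)).
    by apply: filterE => y; rewrite /F; move: (laplacian _ y) => q; ring.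
  by apply: continuous_add; [exact: cSL|apply: continuous_scale; exact: cL].
have kz z (_ : cell s0 t0 z) : {for z, continuous (fun z => laplacian (bump r (P i)) (pt z))}.
  by apply: comp_pt_continuous; exact: cL.
have kS z (_ : cell s0 t0 z) : {for z, continuous (fun z => S (pt z) * laplacian (bump r (P i)) (pt z))}.
  exact: (@comp_pt_continuous R a b (fun x => S x * laplacian (bump r (P i)) x) z (cSL (pt z))).
have kz' z (cz : cell s0 t0 z) := continuous_scale (- S0) (kz z cz).
have -> : Icell a b s0 t0 (fun x => S x * laplacian (bump r (P i)) x) = Icell a b s0 t0 F.
  apply/esym; transitivity (\int[mu2]_(z in (cell s0 t0 : set T2))
     (S (pt z) * laplacian (bump r (P i)) (pt z) + - S0 * laplacian (bump r (P i)) (pt z))).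
    by apply: eq_Rintegral => z _; rewrite /F; move: (laplacian _ _) => q; ring.
  apply: (etrans (Rintegral_rectD kS kz')).
  have e0 := etrans (Rintegral_rectZ kz (- S0)) (congr1 ( *%R (- S0)) (bump_laplacian_cell r (P i) s0 t0)).
  by apply: (etrans (congr2 +%R erefl e0)); rewrite mulr0 addr0.
have [As [mAs muAs hAs]] := bad_set_bound s0 (cs (P i)) r0.
have [At [mAt muAt hAt]] := bad_set_bound t0 (ct (P i)) r0.
have r12 : 0 <= 12 * r by rewrite mulr_ge0// ltW.
have M0 : 0 <= Mi i * (A / r ^+ 2) by rewrite mulr_ge0// divr_ge0 ?ltW.
have -> : Mi i * A * 144 = Mi i * (A / r ^+ 2) * (12 * r * (12 * r)).
  by field; rewrite gt_eqF.
have Fz (x : R * R) : laplacian (bump r (P i)) x = 0 -> F x = 0 by move=> h; rewrite /F h mulr0.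
apply: (@Rintegral_rect_bound R _ _ _ _ (fun z => F (pt z)) As At _ _ _ _
  mAs mAt M0 r12 r12 muAs muAt).
- by move=> z _; apply: comp_pt_continuous; exact: cF.
- move=> z _; set x := pt z.
  have [h|h1] := leP (kap (x - P i)) (r ^+ 2).
    by have [_ _ _ L0] := bump_near_kap h; rewrite Fz// normr0.
  have [h|h2] := leP (4 * r ^+ 2) (kap (x - P i)).
    by have [_ _ _ L0] := bump_far_kap r0 h; rewrite Fz// normr0.
  rewrite normrM; apply: ler_pM => //; last exact: hA.
  have [m [n]] := hB r (P i) x r0 ltac:(by rewrite h1 h2).
  set y := x - lat m n => /andP[q1 q2].
  have Sy : S x = S y.
    rewrite /S /= -(solves_periodic sol y m n) /y subrK//.
  rewrite Sy; apply: (le_trans (ltanh2_lip _ _)).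
  have qy0 : 0 < sqnorm (y - P i) by apply: lt_le_trans q1; rewrite divr_gt0.
  have yP : y != P i.
    by apply/eqP => yP; move: qy0; rewrite yP subrr /sqnorm /= expr0n addr0 ltxx.
  have hy : `|w y - c i * ln (sqnorm (y - P i)) - l| <= 1.
    apply: hrho => //.
    have qr : sqnorm (y - P i) < rho ^+ 2 by exact: le_lt_trans rB.
    have nlt (t : R) : t ^+ 2 < rho ^+ 2 -> `|t| < rho.
      by rewrite -[t ^+ 2]real_normK ?num_real// ltr_sqr ?nnegrE// ltW.
    move: qr; rewrite /sqnorm => qr.
    have := sqr_ge0 (y - P i).1; have := sqr_ge0 (y - P i).2 => u1 u2.
    split; rewrite /ball /= distrC; apply: nlt.
      by apply: le_lt_trans qr; rewrite lerDl.
    by apply: le_lt_trans qr; rewrite lerDr.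
  have lnb : `|ln (sqnorm (y - P i)) - ln (r ^+ 2)| <= ln B.
    rewrite -ln_div ?posrE//.
    have qr0 : 0 < sqnorm (y - P i) / r ^+ 2 by rewrite divr_gt0.
    rewrite ler_norml; apply/andP; split.
      rewrite -lnV ?posrE// ler_ln ?posrE ?invr_gt0//.
      by rewrite ler_pdivlMr// mulrC.
    by rewrite ler_ln ?posrE// ler_pdivrMr.
  have -> : w y - (c i * ln (r ^+ 2) + l) = (w y - c i * ln (sqnorm (y - P i)) - l)
     + c i * (ln (sqnorm (y - P i)) - ln (r ^+ 2)) by ring.
  apply: (le_trans (ler_normD _ _)); rewrite /Mi; apply: lerD => //.
  by rewrite normrM; apply: ler_wpM2l.
- move=> z [/= zs zt] hn; apply: Fz.
  rewrite !in_itv /= in zs zt.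
  have [h|h1] := leP (2 * r ^+ 2) (sin2pi (cs (pt z - P i))).
    by have [] // := @bump_far R a b r (P i) (pt z) r0; left.
  have [h|h2] := leP (2 * r ^+ 2) (sin2pi (ct (pt z - P i))).
    by have [] // := @bump_far R a b r (P i) (pt z) r0; right.
  exfalso; apply: hn; split.
    by apply: hAs => //; rewrite csB (cs_pt hab) in h1.
  by apply: hAt => //; rewrite ctB (ct_pt hab) in h2.
Unshelve. all: end_near. Qed.

Lemma energy_bound : exists2 E0 : R, 0 < E0 &
  forall eps w, solves eps w -> \forall r \near 0^'+, small_radius r /\
  forall s0 t0, Icell a b s0 t0 (fun x => cutout r x * laplacian (ltanh2 \o w) x) <= E0.
Proof.
have [E Ep hE] := bump_energy_bound.
exists (1 + \sum_i E i) => [|eps w sol]; first by rewrite ltr_pwDl// sumr_ge0.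
pose S := ltanh2 \o w.
have hall : \forall r \near 0^'+, forall i, forall s0 t0,
  `|Icell a b s0 t0 (fun x => S x * laplacian (bump r (P i)) x)| <= E i.
  apply: (@filter_forall _ I (fun i r => forall s0 t0,
    `|Icell a b s0 t0 (fun x => S x * laplacian (bump r (P i)) x)| <= E i) 0^'+) => i.
  exact: hE sol i.
near=> r; have sr : small_radius r by near: r; exact: small_radius_near.
split=> // s0 t0; have r0 := sr.1.
have hr : forall i, forall s0 t0,
  `|Icell a b s0 t0 (fun x => S x * laplacian (bump r (P i)) x)| <= E i by near: r; exact: hall.
have cL : continuous (fun x => cutout r x * laplacian S x).
  apply: (continuous_vanishing r0) => x.
    move=> Ux; apply: continuous_mul.
      exact: (Ck_continuous (Ck_cutout a b P 0 r) (Logic.I : setT x)).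
    exact: (Ck_continuous (Ck_laplacian (@open_regular_set R a b I P)
      (Ck_ltanh2 (@open_regular_set R a b I P) (solves_smooth sol 2))) Ux).
  by move=> [i /ltW hi]; rewrite (cutout_near sr hi) mul0r.
have kL z (_ : cell s0 t0 z) : {for z, continuous (fun z => cutout r (pt z) * laplacian S (pt z))}.
  exact: (@comp_pt_continuous R a b (fun x => cutout r x * laplacian S x) z (cL (pt z))).
have kB i z (_ : cell s0 t0 z) :
    {for z, continuous (fun z => S (pt z) * laplacian (bump r (P i)) (pt z))}.
  have cSi := S_bump_continuous (i:=i) sol sr.
  exact: (@comp_pt_continuous R a b (fun x => S x * laplacian (bump r (P i)) x) z (cSi (pt z))).
have kSum z (cz : cell s0 t0 z) :
    {for z, continuous (fun z => \sum_i S (pt z) * laplacian (bump r (P i)) (pt z))}.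
  elim: (index_enum I) => [|i s IH].
    apply: (@near_eq_continuous _ (fun=> 0)); last exact: cst_continuous.
    by near=> y; rewrite big_nil.
  apply: (@near_eq_continuous _ (fun z => S (pt z) * laplacian (bump r (P i)) (pt z) +
     \sum_(j <- s) S (pt z) * laplacian (bump r (P j)) (pt z))).
    by near=> y; rewrite big_cons.
  by apply: continuous_add; [exact: (kB i z cz)|exact: IH].
have E1 : Icell a b s0 t0 (fun x => cutout r x * laplacian S x) +
    \sum_i Icell a b s0 t0 (fun x => S x * laplacian (bump r (P i)) x) = 0.
  rewrite -[RHS](energy_identity hab sol s0 t0 sr).
  transitivity (Icell a b s0 t0 (fun x => cutout r x * laplacian S x +
     \sum_i S x * laplacian (bump r (P i)) x)).
    apply/esym; apply: (etrans (Rintegral_rectD kL kSum)); congr (_ + _).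
    exact: (Rintegral_rect_sum (index_enum I) kB).
  apply: eq_Rintegral => z _.
  by rewrite (laplacian_cutout a b P) mulrN opprK mulr_sumr.
have -> : Icell a b s0 t0 (fun x => cutout r x * laplacian S x) =
    - \sum_i Icell a b s0 t0 (fun x => S x * laplacian (bump r (P i)) x).
  by apply/eqP; rewrite -addr_eq0 E1.
apply: (le_trans (ler_norm _)); rewrite normrN.
apply: (le_trans (ler_norm_sum _ _ _)).
apply: (@le_trans _ _ (\sum_i E i)); last by rewrite lerDr.
by apply: ler_sum => i _; exact: hr.
Unshelve. all: end_near. Qed.

End energy_bound.

(** * Grids of lines and barriers *)

Lemma middle_half (R : realType) (l p t : R) : 0 < l -> l <= 1 ->
  p + l / 4 <= t -> t <= p + l * 3 / 4 -> p <= t <= p + 1 /\ p < t < p + l.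
Proof. by move=> *; split; apply/andP; split; lra. Qed.

Lemma quarters (R : realType) (l : R) : 0 < l -> l <= 1 -> forall p,
  [/\ p <= p + l / 4, p + l / 4 <= p + l * 3 / 4 & p + l * 3 / 4 <= p + 1].
Proof. by move=> *; split; lra. Qed.

(** * Lines of small oscillation *)

Section good_lines.
Context {R : realType}.
Variables (a b : R * R).
Hypothesis hab : lin_indep2 a b.
Notation mu := (@lebesgue_measure R).
Notation cs := (cs a b).
Notation ct := (ct a b).
Notation pt := (pt a b).
Notation lat := (lat a b).
Notation kap := (kap a b).

Variables (I : finType) (P : I -> R * R) (c : I -> R).
Hypothesis hP : forall i j, i != j -> kap (P i - P j) != 0.
Variables (g : R -> R) (C0 : R).
Hypothesis hC0 : 0 < C0.
Hypothesis hg : forall t, tanh2 t ^+ 2 * ((1 - tanh2 t ^+ 2) / 2) <= C0 * (tanh2 t * g t).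

Notation regular_set := (regular_set a b P).
Notation small_radius := (small_radius a b P).
Notation cutout := (cutout a b P).
Notation solves := (solves a b P c g).

(** The cube is chosen for its derivative 3 T^2 T': the product T^2 T' is exactly what [hg]
    controls. *)
Definition cub (t : R) : R := tanh2 t ^+ 3.

Lemma is_derive_cub (t : R) : is_derive t 1 cub (3 * tanh2 t ^+ 2 * ((1 - tanh2 t ^+ 2) / 2)).
Proof.
have h := is_derive_tanh2 t.
have h3 : is_derive (tanh2 t) 1 (fun y : R => y ^+ 3) (3 * tanh2 t ^+ 2).
  by apply: is_derive_eq; rewrite /GRing.scale /=; ring.
exact: (@is_derive1_compE _ (fun y => y ^+ 3) tanh2 t _ _ _ erefl h3 h).
Qed.

Lemma Ck_cub k U (f : R * R -> R) : open U -> Ck_on k U f -> Ck_on k U (cub \o f).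
Proof.
move=> oU hf; have h := Ck_tanh2 oU hf.
by apply: (eq_Ck oU _ (Ck_mul oU h (Ck_mul oU h h))) => x _; rewrite /cub /=; ring.
Qed.

(** Here p = T', q = T^2, tg = T g and e = 1 / eps. Expanding the square
    [e * p * (eps * n - q) ^+ 2] bounds 2 q p n by eps p n^2 plus p q^2 / eps; as q <= 1, the latter
    is at most q p / eps, which [hg] bounds by C0 tg / eps. *)
Let cub_amgm (eps e p q d d' tg : R) : 0 < eps -> 0 < e -> eps * e = 1 -> 0 <= p ->
  0 <= q -> q <= 1 -> 0 <= tg -> q * p <= C0 * tg ->
  `|3 * q * p * d| <= 3 / 2 * (1 + C0) * eps * (p * (d ^+ 2 + d' ^+ 2) + e ^+ 2 * tg).
Proof.
move=> e0 e1 ee p0 q0 q1 tg0 hq.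
have pq0 : 0 <= 3 * q * p by rewrite !mulr_ge0.
rewrite normrM (ger0_norm pq0) -[d ^+ 2]real_normK ?num_real//.
have n0 := normr_ge0 d; move: (`|d|) n0 => n n0.
have h1 : 2 * (q * p * n) <= eps * (p * n ^+ 2) + e * (p * q ^+ 2).
  have : 0 <= e * (p * (eps * n - q) ^+ 2).
    by rewrite mulr_ge0 ?(ltW e1)// mulr_ge0// sqr_ge0.
  have -> : e * (p * (eps * n - q) ^+ 2) = (eps * e) * eps * (p * n ^+ 2)
     - 2 * (eps * e) * (q * p * n) + e * (p * q ^+ 2) by ring.
  by rewrite ee; lra.
have h2 : p * q ^+ 2 <= C0 * tg.
  apply: le_trans hq; rewrite [leRHS]mulrC expr2 mulrA -[leRHS]mulr1.
  by apply: ler_wpM2l => //; rewrite mulr_ge0.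
have h3 : e * (p * q ^+ 2) <= e * (C0 * tg) by apply: ler_wpM2l => //; exact: ltW.
have h4 : eps * (e ^+ 2 * tg) = e * tg.
  by rewrite -[RHS]mul1r -ee; ring.
have h5 : 0 <= eps * (p * n ^+ 2) by rewrite mulr_ge0 ?(ltW e0)// mulr_ge0// sqr_ge0.
have h6 : 0 <= eps * (p * d' ^+ 2) by rewrite mulr_ge0 ?(ltW e0)// mulr_ge0// sqr_ge0.
have h7 : 0 <= e * tg by rewrite mulr_ge0// ltW.
have -> : 3 / 2 * (1 + C0) * eps * (p * (n ^+ 2 + d' ^+ 2) + e ^+ 2 * tg) =
   3 / 2 * (1 + C0) * (eps * (p * n ^+ 2) + eps * (p * d' ^+ 2) + eps * (e ^+ 2 * tg)) by ring.
rewrite h4.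
have -> : 3 * q * p * n = 3 / 2 * (2 * (q * p * n)) by field.
have h8 : e * (C0 * tg) = C0 * (e * tg) by ring.
have := mulr_ge0 (ltW hC0) h5; have := mulr_ge0 (ltW hC0) h6; lra.
Qed.

Definition gradK : R := 3 / 2 * (1 + C0).

Lemma gradK_gt0 : 0 < gradK.
Proof. by rewrite /gradK; apply: mulr_gt0; [lra|rewrite addr_gt0]. Qed.

Lemma cub_gradient eps w x : solves eps w -> regular_set x ->
  `|partial1 (cub \o w) x| <= gradK * eps * laplacian (ltanh2 \o w) x /\
  `|partial2 (cub \o w) x| <= gradK * eps * laplacian (ltanh2 \o w) x.
Proof.
move=> sol Ux; rewrite (laplacian_S sol Ux).
have hw := solves_smooth sol 1; have e0 := solves_eps sol.
rewrite (partial1_comp Ux hw (is_derive_cub (w x))) (partial2_comp Ux hw (is_derive_cub (w x))).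
rewrite -exprVn.
have ei : 0 < eps^-1 by rewrite invr_gt0.
have ee : eps * eps^-1 = 1 by rewrite mulfV// gt_eqF.
have p0 : 0 <= (1 - tanh2 (w x) ^+ 2) / 2 by have := tanh2_sqr (w x); lra.
have q0 := sqr_ge0 (tanh2 (w x)).
have q1 : tanh2 (w x) ^+ 2 <= 1 by exact: ltW (tanh2_sqr _).
have tg0 := Tg_ge0 hC0 hg (w x).
split; last rewrite [partial1 _ _ ^+ 2 + _]addrC; exact: (cub_amgm _ _ e0 ei ee p0 q0 q1 tg0 (hg _)).
Qed.

Lemma bad_set_union (t0 r : R) (sigma : I -> R) : 0 < r -> exists A : set (measurableTypeR R),
  [/\ measurable A, (mu A <= (#|I|%:R * (12 * r))%:E)%E &
  forall t i, t0 <= t <= t0 + 1 -> sin2pi (t - sigma i) < 2 * r ^+ 2 -> A t].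
Proof.
move=> r0; suff H (s : seq I) : exists A : set (measurableTypeR R),
    [/\ measurable A, (mu A <= ((size s)%:R * (12 * r))%:E)%E &
    forall t i, i \in s -> t0 <= t <= t0 + 1 -> sin2pi (t - sigma i) < 2 * r ^+ 2 -> A t].
  have [A [mA muA hA]] := H (enum I); exists A; split => //; first by rewrite cardE.
  by move=> t i; apply: hA; rewrite mem_enum.
elim: s => [|i s [A [mA muA hA]]].
  by exists set0; split => //; rewrite measure0 mul0r.
have [B [mB muB hB]] := bad_set_bound t0 (sigma i) r0.
exists (B `|` A); split; first exact: measurableU.
  apply: (le_trans (measureU2 _ mB mA)); rewrite /= -natr1 mulrDl mul1r [X in X%:E]addrC EFinD.
  exact: (leeD muB muA).
move=> t j; rewrite inE => /orP[/eqP ->|js] ht h; first by left; exact: hB.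
by right; exact: hA h.
Qed.

Let dirK : R := `|a.1| + `|a.2| + (`|b.1| + `|b.2|) + 1.

Let dirK0 : 0 < dirK. Proof. by rewrite ltr_wpDl// !addr_ge0. Qed.

Lemma frac_int (s : R) : exists k : int, 0 <= s - k%:~R <= 1.
Proof.
exists (Num.floor s); have /andP[h1 h2] := floor_itv s; rewrite intrD mulr1z in h2.
by apply/andP; split; lra.
Qed.

Lemma pt_shift_s s t (k : int) : pt (s - k%:~R, t) = pt (s, t) + lat (- k) 0.
Proof. by rewrite lat_pt -pt_D; congr pt; apply: pairE; rewrite /= ?mulrNz ?addr0. Qed.

Lemma pt_shift_t s t (k : int) : pt (s, t - k%:~R) = pt (s, t) + lat 0 (- k).
Proof. by rewrite lat_pt -pt_D; congr pt; apply: pairE; rewrite /= ?mulrNz ?addr0. Qed.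

(** Lines are sought in the middle half of an interval of length l. The radius r is chosen last, so
    small that the lines meeting a bump fill at most l / 4. If [cub \o w] oscillated by more than
    delta on all the others, the integral of its gradient would be at least delta l / 4, more than
    the K eps E0 that the energy allows; hence C1 = 4 K E0. *)
Lemma good_lines : exists2 C1 : R, 0 < C1 & forall eps w, solves eps w ->
  forall delta l, 0 < l <= 1 -> C1 * eps < l * delta ->
  (forall t0, exists t, [/\ t0 < t < t0 + l, forall s, regular_set (pt (s, t)) &
     forall s s', `|cub (w (pt (s, t))) - cub (w (pt (s', t)))| <= delta]) /\
  (forall s0, exists s, [/\ s0 < s < s0 + l, forall t, regular_set (pt (s, t)) &
     forall t t', `|cub (w (pt (s, t))) - cub (w (pt (s, t')))| <= delta]).
Proof.
have [E0 E00 hE] := energy_bound hab c hP g.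
pose K := dirK * gradK; have K0 : 0 < K by rewrite mulr_gt0 ?gradK_gt0.
have KE : 0 < 4 * K * E0 by apply: mulr_gt0 => //; apply: mulr_gt0.
exists (4 * K * E0) => // eps w sol delta l /andP[l0 l1] hl.
have e0 := solves_eps sol.
have d0 : 0 < delta.
  have : 0 < l * delta by apply: lt_trans hl; exact: mulr_gt0.
  by rewrite pmulr_rgt0.
(* The added 1 keeps [N] positive when there are no singular points. *)
pose N : R := #|I|%:R + 1; have N0 : 0 < N by rewrite ltr_wpDl.
pose S := ltanh2 \o w.
have oU := @open_regular_set R a b I P.
have [r [sr hEr rl]] : exists r, [/\ small_radius r, (forall s0 t0,
    Icell a b s0 t0 (fun x => cutout r x * laplacian S x) <= E0) & N * (12 * r) <= l / 4].
  have m0 : 0 < l / (48 * N) by rewrite divr_gt0// mulr_gt0.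
  have : \forall r \near 0^'+, [/\ small_radius r, (forall s0 t0,
    Icell a b s0 t0 (fun x => cutout r x * laplacian S x) <= E0) & N * (12 * r) <= l / 4].
    near=> r.
    have [h1 h2] : small_radius r /\ forall s0 t0,
      Icell a b s0 t0 (fun x => cutout r x * laplacian S x) <= E0.
      by near: r; exact: hE sol.
    split => //.
    have : r <= l / (48 * N) by near: r; exact: nbhs_right_le.
    by rewrite ler_pdivlMr ?mulr_gt0//; lra.
  by move=> h; have [r hr] := @filter_ex _ _ (at_right_proper_filter (0 : R)) _ h; exists r.
have r0 := sr.1.
pose f x := K * eps * (cutout r x * laplacian S x).
have cL : continuous (fun x => cutout r x * laplacian S x).
  apply: (@continuous_vanishing R a b I P r _ r0) => x.
    move=> Ux; apply: continuous_mul.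
      exact: (Ck_continuous (Ck_cutout a b P 0 r) (Logic.I : setT x)).
    exact: (Ck_continuous (Ck_laplacian oU (Ck_ltanh2 oU (solves_smooth sol 2))) Ux).
  by move=> [i /ltW hi]; rewrite (cutout_near sr hi) mul0r.
have cf : continuous f by move=> x; apply: continuous_scale; exact: cL.
have cfp z : {for z, continuous (fun z => f (pt z))}.
  exact: (@comp_pt_continuous R a b f z (cf (pt z))).
have cLp z : {for z, continuous (fun z => cutout r (pt z) * laplacian S (pt z))}.
  exact: (@comp_pt_continuous R a b (fun x => cutout r x * laplacian S x) z (cL (pt z))).
have Ke0 : 0 <= K * eps by rewrite mulr_ge0 ?ltW.
have f0 x : 0 <= f x.
  rewrite /f; apply: mulr_ge0 => //.
  have [Ux|[i /ltW hi]] := @regular_or_near R a b I P r x r0.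
    apply: mulr_ge0; first by have /andP[] := cutout_01 x sr.
    exact: (laplacian_S_ge0 hC0 hg sol Ux).
  by rewrite (cutout_near sr hi) mul0r.
have If s0 t0 : Icell a b s0 t0 f <= K * eps * E0.
  have -> : Icell a b s0 t0 f = K * eps * Icell a b s0 t0 (fun x => cutout r x * laplacian S x).
    exact: (Rintegral_rectZ (fun z _ => cLp z)).
  by apply: ler_wpM2l.
(* One coordinate away from the bad values is enough: the point then misses the support of every
   bump, so it is regular and [f] dominates the gradient there. *)
have off x : (forall i, 2 * r ^+ 2 <= sin2pi (cs (x - P i)) \/ 2 * r ^+ 2 <= sin2pi (ct (x - P i))) ->
    regular_set x /\ cutout r x = 1.
  move=> h; split => [i|]; last first.
    rewrite /cutout big1 ?subr0// => i _.
    by have [] := @bump_far R a b r (P i) x r0 (h i).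
  have r20 : 0 < r ^+ 2 by rewrite exprn_gt0.
  rewrite gt_eqF// /kap; have := sin2pi_ge0 (cs (x - P i)); have := sin2pi_ge0 (ct (x - P i)).
  by case: (h i) => ? ? ?; lra.
have grad x : regular_set x -> cutout r x = 1 ->
    `|a.1 * partial1 (cub \o w) x + a.2 * partial2 (cub \o w) x| <= f x /\
    `|b.1 * partial1 (cub \o w) x + b.2 * partial2 (cub \o w) x| <= f x.
  move=> Ux h1; have [g1 g2] := cub_gradient sol Ux; rewrite /f h1 mul1r -/S in g1 g2 *.
  move: (partial1 _ _) (partial2 _ _) (laplacian S x) (laplacian_S_ge0 hC0 hg sol Ux) g1 g2.
  move=> p1 p2 D D0 g1 g2; have G0 : 0 <= gradK * eps * D.
    by apply: mulr_ge0 => //; apply: mulr_ge0; apply: ltW => //; exact: gradK_gt0.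
  have H (u v : R) : `|u| + `|v| <= dirK -> `|u * p1 + v * p2| <= K * eps * D.
    move=> huv; apply: (le_trans (ler_normD _ _)); rewrite !normrM.
    have := ler_wpM2l (normr_ge0 u) g1; have := ler_wpM2l (normr_ge0 v) g2.
    have := ler_wpM2r G0 huv; rewrite /K -!mulrA in G0 *.
    by move: (gradK * (eps * D)) => G; lra.
  have := normr_ge0 a.1; have := normr_ge0 a.2; have := normr_ge0 b.1; have := normr_ge0 b.2.
  by move=> *; split; apply: H; rewrite /dirK; lra.
have hC : Ck_on 1 regular_set (cub \o w) := Ck_cub oU (solves_smooth sol 1).
have cp1 z : regular_set (pt z) -> {for z, continuous (fun z => partial1 (cub \o w) (pt z))}.
  by move=> Uz; exact: (@comp_pt_continuous R a b _ z (Ck_continuous (Ck_partial1 hC) Uz)).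
have cp2 z : regular_set (pt z) -> {for z, continuous (fun z => partial2 (cub \o w) (pt z))}.
  by move=> Uz; exact: (@comp_pt_continuous R a b _ z (Ck_continuous (Ck_partial2 hC) Uz)).
have pc1 (s t : R) : {for s, continuous (fun s : R => (s, t))}.
  apply: (@cvg_pair _ _ _ (nbhs s) (nbhs s) (nbhs t) _ _ _ id (fun=> t)).
    exact: cvg_id.
  exact: cvg_cst.
have pc2 (s t : R) : {for t, continuous (fun t : R => (s, t))}.
  apply: (@cvg_pair _ _ _ (nbhs t) (nbhs s) (nbhs t) _ _ _ (fun=> s) id).
    exact: cvg_cst.
  exact: cvg_id.
have l4 : 0 < l / 4 by rewrite divr_gt0.
have key A : delta * (l / 2 - #|I|%:R * (12 * r)) <= A -> A <= K * eps * E0 -> False.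
  move=> h1 h2; have : delta * (l / 4) <= delta * (l / 2 - #|I|%:R * (12 * r)).
    rewrite ler_pM2l//; have : 0 <= 12 * r by rewrite mulr_ge0// ltW.
    by move: rl; rewrite /N mulrDl mul1r => *; lra.
  by move=> h3; have := le_trans h3 (le_trans h1 h2); lra.
split=> [t0|s0].
- apply: contrapT => hno.
  have [B [mB muB hB]] := bad_set_union t0 (fun i => ct (P i)) r0.
  apply: (key (Icell a b 0 t0 f)); last exact: If.
  have -> : l / 2 = (t0 + l * 3 / 4) - (t0 + l / 4) by field.
  have [q1 q2 q3] := quarters l0 l1 t0.
  apply: (@slice_chebyshev2 R 0 (0 + 1) t0 (t0 + 1) (fun z => f (pt z)) (fun z _ => cfp z)
    (t0 + l / 4) (t0 + l * 3 / 4) delta (#|I|%:R * (12 * r)) B (ltW d0) (fun z _ => f0 (pt z)) mB muB q1 q2 q3).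
  move=> t /andP[t1 t2] nB; have [m1 m2] := middle_half l0 l1 t1 t2.
  have ht i : 2 * r ^+ 2 <= sin2pi (t - ct (P i)).
    rewrite leNgt; apply/negP => h; apply: nB; exact: (hB t i m1 h).
  have ln s : regular_set (pt (s, t)) /\ cutout r (pt (s, t)) = 1.
    by apply: off => i; right; rewrite ctB (ct_pt hab).
  have [s [s' hss]] : exists s s', delta < `|cub (w (pt (s, t))) - cub (w (pt (s', t)))|.
    apply: contrapT => h; apply: hno; exists t; split.
    + exact: m2.
    + by move=> s; exact: (ln s).1.
    + move=> s s'; rewrite leNgt; apply/negP => h'; apply: h; by exists s, s'.
  apply/ltW; apply: (lt_le_trans hss).
  (* The two points of the infinite line are brought separately into one period, where the integral
     over a unit segment bounds the oscillation. *)
  have [k hk] := frac_int s; have [k' hk'] := frac_int s'.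
  have -> : w (pt (s, t)) = w (pt (s - k%:~R, t)) by rewrite pt_shift_s (solves_periodic sol).
  have -> : w (pt (s', t)) = w (pt (s' - k'%:~R, t)) by rewrite pt_shift_s (solves_periodic sol).
  rewrite add0r.
  apply: (@osc_le_int R (fun s => cub (w (pt (s, t)))) (fun s => a.1 * partial1 (cub \o w) (pt (s, t))
     + a.2 * partial2 (cub \o w) (pt (s, t))) (fun s => f (pt (s, t))) 0 1 ltr01 _ _ _ _ _ _ hk hk').
  + by move=> u _; exact: (@line_s_derive R a b regular_set _ (u, t) oU hC (ln u).1).
  + move=> u _.
    apply: (@continuous_comp _ _ _ (fun s => (s, t)) (fun z => a.1 * partial1 (cub \o w) (pt z)
      + a.2 * partial2 (cub \o w) (pt z))); first exact: pc1.
    by apply: continuous_add; apply: continuous_scale; [exact: (cp1 _ (ln u).1)|exact: (cp2 _ (ln u).1)].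
  + move=> u _.
    by apply: (@continuous_comp _ _ _ (fun s => (s, t)) (fun z => f (pt z))); [exact: pc1|exact: cfp].
  + by move=> u _; exact: (grad _ (ln u).1 (ln u).2).1.
- apply: contrapT => hno.
  have [B [mB muB hB]] := bad_set_union s0 (fun i => cs (P i)) r0.
  apply: (key (Icell a b s0 0 f)); last exact: If.
  have -> : l / 2 = (s0 + l * 3 / 4) - (s0 + l / 4) by field.
  have [q1 q2 q3] := quarters l0 l1 s0.
  apply: (@slice_chebyshev1 R s0 (s0 + 1) 0 (0 + 1) (fun z => f (pt z)) (fun z _ => cfp z)
    (s0 + l / 4) (s0 + l * 3 / 4) delta (#|I|%:R * (12 * r)) B (ltW d0) (fun z _ => f0 (pt z)) mB muB q1 q2 q3).
  move=> s /andP[s1 s2] nB; have [m1 m2] := middle_half l0 l1 s1 s2.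
  have hs i : 2 * r ^+ 2 <= sin2pi (s - cs (P i)).
    rewrite leNgt; apply/negP => h; apply: nB; exact: (hB s i m1 h).
  have ln t : regular_set (pt (s, t)) /\ cutout r (pt (s, t)) = 1.
    by apply: off => i; left; rewrite csB (cs_pt hab).
  have [t [t' htt]] : exists t t', delta < `|cub (w (pt (s, t))) - cub (w (pt (s, t')))|.
    apply: contrapT => h; apply: hno; exists s; split.
    + exact: m2.
    + by move=> t; exact: (ln t).1.
    + move=> t t'; rewrite leNgt; apply/negP => h'; apply: h; by exists t, t'.
  apply/ltW; apply: (lt_le_trans htt).
  have [k hk] := frac_int t; have [k' hk'] := frac_int t'.
  have -> : w (pt (s, t)) = w (pt (s, t - k%:~R)) by rewrite pt_shift_t (solves_periodic sol).
  have -> : w (pt (s, t')) = w (pt (s, t' - k'%:~R)) by rewrite pt_shift_t (solves_periodic sol).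
  rewrite add0r.
  apply: (@osc_le_int R (fun t => cub (w (pt (s, t)))) (fun t => b.1 * partial1 (cub \o w) (pt (s, t))
     + b.2 * partial2 (cub \o w) (pt (s, t))) (fun t => f (pt (s, t))) 0 1 ltr01 _ _ _ _ _ _ hk hk').
  + by move=> u _; exact: (@line_t_derive R a b regular_set _ (s, u) oU hC (ln u).1).
  + move=> u _.
    apply: (@continuous_comp _ _ _ (fun t => (s, t)) (fun z => b.1 * partial1 (cub \o w) (pt z)
      + b.2 * partial2 (cub \o w) (pt z))); first exact: pc2.
    by apply: continuous_add; apply: continuous_scale; [exact: (cp1 _ (ln u).1)|exact: (cp2 _ (ln u).1)].
  + move=> u _.
    by apply: (@continuous_comp _ _ _ (fun t => (s, t)) (fun z => f (pt z))); [exact: pc2|exact: cfp].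
  + by move=> u _; exact: (grad _ (ln u).1 (ln u).2).2.
Unshelve. all: end_near. Qed.

End good_lines.

(** * Grid values and comparison on boxes *)

Section trichotomy.
Context {R : realType}.
Variables (a b : R * R).
Hypothesis hab : lin_indep2 a b.
Notation cs := (cs a b).
Notation ct := (ct a b).
Notation pt := (pt a b).
Notation lat := (lat a b).
Notation kap := (kap a b).
Notation periodic2 := (periodic2 a b).

Variables (I : finType) (P : I -> R * R).
Hypothesis hP : forall i j, i != j -> kap (P i - P j) != 0.
Notation regular_set := (regular_set a b P).
Notation solves := (solves a b P).

(** The class of problems is closed under w -> - w, which exchanges the two kinds of singularities
    and turns upper bounds into lower ones. *)
Lemma solvesN (c : I -> R) (g : R -> R) eps w : solves c g eps w ->
  solves (fun i => - c i) (fun t => - g (- t)) eps (fun x => - w x).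
Proof.
move=> sol; have oU := @open_regular_set R a b I P; split.
- exact: solves_eps sol.
- by move=> x m n; rewrite (solves_periodic sol).
- by move=> k; exact: (Ck_opp oU (solves_smooth sol k)).
- move=> x Ux; rewrite (laplacianN oU Ux (solves_smooth sol 2)).
  by rewrite (solves_eqn sol Ux) opprK mulrN.
- move=> i; have [l hl] := solves_sing sol i; exists (- l).
  apply: cvg_trans (cvgN hl); apply: near_eq_cvg; near=> x.
  by rewrite /= opprB mulNr opprK addrC.
Unshelve. all: end_near. Qed.

(* The first condition drives the energy estimate; the other two make exponentials
   of rate [kappa / eps] barriers for [laplacian w = eps ^- 2 * g w]. *)
Definition tame (g : R -> R) (C0 kappa : R) : Prop :=
  [/\ forall t, tanh2 t ^+ 2 * ((1 - tanh2 t ^+ 2) / 2) <= C0 * (tanh2 t * g t),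
    forall t, t <= 0 -> kappa ^+ 2 * t <= g t & forall t, 0 <= t -> g t <= kappa ^+ 2 * t].

Lemma tameN g C0 kappa : tame g C0 kappa -> tame (fun t => - g (- t)) C0 kappa.
Proof.
move=> [h1 h2 h3]; split=> t.
- by have := h1 (- t); rewrite tanh2N sqrrN mulrN mulNr.
- by move=> t0; have := h3 (- t); rewrite oppr_ge0 => /(_ t0); rewrite mulrN lerNr.
- by move=> t0; have := h2 (- t); rewrite oppr_le0 => /(_ t0); rewrite mulrN lerNl.
Qed.

Lemma cub_lt (s t : R) : s < t -> cub s < cub t.
Proof.
move=> /tanh2_ltP; rewrite /cub; move: (tanh2 s) (tanh2 t) => u v uv.
have := sqr_ge0 (u + v); have := sqr_ge0 u; have := sqr_ge0 v.
rewrite -subr_gt0 => h1 h2 h3.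
have -> : v ^+ 3 - u ^+ 3 = (v - u) * (u ^+ 2 + u * v + v ^+ 2) by ring.
apply: mulr_gt0; first by rewrite subr_gt0.
have h4 : 0 < (v - u) ^+ 2 by rewrite exprn_gt0// subr_gt0.
have := sqr_ge0 (v + u) => h5; nra.
Qed.

Lemma cub_le_inv (s t : R) : cub s <= cub t -> s <= t.
Proof. by move=> h; rewrite leNgt; apply/negP => /cub_lt; rewrite ltNge h. Qed.

Lemma cubN (t : R) : cub (- t) = - cub t.
Proof. by rewrite /cub tanh2N; ring. Qed.

Lemma cub_gt0 (t : R) : 0 < t -> 0 < cub t.
Proof. by move=> /cub_lt; rewrite /cub tanh20 expr0n. Qed.

Lemma cub_1 (t : R) : `|cub t| <= 1.
Proof.
have /andP[h1 h2] := tanh2_lt1 t; rewrite /cub normrX -[leRHS](expr1n _ 3).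
by rewrite lerXn2r ?nnegrE// ler_norml !ltW.
Qed.

(** For t > 0 the left side of the first condition is positive, and so is [tanh2 t]. *)
Lemma tame_gt0 g C0 kappa t : 0 < C0 -> tame g C0 kappa -> 0 < t -> 0 < g t.
Proof.
move=> C00 [h _ _] t0; have := h t; have T0 : 0 < tanh2 t by rewrite -tanh20 tanh2_ltP.
have h1 : 0 < tanh2 t ^+ 2 * ((1 - tanh2 t ^+ 2) / 2).
  by rewrite mulr_gt0 ?exprn_gt0// divr_gt0// subr_gt0 tanh2_sqr.
by move=> /(lt_le_trans h1); rewrite (pmulr_rgt0 _ C00) (pmulr_rgt0 _ T0).
Qed.

(* [cub \o w] replaces [w] because it is bounded and its gradient is O(eps) in L^1. *)
Definition grid_value (C1 : R) (eps : R) (w : R * R -> R) (k : R) : Prop :=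
  `|k| <= 1 /\ forall delta l, 0 < l <= 1 -> C1 * eps < l * delta -> forall x,
  exists s1 s2 t1 t2, [/\ cs x - l < s1 < cs x, cs x < s2 < cs x + l,
    ct x - l < t1 < ct x, ct x < t2 < ct x + l &
    forall y, [\/ cs y = s1, cs y = s2, ct y = t1 | ct y = t2] ->
    regular_set y /\ `|cub (w y) - k| <= delta + 2 * C1 * eps].

Lemma grid_valueN C1 eps w k : grid_value C1 eps w k -> grid_value C1 eps (fun x => - w x) (- k).
Proof.
move=> [k1 h]; split; first by rewrite normrN.
move=> delta l hl hd x; have [s1 [s2 [t1 [t2 [h1 h2 h3 h4 h5]]]]] := h delta l hl hd x.
exists s1, s2, t1, t2; split => // y /h5[Uy hy]; split => //.
by rewrite cubN -opprD normrN.
Qed.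

(** k is the value at the crossing of two reference lines, one in each direction. Good lines are
    complete lines of the plane, so each line of the grid meets the reference line of the other
    direction, and the two oscillations add up to delta + 2 C1 eps. *)
Lemma grid_value_exists (c : I -> R) g C0 kappa : 0 < C0 -> tame g C0 kappa ->
  exists2 C1 : R, 0 < C1 & forall eps w, solves c g eps w -> exists k, grid_value C1 eps w k.
Proof.
move=> C00 [hg _ _]; have [C1 C10 H] := good_lines hab c hP C00 hg.
exists C1 => // eps w sol; have e0 := solves_eps sol; have hl := H eps w sol.
have Ce : 0 < C1 * eps by rewrite mulr_gt0.
have l01 : 0 < (1 : R) <= 1 by rewrite ltr01 lexx.
(* The reference lines use l = 1, where any delta above C1 eps is admissible; twice that value is
   taken. *)
have lt2 : C1 * eps < 1 * (2 * C1 * eps) by lra.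
have [/(_ 0)[ts [_ Ut ht]] /(_ 0)[ss [_ Us hs]]] := hl _ _ l01 lt2.
exists (cub (w (pt (ss, ts)))); split; first exact: cub_1.
move=> delta l hl1 hd x; have [hT hS] := hl _ _ hl1 hd.
have [t1 [/andP[t1a t1b] Ut1 ht1]] := hT (ct x - l); have [t2 [t2a Ut2 ht2]] := hT (ct x).
have [s1 [/andP[s1a s1b] Us1 hs1]] := hS (cs x - l); have [s2 [s2a Us2 hs2]] := hS (cs x).
rewrite subrK in t1b; rewrite subrK in s1b.
exists s1, s2, t1, t2; split; rewrite ?s1a ?t1a// => y.
have yE : y = pt (cs y, ct y) by rewrite (pt_cst hab).
have tri (p q r : R) : `|p - q| <= delta -> `|q - r| <= 2 * C1 * eps ->
    `|p - r| <= delta + 2 * C1 * eps.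
  by move=> h1 h2; rewrite -(subrK q p) -addrA (le_trans (ler_normD _ _))// lerD.
case=> E; rewrite yE E; split => //.
- exact: tri (hs1 (ct y) ts) (ht s1 ss).
- exact: tri (hs2 (ct y) ts) (ht s2 ss).
- exact: tri (ht1 (cs y) ss) (hs t1 ts).
- exact: tri (ht2 (cs y) ss) (hs t2 ts).
Qed.

Definition box (s1 s2 t1 t2 : R) : set (R * R) := pt @` rect s1 s2 t1 t2.

Lemma boxP s1 s2 t1 t2 y : box s1 s2 t1 t2 y <-> s1 <= cs y <= s2 /\ t1 <= ct y <= t2.
Proof.
split=> [[z [/=]]|[h1 h2]].
  by rewrite !in_itv /= => h1 h2 <-; rewrite (cs_pt hab) (ct_pt hab).
by exists (cs y, ct y); [split; rewrite /= in_itv|exact: pt_cst].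
Qed.

Lemma compact_box s1 s2 t1 t2 : compact (box s1 s2 t1 t2).
Proof.
apply: continuous_compact; last exact: compact_rect.
by apply: continuous_in_subspaceT => z _; exact: pt_continuous.
Qed.

Lemma interior_box s1 s2 t1 t2 y : s1 < cs y < s2 -> t1 < ct y < t2 ->
  interior (box s1 s2 t1 t2) y.
Proof.
move=> /andP[h1 h2] /andP[h3 h4].
have c1 := @cs_continuous R a b y; have c2 := @ct_continuous R a b y.
have n1 : \forall x \near y, s1 < cs x by move/cvgr_gt: c1; apply.
have n2 : \forall x \near y, cs x < s2 by move/cvgr_lt: c1; apply.
have n3 : \forall x \near y, t1 < ct x by move/cvgr_gt: c2; apply.
have n4 : \forall x \near y, ct x < t2 by move/cvgr_lt: c2; apply.
rewrite /interior; near=> x; apply/boxP; split; apply/andP; split; apply: ltW; near: x.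
- exact: n1.
- exact: n2.
- exact: n3.
- exact: n4.
Unshelve. all: end_near. Qed.

(** Between two points of a box with coordinates within l of its centre, [kap] is at most 8 pi^2
    l^2. If they were translates of two different [P i], two uses of the quasi-triangle inequality
    would multiply this by 4, whence 32. The bound 1 / 4 on [l0] excludes two translates of the same
    [P i]. *)
Lemma small_box : exists2 l0 : R, 0 < l0 < 4^-1 &
  forall i j, i != j -> 32 * pi ^+ 2 * l0 ^+ 2 < kap (P i - P j).
Proof.
have [d d0 hd] := separation hP.
have p0 : 0 < 32 * pi ^+ 2 :> R by rewrite mulr_gt0// exprn_gt0// pi_gt0.
pose l0 := Num.min 5^-1 (d / (2 * (32 * pi ^+ 2))).
have l00 : 0 < l0 by rewrite lt_min invr_gt0 ltr0n/= divr_gt0// mulr_gt0.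
have l05 : l0 <= 5^-1 by rewrite ge_min lexx.
exists l0; first by rewrite l00/=; lra.
move=> i j ij; apply: lt_le_trans (hd _ _ ij).
have : l0 <= d / (2 * (32 * pi ^+ 2)) by rewrite ge_min lexx orbT.
have p02 : 0 < 2 * (32 * pi ^+ 2) :> R by rewrite mulr_gt0.
rewrite (ler_pdivlMr _ _ p02) => h.
have h2 : l0 ^+ 2 <= l0 by rewrite expr2 ler_piMl// ?ltW//; lra.
have := ler_wpM2l (ltW p0) h2; move: (32 * pi ^+ 2) p0 h => q *; nra.
Qed.

(** The maximum principle for [w - zeta] on a box around x. The box holds at most one singular
    point, as [punctured_maximum] requires; [hneg] keeps out of it those where w tends to +oo, and
    near the others w is bounded above. *)
Lemma box_comparison (c : I -> R) g eps w (zeta : R * R -> R) (x : R * R) (l s1 s2 t1 t2 : R) :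
  solves c g eps w -> Ck_on 2 setT zeta -> 0 < l < 4^-1 ->
  (forall i j, i != j -> 32 * pi ^+ 2 * l ^+ 2 < kap (P i - P j)) ->
  (forall i, c i < 0 -> 4 * pi ^+ 2 * l ^+ 2 < kap (x - P i)) ->
  cs x - l < s1 < cs x -> cs x < s2 < cs x + l ->
  ct x - l < t1 < ct x -> ct x < t2 < ct x + l ->
  (forall y, [\/ cs y = s1, cs y = s2, ct y = t1 | ct y = t2] ->
     s1 <= cs y <= s2 -> t1 <= ct y <= t2 -> w y <= zeta y) ->
  (forall y, regular_set y -> zeta y < w y -> laplacian zeta y < eps ^- 2 * g (w y)) ->
  regular_set x -> w x <= zeta x.
Proof.
move=> sol hz /andP[l0 l4] hsep hneg /andP[s1a s1b] /andP[s2a s2b] /andP[t1a t1b] /andP[t2a t2b] hbd hint Ux.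
have oU := @open_regular_set R a b I P; have sw := solves_smooth sol.
pose K := box s1 s2 t1 t2.
have pi2 : 0 < (pi : R) ^+ 2 by rewrite exprn_gt0// pi_gt0.
have sq (u v : R) : `|u| <= v -> u ^+ 2 <= v ^+ 2.
  by move=> h; rewrite -[u ^+ 2]real_normK ?num_real// lerXn2r ?nnegrE// (le_trans _ h).
have Kx y : K y -> kap (x - y) <= 2 * pi ^+ 2 * l ^+ 2.
  move=> /boxP[/andP[h1 h2] /andP[h3 h4]]; apply: (le_trans (kap_le a b (x - y))).
  rewrite csB ctB [2 * _]mulrC -[leRHS]mulrA (ler_pM2l pi2).
  have q1 : (cs x - cs y) ^+ 2 <= l ^+ 2 by apply: sq; rewrite ler_norml; apply/andP; split; lra.
  have q2 : (ct x - ct y) ^+ 2 <= l ^+ 2 by apply: sq; rewrite ler_norml; apply/andP; split; lra.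
  lra.
have kapC y y' : kap (y - y') = kap (y' - y) by rewrite -[LHS]kapN opprB.
have sing y : ~ regular_set y -> exists i, kap (y - P i) = 0.
  move=> h; apply: contrapT => hn; apply: h => i; apply/eqP => h; apply: hn; by exists i.
have uniq y y' : K y -> K y' -> ~ regular_set y -> ~ regular_set y' -> y = y'.
  move=> Ky Ky' /sing[i hi] /sing[j hj].
  have kyy : kap (y - y') <= 8 * pi ^+ 2 * l ^+ 2.
    have := kap_le_dist a b y y' x; rewrite [kap (y - x)]kapC [kap (y' - x)]kapC.
    by have := Kx _ Ky; have := Kx _ Ky'; lra.
  have [ij|ij] := eqVneq i j; last first.
    exfalso; have := hsep _ _ ij.
    have := kap_le_dist a b (P i) (P j) y; rewrite [kap (P i - y)]kapC hi.
    have := kap_le_dist a b (P j) y y'; rewrite [kap (P j - y')]kapC hj.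
    move=> h1 h2 h3; lra.
  have k0 : kap (y - y') = 0.
    apply/eqP; rewrite eq_le kap_ge0 andbT.
    have := kap_le_dist a b y y' (P i); rewrite hi ij hj; lra.
  have [m [n mn]] := kap_eq0 hab k0.
  have e1 : cs y - cs y' = m%:~R by rewrite -csB mn (cs_lat hab).
  have e2 : ct y - ct y' = n%:~R by rewrite -ctB mn (ct_lat hab).
  move: Ky Ky' => /boxP[/andP[h1 h2] /andP[h3 h4]] /boxP[/andP[h5 h6] /andP[h7 h8]].
  have int0 (j' : int) : -1 < (j'%:~R : R) < 1 -> j' = 0.
    have -> : -1 = (-1)%:~R :> R by rewrite mulrNz.
    by rewrite ltr_int -[X in _ && (_ < X)]/(1%:~R) ltr_int; clear => /andP[? ?]; lia.
  have m0 : m = 0 by apply: int0; rewrite -e1; apply/andP; split; lra.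
  have n0 : n = 0 by apply: int0; rewrite -e2; apply/andP; split; lra.
  by apply/eqP; rewrite -subr_eq0 mn m0 n0 lat00.
pose z y := w y - zeta y.
have hzU : Ck_on 2 regular_set z.
  by apply: (Ck_sub oU (sw 2)); apply: Ck_subset hz.
(* The puncture is the singular point of the box if there is one, and otherwise some point different
   from x. *)
have [P0 [xP0 KP0 hP0]] : exists P0, [/\ x != P0, forall y, K y -> y != P0 -> regular_set y &
    K P0 -> exists M, \forall y \near P0^', w y <= M].
  have [[P0 [KP0 sP0]]|hno] := pselect (exists P0, K P0 /\ ~ regular_set P0).
    exists P0; split.
    - by apply/eqP => xP; apply: sP0; rewrite -xP.
    - move=> y Ky yP; apply: contrapT => sy; move/eqP: yP; apply.
      exact: uniq.
    - move=> _; have [i hi] := sing _ sP0.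
      have [m [n mn]] := kap_eq0 hab hi.
      have ci : 0 <= c i.
        rewrite leNgt; apply/negP => ci; have := hneg i ci.
        have := kap_le_dist a b x (P i) P0; rewrite [kap (P i - P0)]kapC hi.
        by have := Kx _ KP0; lra.
      have [lim hlim] := solves_sing sol i; exists (lim + 1).
      have : \forall y \near (P i)^', `|w y - c i * ln (sqnorm (y - P i)) - lim| <= 1.
        by move/cvgrPdist_le: hlim => /(_ 1 ltr01); apply: filterS => y; rewrite distrC.
      move=> /nbhs_ballP[d /= d0 hd].
      (* Within 1 / 2 in each coordinate |y - P0|^2 <= 1, so the logarithm is nonpositive and, as
         [c i >= 0], w is at most lim + 1. *)
      apply/nbhs_ballP; exists (Num.min d 2^-1) => /=; first by rewrite lt_min; apply/andP; split; [exact: d0|rewrite invr_gt0 ltr0n].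
      move=> y [/= hy1 hy2] yP0.
      have yE : y - lat m n - P i = y - P0.
        by rewrite -mn opprB -addrA [P i - P0 - _]addrAC subrr add0r.
      have PE : P i - (y - lat m n) = P0 - y.
        by rewrite -[LHS]opprB yE opprB.
      move: hy1 hy2; rewrite /ball /= !lt_min => /andP[u1 u2] /andP[v1 v2].
      have hw : `|w (y - lat m n) - c i * ln (sqnorm (y - lat m n - P i)) - lim| <= 1.
        apply: hd.
          split; rewrite /ball /=.
            by rewrite -[_ - _]/((P i - (y - lat m n)).1) PE.
          by rewrite -[_ - _]/((P i - (y - lat m n)).2) PE.
        by rewrite /= -subr_eq0 yE subr_eq0.
      have wE : w (y - lat m n) = w y by rewrite -(solves_periodic sol _ m n) subrK.
      rewrite wE yE in hw.
      have q0 : 0 < sqnorm (y - P0) by rewrite sqnorm_gt0 ?subr_eq0.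
      have q1 : sqnorm (y - P0) <= 1.
        rewrite /sqnorm /= -[(y.1 - _) ^+ 2]real_normK ?num_real// -[(y.2 - _) ^+ 2]real_normK ?num_real//.
        rewrite [`|y.1 - _|]distrC [`|y.2 - _|]distrC.
        by have := normr_ge0 (P0.1 - y.1); have := normr_ge0 (P0.2 - y.2); nra.
      have : c i * ln (sqnorm (y - P0)) <= 0.
        by rewrite mulr_ge0_le0// -[leRHS](@ln1 R) ler_ln ?posrE.
      by move: hw; rewrite ler_norml => /andP[_]; lra.
  exists (x + (1, 0)); split.
  - by rewrite eq_sym -subr_eq0 addrAC subrr add0r xpair_eqE oner_eq0.
  - by move=> y Ky _; apply: contrapT => sy; apply: hno; exists y.
  - move=> KP; have UP : regular_set (x + (1, 0)).
      by apply: contrapT => sy; apply: hno; exists (x + (1, 0)).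
    exists (w (x + (1, 0)) + 1).
    have := Ck_continuous (sw 0) UP => /cvgr_le /(_ (w (x + (1, 0)) + 1)).
    by move=> H; apply: cvg_within; apply: H; rewrite ltrDl.
have Kxx : K x by apply/boxP; split; apply/andP; split; exact: ltW.
have H := @punctured_maximum R K regular_set P0 z (@compact_box s1 s2 t1 t2) oU KP0 hzU.
suff : z x <= 0 by rewrite /z subr_le0.
apply: H => //.
- move=> y Ky yP0 zy; have Uy := KP0 _ Ky yP0.
  have zw : zeta y < w y by rewrite -subr_gt0.
  split.
    move: (Ky) => /boxP[/andP[h1 h2] /andP[h3 h4]].
    have hb : [\/ cs y = s1, cs y = s2, ct y = t1 | ct y = t2] -> False.
      move=> hy; have := hbd y hy; rewrite h1 h2 h3 h4 => /(_ isT isT).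
      by rewrite leNgt zw.
    apply: interior_box; apply/andP; split; rewrite lt_neqAle ?h1 ?h2 ?h3 ?h4 andbT;
      apply/eqP => E; apply: hb.
    + by constructor 1.
    + by constructor 2.
    + by constructor 3.
    + by constructor 4.
  have hzU' : Ck_on 2 regular_set zeta by apply: Ck_subset hz.
  rewrite (laplacianD oU Uy (sw 2) (Ck_opp oU hzU')) (laplacianN oU Uy hzU').
  by rewrite (solves_eqn sol Uy) subr_gt0; exact: hint.
- move=> KP; have [M hM] := hP0 KP.
  have cz : {for P0, continuous zeta} := Ck_continuous hz (Logic.I : setT P0).
  exists (M - (zeta P0 - 1)).
  have hzn : \forall y \near P0^', zeta P0 - 1 <= zeta y.
    by apply: cvg_within; move/cvgr_ge: cz; apply; rewrite ltrBlDr ltrDl.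
  apply: filterS2 hM hzn => y h1 h2.
  by rewrite /z; lra.
Qed.

End trichotomy.

Section supersolution.
Context {R : realType}.

Lemma Ck_expR k U (f : R * R -> R) : open U -> Ck_on k U f -> Ck_on k U (expR \o f).
Proof.
move=> oU; have d x (Ux : U x) : is_derive (f x) 1 (@expR R) (expR (f x)) := is_derive_expR (f x).
elim: k => [|k IH] hf; first exact: (@Ck0_comp R U expR expR f d hf).
exact: (@Ck_comp R k U expR expR f oU d (IH (Ck_pred hf)) hf).
Qed.

Lemma laplacian_exp (m s : R) (x : R * R) :
  laplacian (fun y => expR (m * y.1 + 0 * y.2 + s)) x = m ^+ 2 * expR (m * x.1 + 0 * x.2 + s).
Proof.
have d1 (q t : R) : is_derive t 1 (fun t => m * t + q + s) m.
  by apply: is_derive_eq; rewrite /GRing.scale /=; ring.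
have d2 (q t : R) : is_derive t 1 (fun t => q + 0 * t + s) 0.
  by apply: is_derive_eq; rewrite /GRing.scale /=; ring.
have hl := Ck_linear 2 m 0 s (@openT (R * R)%type).
pose f := fun y : R * R => m * y.1 + 0 * y.2 + s.
have p1 : partial1 f = fun=> m.
  apply/funext => y; have h := is_derive_slice1 (Ck_derivable1 (Ck_pred hl) (Logic.I : setT y)).
  by rewrite -(@derive_val _ _ _ _ _ _ _ h) (@derive_val _ _ _ _ _ _ _ (d1 (0 * y.2) y.1)).
have p2 : partial2 f = fun=> 0.
  apply/funext => y; have h := is_derive_slice2 (Ck_derivable2 (Ck_pred hl) (Logic.I : setT y)).
  by rewrite -(@derive_val _ _ _ _ _ _ _ h) (@derive_val _ _ _ _ _ _ _ (d2 (m * y.1) y.2)).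
have c1 (d : R) : partial1 (fun=> d) = fun=> 0 by apply/funext => y; exact: derive_cst.
have c2 (d : R) : partial2 (fun=> d) = fun=> 0 by apply/funext => y; exact: derive_cst.
have := @laplacian_comp R setT x (@openT _) Logic.I expR expR expR f hl
  (fun y _ => is_derive_expR (f y)) (fun y _ => is_derive_expR (f y)).
rewrite /laplacian p1 p2 c1 c2 => ->; rewrite /f.
move: (expR _) => e; ring.
Qed.

End supersolution.

(** * The three alternatives on the plane *)

Section alternatives.
Context {R : realType}.
Variables (a b : R * R).
Hypothesis hab : lin_indep2 a b.
Notation cs := (cs a b).
Notation ct := (ct a b).
Notation kap := (kap a b).

Variables (I : finType) (P : I -> R * R).
Hypothesis hP : forall i j, i != j -> kap (P i - P j) != 0.
Notation regular_set := (regular_set a b P).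
Notation solves := (solves a b P).

Lemma small_boxes (k0 : R) : 0 < k0 -> exists2 l0 : R, 0 < l0 &
  forall l, 0 < l <= l0 -> [/\ 0 < l < 4^-1, 0 < l <= 1,
    forall i j, i != j -> 32 * pi ^+ 2 * l ^+ 2 < kap (P i - P j) &
    4 * pi ^+ 2 * l ^+ 2 < k0].
Proof.
move=> k00; have [l1 /andP[l10 l14] hl1] := small_box hP.
have pi2 : 0 < (pi : R) ^+ 2 by rewrite exprn_gt0// pi_gt0.
pose l2 := k0 / (8 * pi ^+ 2); have l20 : 0 < l2 by rewrite divr_gt0// mulr_gt0.
exists (Num.min l1 l2); first by rewrite lt_min l10.
move=> l /andP[l0]; rewrite le_min => /andP[h1 h2].
have lq : l ^+ 2 <= l by rewrite expr2 ler_piMl// ?ltW//; lra.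
have l1q : l ^+ 2 <= l1 ^+ 2 by rewrite lerXn2r ?nnegrE// ltW.
split.
- by rewrite l0/=; lra.
- by rewrite l0/=; lra.
- move=> i j ij; apply: le_lt_trans (hl1 _ _ ij).
  by rewrite ler_pM2l// mulr_gt0.
- have h3 : l * (8 * pi ^+ 2) <= k0 by rewrite -ler_pdivlMr// mulr_gt0.
  move: (pi ^+ 2) pi2 h3 => q q0 h3.
  have : q * l ^+ 2 <= q * l by rewrite ler_pM2l.
  have : 0 < q * l by rewrite mulr_gt0.
  by rewrite -mulrA; lra.
Qed.

(** The constant [eta] is a barrier because g is positive where w exceeds it. [g] is quantified
    after [ta], so that the estimate also applies to the reflected nonlinearity. *)
Lemma grid_small_le C0 C1 kappa (c : I -> R) eta k0 : 0 < C0 -> 0 < C1 -> 0 < eta -> 0 < k0 ->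
  exists2 ta : R, 0 < ta & forall g eps w k, tame g C0 kappa -> solves c g eps w ->
    grid_value a b P C1 eps w k -> eps < ta -> `|k| < ta ->
    forall x, regular_set x -> (forall i, c i < 0 -> k0 <= kap (x - P i)) -> w x <= eta.
Proof.
move=> C00 C10 eta0 k00; have [l l0 hl] := small_boxes k00.
have ce := cub_gt0 eta0; pose q := cub eta.
(* A quarter of cub eta is granted to each of |k|, delta and 2 C1 eps; the middle entry is the
   condition C1 eps < l delta for the fixed l. *)
pose ta := Num.min (q / 4) (Num.min (l * (q / 4) / C1) (q / 4 / (2 * C1))).
have q40 : 0 < q / 4 by rewrite divr_gt0.
exists ta; first by rewrite !lt_min q40 !divr_gt0// mulr_gt0.
move=> g eps w k tg sol [k1 hk]; rewrite !lt_min => /andP[_ /andP[e2 e3]] /andP[ka _] x Ux hx.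
have [|h1 h2 h3 h4] := hl l; first by rewrite l0/=.
have hd : C1 * eps < l * (q / 4) by rewrite mulrC -ltr_pdivlMr.
have [s1 [s2 [t1 [t2 [g1 g2 g3 g4 hg]]]]] := hk (q / 4) l h2 hd x.
have hint y : regular_set y -> eta < w y -> laplacian (fun=> eta) y < eps ^- 2 * g (w y).
  move=> _ wy; rewrite laplacian_cst mulr_gt0// ?invr_gt0 ?exprn_gt0 ?(solves_eps sol)//.
  exact: (tame_gt0 C00 tg (lt_trans eta0 wy)).
apply: (box_comparison hab (zeta := fun=> eta) sol (Ck_cst 2 setT eta) h1 h3 _ g1 g2 g3 g4 _ hint Ux).
- by move=> i ci; exact: lt_le_trans h4 (hx i ci).
- move=> y hy _ _; have [_ hwy] := hg y hy.
  apply: cub_le_inv; rewrite -/q.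
  have e3' : eps * (2 * C1) < q / 4 by rewrite -ltr_pdivlMr// mulr_gt0.
  have e3'' : 2 * C1 * eps < q / 4 by rewrite mulrC.
  have := ler_norm (cub (w y) - k); have := ler_norm k; move: hwy ka e3''.
  move: (2 * C1 * eps) (cub (w y)) => A B; lra.
Qed.

Lemma grid_small C0 C1 kappa (c : I -> R) eta k0 : 0 < C0 -> 0 < C1 -> 0 < eta -> 0 < k0 ->
  exists2 ta : R, 0 < ta & forall g eps w k, tame g C0 kappa -> solves c g eps w ->
    grid_value a b P C1 eps w k -> eps < ta -> `|k| < ta ->
    forall x, regular_set x -> (forall i, k0 <= kap (x - P i)) -> `|w x| <= eta.
Proof.
move=> C00 C10 eta0 k00.
have [t1 t10 h1] := grid_small_le kappa c C00 C10 eta0 k00.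
have [t2 t20 h2] := grid_small_le kappa (fun i => - c i) C00 C10 eta0 k00.
exists (Num.min t1 t2); first by rewrite lt_min t10.
move=> g eps w k tg sol gv; rewrite !lt_min => /andP[e1 e2] /andP[k1 k2] x Ux hx.
rewrite ler_norml; apply/andP; split.
- rewrite lerNl; apply: (h2 _ _ _ _ (tameN tg) (solvesN sol) (grid_valueN gv) e2 _ x Ux).
    by rewrite normrN.
  by move=> i _.
- by apply: (h1 _ _ _ _ tg sol gv e1 k1 x Ux) => i _.
Qed.

(** The barrier is - eta exp (m (y.1 - x.1) - L), whose Laplacian is eps^-2 kappa^2 times itself.
    [N * l] bounds [y.1 - x.1] on the box and [L = m * (N * l)], so the exponential is at most 1
    there and the barrier stays above - eta. At x it equals - eta exp (- L), and L = kappa N rho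
    does not involve eps. *)
Lemma grid_negative C0 C1 kappa (c : I -> R) th k0 : 0 < C0 -> 0 < C1 -> 0 < kappa ->
  0 < th -> 0 < k0 ->
  exists2 ta : R, 0 < ta & exists2 nu : R, 0 < nu & forall g eps w k,
    tame g C0 kappa -> solves c g eps w ->
    grid_value a b P C1 eps w k -> eps < ta -> k <= - th ->
    forall x, regular_set x -> (forall i, c i < 0 -> k0 <= kap (x - P i)) -> w x <= - nu.
Proof.
move=> C00 C10 kappa0 th0 k00; have [l0 l00 hl] := small_boxes k00.
(* With delta = th / 4 and 2 C1 eps < th / 4, cub w is at most - th / 2 on the grid lines. The
   choice of [rho] makes l delta = 2 C1 eps, twice the admissible threshold. *)
pose delta := th / 4; have d0 : 0 < delta by rewrite divr_gt0.
pose rho := 2 * C1 / delta; have rho0 : 0 < rho by rewrite divr_gt0// mulr_gt0.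
pose N := `|a.1| + `|b.1|; pose eta := th / 2; pose L := kappa * N * rho.
have eta0 : 0 < eta by rewrite divr_gt0.
exists (Num.min (l0 / rho) (delta / (2 * C1))).
  by rewrite lt_min !divr_gt0// mulr_gt0.
exists (eta * expR (- L)); first by rewrite mulr_gt0// expR_gt0.
move=> g eps w k tg sol [k1 hk]; rewrite lt_min => /andP[e1 e2] kth x Ux hx.
have eps0 := solves_eps sol; have [_ tg2 _] := tg.
pose l := rho * eps; have lp : 0 < l by rewrite mulr_gt0.
have ll0 : l <= l0 by rewrite /l mulrC -ler_pdivlMr// ltW.
have [|h1 h2 h3 h4] := hl l; first by rewrite lp.
have hd : C1 * eps < l * delta.
  have -> : l * delta = 2 * C1 * eps.
    rewrite /l /rho; field; by rewrite gt_eqF.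
  have : 0 < C1 * eps by rewrite mulr_gt0.
  by rewrite -mulrA; lra.
have [s1 [s2 [t1 [t2 [g1 g2 g3 g4 hg]]]]] := hk delta l h2 hd x.
pose m := kappa / eps; pose s := - (m * x.1) - L.
pose zeta y := - eta * expR (m * y.1 + 0 * y.2 + s).
have he : Ck_on 2 setT (fun y : R * R => expR (m * y.1 + 0 * y.2 + s)).
  exact: (Ck_expR (@openT _) (Ck_linear 2 m 0 s (@openT (R * R)%type))).
have hz : Ck_on 2 setT zeta := Ck_scale (- eta) (@openT _) he.
have zx : zeta x = - (eta * expR (- L)).
  by rewrite /zeta mul0r addr0 /s addrA subrr add0r mulNr.
have zneg y : zeta y < 0 by rewrite /zeta mulNr oppr_lt0 mulr_gt0// expR_gt0.
have hint y : regular_set y -> zeta y < w y -> laplacian zeta y < eps ^- 2 * g (w y).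
  move=> _ wy; have -> : laplacian zeta y = eps ^- 2 * (kappa ^+ 2 * zeta y).
    rewrite (@laplacianZ R setT y (@openT _) Logic.I _ _ he) laplacian_exp /zeta.
    rewrite /m; move: (expR _) => e; field; by rewrite gt_eqF.
  have e2p : 0 < eps ^- 2 by rewrite invr_gt0 exprn_gt0.
  rewrite (ltr_pM2l e2p).
  (* For w <= 0 the linear lower bound on g compares it with kappa^2 zeta; for w > 0, g is positive
     and the barrier negative. *)
  have [w0|w0] := leP (w y) 0.
    by apply: lt_le_trans (tg2 _ w0); rewrite ltr_pM2l// exprn_gt0.
  apply: lt_trans (tame_gt0 C00 tg w0).
  by rewrite pmulr_rlt0 ?zneg// exprn_gt0.
rewrite -zx.
apply: (box_comparison hab sol hz h1 h3 _ g1 g2 g3 g4 _ hint Ux).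
- by move=> i ci; exact: lt_le_trans h4 (hx i ci).
- move=> y hy /andP[ya yb] /andP[yc yd]; have [_ hwy] := hg y hy.
  move: g1 g2 g3 g4 => /andP[q1 q2] /andP[q3 q4] /andP[q5 q6] /andP[q7 q8].
  have dist (p q r r' : R) : q - l < r -> r' < q + l -> r <= p -> p <= r' -> `|p - q| <= l.
    by clear => *; rewrite ler_norml; apply/andP; split; lra.
  have dc := dist _ _ _ _ q1 q4 ya yb; have dt := dist _ _ _ _ q5 q8 yc yd.
  have dy : y.1 - x.1 <= N * l.
    have -> : y.1 - x.1 = (cs y - cs x) * a.1 + (ct y - ct x) * b.1.
      rewrite -{1}(pt_cst hab y) -{1}(pt_cst hab x) /= /GRing.scale /=.
      by move: (cs _) (ct _) (cs _) (ct _) => *; ring.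
    apply: le_trans (ler_norm _) _; apply: le_trans (ler_normD _ _) _.
    rewrite !normrM mulrDl [`|a.1| * _]mulrC [`|b.1| * _]mulrC.
    by apply: lerD; rewrite ler_wpM2r.
  have ez : expR (m * y.1 + 0 * y.2 + s) <= 1.
    rewrite -[leRHS](@expR0 R) ler_expR mul0r addr0 /s addrA -mulrBr subr_le0.
    have -> : L = m * (N * l).
      rewrite /L /m /l; field; by rewrite gt_eqF.
    by rewrite ler_pM2l// divr_gt0.
  have h : - eta <= zeta y by rewrite /zeta mulNr lerN2 ler_piMr// ltW.
  apply: le_trans h; apply: cub_le_inv; rewrite cubN.
  (* This converts the bound - th / 2 on cub w into w <= - eta. *)
  have ceta : cub eta <= eta.
    have T0 : 0 <= tanh2 eta by rewrite -tanh20; apply/ltW; rewrite tanh2_ltP.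
    apply: le_trans (tanh2_le_id (ltW eta0)).
    have := tanh2_sqr eta; rewrite /cub => /ltW hT.
    by rewrite exprSr ler_piMl.
  have e2' : eps * (2 * C1) < delta by rewrite -ltr_pdivlMr// mulr_gt0.
  have e2'' : 2 * C1 * eps < delta by rewrite mulrC.
  have := ler_norm (cub (w y) - k); move: hwy e2'' ceta kth; rewrite /delta /eta.
  move: (2 * C1 * eps) (cub (w y)) (cub (th / 2)) => A B D; lra.
Qed.

Lemma grid_positive C0 C1 kappa (c : I -> R) th k0 : 0 < C0 -> 0 < C1 -> 0 < kappa ->
  0 < th -> 0 < k0 ->
  exists2 ta : R, 0 < ta & exists2 nu : R, 0 < nu & forall g eps w k,
    tame g C0 kappa -> solves c g eps w ->
    grid_value a b P C1 eps w k -> eps < ta -> th <= k ->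
    forall x, regular_set x -> (forall i, 0 < c i -> k0 <= kap (x - P i)) -> nu <= w x.
Proof.
move=> C00 C10 kappa0 th0 k00.
have [ta ta0 [nu nu0 h]] := grid_negative (fun i => - c i) C00 C10 kappa0 th0 k00.
exists ta => //; exists nu => // g eps w k tg sol gv ea ka x Ux hx.
rewrite -lerN2; apply: (h _ _ _ _ (tameN tg) (solvesN sol) (grid_valueN gv) ea _ x Ux).
  by rewrite lerN2.
by move=> i; rewrite oppr_lt0; exact: hx.
Qed.

End alternatives.

(** * Passage to the torus *)

Section sequences.
Context {R : realType}.

Lemma increasing_choice (Q : nat -> nat -> Prop) :
  (forall j N, exists2 n, (N <= n)%N & Q j n) ->
  exists sigma : nat -> nat, {homo sigma : m n / (m < n)%N} /\ forall j, Q j (sigma j).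
Proof.
move=> h.
pose F jN := projT1 (cid2 (h jN.1 jN.2)).
have hF jN : (jN.2 <= F jN)%N /\ Q jN.1 (F jN) by rewrite /F; case: (cid2 _).
pose sigma := fix s j := if j is i.+1 then F (i.+1, (s i).+1) else F (0%N, 0%N).
have step j : (sigma j < sigma j.+1)%N by have [] := hF (j.+1, (sigma j).+1).
exists sigma; split; first exact: (homo_ltn ltn_trans step).
by case=> [|j]; [have [_] := hF (0%N, 0%N)|have [_] := hF (j.+1, (sigma j).+1)].
Qed.

(** If |k| is arbitrarily small arbitrarily late, a subsequence tends to 0. Otherwise |k| is
    eventually at least some e, and either k <= - e infinitely often or k >= e from some rank on. *)
Lemma sign_trichotomy (k : nat -> R) : exists sigma : nat -> nat,
  {homo sigma : m n / (m < n)%N} /\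
  [\/ k (sigma j) @[j --> \oo] --> (0 : R),
      exists2 th, 0 < th & forall j, k (sigma j) <= - th
    | exists2 th, 0 < th & forall j, th <= k (sigma j)].
Proof.
have [h|] := pselect (forall e N, 0 < e -> exists2 n, (N <= n)%N & `|k n| < e).
  have [|s [hs hk]] := @increasing_choice (fun j n => `|k n| < j.+1%:R^-1).
    by move=> j N; apply: h; rewrite invr_gt0.
  exists s; split => //; constructor 1.
  apply/cvgrPdist_lt => e e0; near=> j.
  rewrite sub0r normrN (lt_trans (hk j))//.
  by near: j; exact: near_infty_natSinv_lt (PosNum e0).
move=> /existsNP[e /existsNP[N /not_implyP[e0 hN]]].
have hk n : (N <= n)%N -> e <= `|k n|.
  by move=> Nn; rewrite leNgt; apply/negP => h; apply: hN; exists n.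
have [h|] := pselect (forall M, exists2 n, (M <= n)%N & k n <= - e).
  have [|s [hs ks]] := @increasing_choice (fun j n => k n <= - e); first by [].
  by exists s; split => //; constructor 2; exists e.
move=> /existsNP[M hM]; exists (fun j => j + (N + M))%N; split.
  by move=> m n; rewrite ltn_add2r.
constructor 3; exists e => // j.
have Nj : (N <= j + (N + M))%N by rewrite addnCA leq_addr.
have := hk _ Nj.
rewrite ler_normr => /orP[//|h]; exfalso; apply: hM.
exists (j + (N + M))%N.
  by rewrite addnA leq_addl.
by move: h; lra.
Unshelve. all: end_near. Qed.

Lemma limn_esup_le (v : nat -> \bar R) (l : \bar R) :
  (\forall n \near \oo, v n <= l)%E -> (limn_esup v <= l)%E.
Proof.
move=> h; apply: (@le_trans _ _ (ereal_sup [set v n | n in [set n | v n <= l]%E])).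
  by apply: ereal_inf_lbound; exists [set n | v n <= l]%E.
by apply: ub_ereal_sup => _ [n /= hn <-].
Qed.

Lemma limn_einf_ge (v : nat -> \bar R) (l : \bar R) :
  (\forall n \near \oo, l <= v n)%E -> (l <= limn_einf v)%E.
Proof.
move=> h; rewrite -leeN2 -limn_esupN; apply: limn_esup_le.
by apply: filterS h => n /=; rewrite leeN2.
Qed.

End sequences.

(** * The nonlinearity of the equation *)

Section nonlinearity.
Context {R : realType}.
Variable tau : R.
Hypothesis tau0 : 0 < tau.

Lemma nonlinearity_continuous : continuous (nonlinearity tau : R -> R).
Proof.
move=> t; have e1 := @continuous_expR R t.
have c1 : {for t, continuous (fun=> 1 : R)} := @cst_continuous _ _ _ t.
have c2 : {for t, continuous (fun=> tau : R)} := @cst_continuous _ _ _ t.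
have e2 : {for t, continuous (fun s : R => 1 - expR s)} := continuousB c1 e1.
have e3 : {for t, continuous (fun s : R => expR s * (1 - expR s))} := continuousM e1 e2.
have e4 : {for t, continuous (fun s : R => tau + expR s)} := continuousD c2 e1.
have e5 : {for t, continuous (fun s : R => (tau + expR s) ^+ 3)}.
  exact: (continuous_comp e4 (@exprn_continuous _ 3 _)).
have n0 : (tau + expR t) ^+ 3 != 0 by rewrite expf_neq0// gt_eqF// addr_gt0// expR_gt0.
have e6 : {for t, continuous (fun s : R => ((tau + expR s) ^+ 3)^-1)}.
  by apply: continuousV.
have e7 : {for t, continuous (fun s : R => expR s * (1 - expR s) * ((tau + expR s) ^+ 3)^-1)}.
  exact: (continuousM e3 e6).
exact: e7.
Qed.

(** The square of [1 + tau ^- 3] dominates both 1 and tau^-3, the slopes that bound g on the two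
    half-lines. With y = expR t, the first condition reduces, after common factors, to the cube of 1
    / (y + 1) <= (1 + tau) / (tau + y). *)
Lemma nonlinearity_tame :
  tame (fun t => - nonlinearity tau t) (2 * (1 + tau) ^+ 3) (1 + tau ^- 3).
Proof.
have ti : 0 < tau ^- 3 by rewrite invr_gt0 exprn_gt0.
have k1 : 1 <= (1 + tau ^- 3) ^+ 2 by move: (tau ^- 3) ti => q *; nra.
have k2 : tau ^- 3 <= (1 + tau ^- 3) ^+ 2 by move: (tau ^- 3) ti => q *; nra.
have gE t : - nonlinearity tau t = expR t * (expR t - 1) / (tau + expR t) ^+ 3.
  by rewrite /nonlinearity -mulNr -mulrN opprB.
split=> t.
- have : 0 < expR t by exact: expR_gt0.
  rewrite gE /tanh2; move: (expR t) => y y0.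
  have y1 : y + 1 != 0 by rewrite gt_eqF// addr_gt0.
  have y2 : tau + y != 0 by rewrite gt_eqF// addr_gt0.
  have -> : ((y - 1) / (y + 1)) ^+ 2 * ((1 - ((y - 1) / (y + 1)) ^+ 2) / 2) =
      (2 * (y - 1) ^+ 2 * y / (y + 1)) * (y + 1) ^- 3 by field.
  have -> : 2 * (1 + tau) ^+ 3 * ((y - 1) / (y + 1) * (y * (y - 1) / (tau + y) ^+ 3)) =
      (2 * (y - 1) ^+ 2 * y / (y + 1)) * ((1 + tau) / (tau + y)) ^+ 3.
    by field; rewrite y1 y2.
  apply: ler_wpM2l.
    apply: divr_ge0; last by rewrite addr_ge0// ltW.
    by apply: mulr_ge0; [rewrite mulr_ge0 ?sqr_ge0|exact: ltW].
  have d1 : 0 <= (y + 1)^-1 by rewrite invr_ge0 addr_ge0// ltW.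
  have d2 : 0 <= (1 + tau) / (tau + y) by rewrite divr_ge0// addr_ge0// ltW.
  rewrite -exprVn lerXn2r ?nnegrE//.
  rewrite ler_pdivlMr ?addr_gt0// mulrC ler_pdivrMr ?addr_gt0//.
  by have : 0 < tau * y; [rewrite mulr_gt0|nra].
- move=> t0; rewrite gE.
  have y0 := expR_gt0 t; have y1 := expR_ge1Dx t.
  have yt : expR t <= 1 by rewrite -[leRHS](@expR0 R) ler_expR.
  have d0 : 0 < (tau + expR t) ^+ 3 by rewrite exprn_gt0// addr_gt0.
  apply: (@le_trans _ _ (tau ^- 3 * t)); first by rewrite ler_wnM2r.
  have -> : expR t * (expR t - 1) / (tau + expR t) ^+ 3 =
      - (expR t * (1 - expR t) / (tau + expR t) ^+ 3).
    by rewrite -mulNr -mulrN opprB.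
  rewrite lerNr -mulrN; apply: (@le_trans _ _ (- t / (tau + expR t) ^+ 3)).
    rewrite ler_pM2r ?invr_gt0//.
    by move: (expR t) y0 y1 yt => y *; nra.
  rewrite mulrC ler_wpM2r ?oppr_ge0// lef_pV2 ?posrE ?exprn_gt0//.
    by rewrite lerXn2r ?nnegrE ?ltW// ?addr_gt0// ltrDl.
  by rewrite addr_gt0.
- move=> t0; rewrite gE.
  have y0 := expR_gt0 t; have y1 := expR_ge1Dx (- t).
  have yt : 1 <= expR t by rewrite -[leLHS](@expR0 R) ler_expR.
  apply: (@le_trans _ _ t); last by rewrite ler_peMl.
  rewrite expRN in y1.
  have d0 : 0 < (tau + expR t) ^+ 3 by rewrite exprn_gt0// addr_gt0.
  rewrite ler_pdivrMr//.
  have h3 : expR t ^+ 3 <= (tau + expR t) ^+ 3.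
    by rewrite lerXn2r ?nnegrE ?ltW// ?addr_gt0// ltrDr.
  have h4 : expR t - 1 <= t * expR t.
    have : (1 - t) * expR t <= 1 by rewrite -ler_pdivlMr// mul1r.
    by move: (expR t) => y; lra.
  apply: le_trans (ler_wpM2l t0 h3).
  move: (expR t) y0 yt h4 => y y0 yt h4.
  apply: (@le_trans _ _ (y * (t * y))); first by rewrite ler_pM2l.
  have -> : t * y ^+ 3 = (y * (t * y)) * y by ring.
  by rewrite ler_peMr// !mulr_ge0// ltW.
Qed.

End nonlinearity.

(** * The quotient torus *)

Section torus_quotient.
Context {R : realType}.
Variables (a b : R * R).
Hypothesis hab : lin_indep2 a b.
Notation T := (torus a b).
Notation tpi := (torus_pi a b).
Notation kap := (kap a b).
Notation lat := (lat a b).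
Notation cs := (cs a b).
Notation ct := (ct a b).

Lemma torus_reprK (q : T) : tpi (repr q) = q.
Proof. exact: reprK. Qed.

Lemma torus_pi_eq (x y : R * R) : tpi x = tpi y <-> exists m n, y = x + lat m n.
Proof.
split=> [h|h]; first by have /eqmodP/asboolP := h.
by apply/eqmodP/asboolP.
Qed.

Lemma torus_pi_lat x m n : tpi (x + lat m n) = tpi x.
Proof. by apply/esym/torus_pi_eq; exists m, n. Qed.

Lemma torus_pi_continuous : continuous tpi.
Proof. exact: pi_continuous. Qed.

Lemma kap_congr (x y x0 : R * R) : tpi x = tpi y -> kap (x - x0) = kap (y - x0).
Proof. by move=> /torus_pi_eq[m [n ->]]; rewrite addrAC (kap_lat hab). Qed.

Lemma kap_repr_continuous (x0 : R * R) : continuous (fun q : T => kap (repr q - x0)).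
Proof.
apply: (@repr_comp_continuous _ _ _ (fun x : R * R => kap (x - x0))).
  exact: kapB_continuous.
by move=> x y /eqP h; apply/eqP; exact: kap_congr.
Qed.

Lemma kap_torus_eq0 (x y : R * R) : kap (x - y) = 0 -> tpi x = tpi y.
Proof.
by move=> /(kap_eq0 hab)[m [n h]]; rewrite -(subrK y x) h addrC torus_pi_lat.
Qed.

Variables (I : finType) (P : I -> R * R).

(** [kap (x - P i)] descends to a continuous function on the torus that vanishes only at the class
    of [P i], so it has a positive minimum on [K]. The predicate [A] selects the singular points to
    be avoided, which differ from one alternative to another. *)
Lemma compact_kap_ge (K : set T) (A : pred I) : compact K ->
  (forall i, A i -> ~ K (tpi (P i))) ->
  exists2 k0 : R, 0 < k0 & forall x, K (tpi x) -> forall i, A i -> k0 <= kap (x - P i).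
Proof.
move=> cK hA.
have H i : exists k : R, 0 < k /\ forall x, K (tpi x) -> A i -> k <= kap (x - P i).
  have [[q0 Kq0]|hn] := pselect (K !=set0); last first.
    by exists 1; split => // x Kx; exfalso; apply: hn; exists (tpi x).
  have [Ai|nAi] := boolP (A i); last by exists 1.
  have [||q /set_mem Kq hq] := @compact_EVT_min _ R (fun q : T => kap (repr q - P i)) K _ cK.
  - by exists q0.
  - by apply: continuous_subspaceT; exact: kap_repr_continuous.
  exists (kap (repr q - P i)); split.
    rewrite lt_neqAle kap_ge0 andbT; apply/negP => /eqP h.
    by apply: (hA i Ai); rewrite -(kap_torus_eq0 (esym h)) torus_reprK.
  move=> x Kx _; have := hq (tpi x) (mem_set Kx).
  by rewrite (@kap_congr (repr (tpi x)) x)// torus_reprK.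
have [k hk] := boolp.choice H.
exists (\big[Num.min/1]_i k i).
  by apply: lt_bigmin => // i _; have [] := hk i.
move=> x Kx i Ai; apply: le_trans ((hk i).2 x Kx Ai).
exact: bigmin_le.
Qed.

Lemma line_continuous (x : R * R) : continuous (fun t : R => x + (t, 0)).
Proof.
move=> t; have c1 : (fun t : R => x.1 + t) @ t --> x.1 + t.
  by apply: cvgD; [exact: cvg_cst|exact: cvg_id].
have c2 : (fun _ : R => x.2 + 0) @ t --> x.2 + 0 by exact: cvg_cst.
exact: (cvg_pair c1 c2).
Qed.

(* Singular points are limits of regular ones, so bounds pass to them. *)
Lemma bound_by_regular (v : T -> \bar R) (A : pred I) (k0 M : R) : continuous v -> 0 < k0 ->
  (forall x, regular_set a b P x -> (forall i, A i -> k0 / 2 <= kap (x - P i)) ->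
     (v (tpi x) <= M%:E)%E) ->
  forall x, (forall i, A i -> k0 <= kap (x - P i)) -> (v (tpi x) <= M%:E)%E.
Proof.
move=> cv k00 h x hx.
pose ga t : R * R := x + (t, 0).
have ga0 : ga 0 = x by rewrite /ga; apply: pairE; rewrite /= addr0.
have lim (W : topologicalType) (F : R * R -> W) : continuous F -> F (ga t) @[t --> (0 : R)^'] --> F x.
  move=> cF; rewrite -[in F x]ga0; apply: cvg_within_filter.
  by apply: (@continuous_comp _ _ _ ga F); [exact: line_continuous|exact: cF].
have cvga : continuous (fun x => v (tpi x)).
  move=> y; apply: (@continuous_comp _ _ _ tpi v); [exact: torus_pi_continuous|exact: cv].
apply: (@closed_cvg _ _ _ _ (fun t => v (tpi (ga t))) (fun y => (y <= M%:E)%E)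
  (@closed_ereal_ge_ereal R M%:E) _ _ (lim _ _ cvga)).
have nA : \forall t \near (0 : R)^', forall i, A i -> k0 / 2 <= kap (ga t - P i).
  apply: (@filter_forall _ I (fun i t => A i -> k0 / 2 <= kap (ga t - P i))) => i.
  have [Ai|nAi] := boolP (A i); last by apply: nearW.
  have := lim _ _ (@kapB_continuous R a b (P i)) => /cvgr_ge /(_ (k0 / 2)).
  have kk : k0 / 2 < kap (x - P i) by apply: lt_le_trans (hx i Ai); lra.
  by move=> /(_ kk); apply: filterS => t ht _.
have nU : \forall t \near (0 : R)^', regular_set a b P (ga t).
  apply: (@filter_forall _ I (fun i t => kap (ga t - P i) != 0)) => i.
  (* A singular x is left along a horizontal segment: for small nonzero t both coordinates move by
     less than 1, so x + (t, 0) cannot reach another translate of [P i]. *)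
  have [k00'|k0n] := eqVneq (kap (x - P i)) 0; last first.
    exact: (cvgr_neq0 _ (lim _ _ (@kapB_continuous R a b (P i))) k0n).
  have [m [n mn]] := kap_eq0 hab k00'.
  have c1 := lim _ _ (@cs_continuous R a b); have c2 := lim _ _ (@ct_continuous R a b).
  near=> t.
  have t0 : t != 0 by near: t; exact: nbhs_dnbhs_neq.
  have d1 : `|cs x - cs (ga t)| < 1 by near: t; move/cvgrPdist_lt: c1; apply.
  have d2 : `|ct x - ct (ga t)| < 1 by near: t; move/cvgrPdist_lt: c2; apply.
  apply/negP => /eqP hk; have [m' [n' mn']] := kap_eq0 hab hk.
  have E : x - ga t = lat m n - lat m' n'.
    by rewrite -mn -mn' opprB addrA subrK.
  have small (j j' : int) : `|j%:~R - j'%:~R : R| < 1 -> j = j'.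
    rewrite -intrB -intr_norm -[X in _ < X]/(1%:~R) ltr_int; clear => hj; lia.
  have e1 : m = m' by apply: small; rewrite -(cs_lat hab m n) -(cs_lat hab m' n') -csB -E csB.
  have e2 : n = n' by apply: small; rewrite -(ct_lat hab m n) -(ct_lat hab m' n') -ctB -E ctB.
  move: E; rewrite e1 e2 subrr => /eqP; rewrite subr_eq0 => /eqP /(congr1 fst) /= /eqP.
  by rewrite -subr_eq0 opprD addrA subrr add0r oppr_eq0 (negbTE t0).
by near=> t; apply: h; [near: t|near: t].
Unshelve. all: end_near. Qed.

End torus_quotient.

(** * Lifting the solutions to the plane *)

Section transfer.
Context {R : realType}.
Variables (a b : R * R).
Hypothesis hab : lin_indep2 a b.
Notation T := (torus a b).
Notation tpi := (torus_pi a b).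
Notation kap := (kap a b).
Variables (tau : R) (d1 d2 : nat).
Hypothesis tau0 : 0 < tau.
Variables (p1 : 'I_d1 -> T) (p2 : 'I_d2 -> T).
Hypotheses (hp1 : injective p1) (hp2 : injective p2).
Hypothesis hp12 : forall i j, p1 i <> p2 j.
Variables (m1 : 'I_d1 -> R) (m2 : 'I_d2 -> R).
Notation I := ('I_d1 + 'I_d2)%type.

Definition singular_point (i : I) : T := match i with inl j => p1 j | inr j => p2 j end.
Definition singular_lift (i : I) : R * R := repr (singular_point i).
(** The coefficient of ln |x - p|^2 in [u]: positive masses at [p1] send [u] to -oo, those at [p2]
    send it to +oo. *)
Definition signed_mass (i : I) : R := match i with inl j => m1 j | inr j => - m2 j end.
Notation P := singular_lift.
Notation regular_set := (regular_set a b P).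

Lemma torus_singular_lift i : tpi (P i) = singular_point i.
Proof. exact: torus_reprK. Qed.

Lemma singular_lift_separated i j : i != j -> kap (P i - P j) != 0.
Proof.
move=> /eqP ij; apply/negP => /eqP /(kap_torus_eq0 hab).
rewrite !torus_singular_lift; case: i j ij => [i|i] [j|j] //= ij.
- by move=> /hp1 E; apply: ij; rewrite E.
- exact: hp12.
- by move=> /esym; exact: hp12.
- by move=> /hp2 E; apply: ij; rewrite E.
Qed.

Lemma regular_setE : regular_set = tpi @^-1` (~` (range p1 `|` range p2)).
Proof.
apply/seteqP; split=> x /= h.
- case=> -[j _ E].
    have [m [n mn]] : exists m n, x = P (inl j) + lat a b m n.
      by apply/torus_pi_eq; rewrite torus_singular_lift.
    have := h (inl j); rewrite mn addrAC (kap_lat hab) subrr kap0; first by rewrite eqxx.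
  have [m [n mn]] : exists m n, x = P (inr j) + lat a b m n.
    by apply/torus_pi_eq; rewrite torus_singular_lift.
  by have := h (inr j); rewrite mn addrAC (kap_lat hab) subrr kap0 eqxx.
- move=> i; apply/negP => /eqP /(kap_torus_eq0 hab); rewrite torus_singular_lift => E; apply: h.
  by rewrite E; case: i {E} => j; [left|right]; exists j.
Qed.

Variables (eps : R) (u : T -> \bar R).
Hypothesis eps0 : 0 < eps.
Hypothesis hu : is_solution tau p1 p2 m1 m2 eps u.

Lemma solution_solves :
  solves a b P signed_mass (fun t => - nonlinearity tau t) eps (fun x => fine (u (tpi x))).
Proof.
have pw : periodic2 a b (fun x => fine (u (tpi x))) by move=> x m n; rewrite torus_pi_lat.
have sw : smooth_on regular_set (fun x => fine (u (tpi x))).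
  by rewrite regular_setE; exact: sol_smooth hu.
split; [exact: eps0|exact: pw|exact: sw| |].
- move=> x Ux; apply/eqP; rewrite mulrN -addr_eq0; apply/eqP.
  apply: (weak_pointwise hab pw sw (nonlinearity_continuous tau0) _ Ux) => phi sphi pphi phi0.
  (* A periodic test function on the plane descends to the torus through representatives. *)
  have E : (phi \o repr) \o tpi = phi.
    apply/funext => y /=; have : tpi y = tpi (repr (tpi y)) by rewrite torus_reprK.
    by move=> /torus_pi_eq[m [n ->]]; rewrite pphi.
  have := sol_weak hu (phi := phi \o repr); rewrite E => /(_ sphi).
  (* [phi] vanishes at the singular points, so both Dirac sums drop out. *)
  rewrite big1 ?big1 ?mulr0 ?subr0 => [|j _|j _].
  + move=> <-; apply: eq_Rintegral => y _.
    by have := congr1 (fun h => h y) E => /= <-.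
  + by have := phi0 (inr j) => /= h; rewrite h mulr0.
  + by have := phi0 (inl j) => /= h; rewrite h mulr0.
- case=> j; [apply: (sol_log1 hu)|apply: (sol_log2 hu)]; exact: torus_reprK.
Qed.

Lemma regular_solution_fin x : regular_set x -> u (tpi x) \is a fin_num.
Proof. by rewrite regular_setE; exact: (sol_finite hu). Qed.

End transfer.

Theorem theorem1p5 (R : realType) (a b : R * R) (hab : lin_indep2 a b)
    (tau : R) (htau : 0 < tau) (d1 d2 : nat)
    (p1 : 'I_d1 -> torus a b) (p2 : 'I_d2 -> torus a b)
    (hp1 : injective p1) (hp2 : injective p2)
    (hp12 : forall i j, p1 i <> p2 j)
    (m1 : 'I_d1 -> R) (m2 : 'I_d2 -> R)
    (hm1 : forall j, 0 <= m1 j) (hm2 : forall j, 0 <= m2 j)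
    (eps : nat -> R) (heps : forall n, 0 < eps n)
    (heps0 : eps n @[n --> \oo] --> (0 : R))
    (u : nat -> torus a b -> \bar R)
    (hu : forall n, is_solution tau p1 p2 m1 m2 (eps n) (u n)) :
  exists sigma : nat -> nat, {homo sigma : m n / (m < n)%N} /\
  [\/ (forall K : set (torus a b), compact K ->
         K `<=` ~` (range p1 `|` range p2) ->
         {uniform K, (fun n => fine \o u (sigma n)) @ \oo -->
                     ((fun=> 0) : torus a b -> R)}),
      (forall K : set (torus a b), compact K -> K `<=` ~` range p2 ->
         exists nu : R, 0 < nu /\
           (limn_esup (fun n => ereal_sup (u (sigma n) @` K)) <= (- nu)%:E)%E)
    | (forall K : set (torus a b), compact K -> K `<=` ~` range p1 ->
         exists nu : R, 0 < nu /\
           (nu%:E <= limn_einf (fun n => ereal_inf (u (sigma n) @` K)))%E)].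
Proof.
pose c := signed_mass m1 m2.
have hP := singular_lift_separated hab hp1 hp2 hp12.
pose w n x := fine (u n (torus_pi a b x)).
have sol n : solves a b (singular_lift p1 p2) c (fun t => - nonlinearity tau t) (eps n) (w n).
  exact: (solution_solves hab htau (heps n) (hu n)).
have tg := nonlinearity_tame htau.
have C00 : 0 < 2 * (1 + tau) ^+ 3 by rewrite mulr_gt0// exprn_gt0// addr_gt0.
have kappa0 : 0 < 1 + tau ^- 3 by rewrite addr_gt0// invr_gt0 exprn_gt0.
have [C1 C10 gve] := grid_value_exists hab hP c C00 tg.
have [k hk] := boolp.choice (fun n => gve (eps n) (w n) (sol n)).
(* The subsequence is extracted from the grid values alone, before any compact set is given, so it
   serves all of them. *)
have [sigma [hs tri]] := sign_trichotomy k; exists sigma; split => //.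
have sub (Q : nat -> Prop) : (\forall n \near \oo, Q n) -> \forall n \near \oo, Q (sigma n).
  have ge n : (n <= sigma n)%N.
    by elim: n => // n IH; apply: leq_ltn_trans IH (hs _ _ (ltnSn n)).
  by move=> [N _ hN]; exists N => // n /= Nn; apply: hN => /=; exact: leq_trans Nn (ge n).
have heps_lt ta : 0 < ta -> \forall n \near \oo, eps (sigma n) < ta.
  by move=> ta0; apply: (sub (fun n => eps n < ta)); move/cvgr_lt: heps0; apply.
have reg x k0 : 0 < k0 -> (forall i, k0 <= kap a b (x - singular_lift p1 p2 i)) ->
    regular_set a b (singular_lift p1 p2) x.
  by move=> k00 h i; rewrite gt_eqF// (lt_le_trans k00).
have repK q : torus_pi a b (repr q) = q by exact: torus_reprK.
have finE n x : regular_set a b (singular_lift p1 p2) x -> u n (torus_pi a b x) = (w n x)%:E.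
  by move=> Ux; rewrite /w fineK//; exact: (regular_solution_fin hab (hu n) Ux).
case: tri => [k0|[th th0 hth]|[th th0 hth]].
- constructor 1 => K cK hK.
  (* [predT]: here [K] keeps away from every singular point, so all lifts of its points are regular
     and the estimate applies to them directly. *)
  have [|z z0 hz] := @compact_kap_ge R a b hab _ (singular_lift p1 p2) K predT cK.
    move=> i _; rewrite torus_singular_lift => /hK; apply.
    by case: i => j; [left|right]; exists j.
  move=> X /uniform_nbhs[E [entE hE]].
  have [e /= e0 he] : exists2 e : R, 0 < e & [set xy | ball xy.1 e xy.2] `<=` E.
    by move: entE; rewrite -entourage_ballE => -[e /= e0 he]; exists e.
  have e20 : 0 < e / 2 by rewrite divr_gt0.
  have [ta ta0 hta] := grid_small hab hP (1 + tau ^- 3) c C00 C10 e20 z0.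
  have kn : \forall n \near \oo, `|k (sigma n)| < ta.
    by move/cvgrPdist_lt: k0 => /(_ _ ta0); apply: filterS => n; rewrite sub0r normrN.
  rewrite /=; near=> n; apply: hE => q Kq; apply: he.
  rewrite /ball /= sub0r normrN.
  have hx i : z <= kap a b (repr q - singular_lift p1 p2 i).
    by apply: hz => //; rewrite repK.
  have := hta _ _ _ _ tg (sol (sigma n)) (hk (sigma n)) _ _ (repr q) (reg _ _ z0 hx) hx.
  rewrite /w repK => h; apply: (@le_lt_trans _ _ (e / 2)); last by lra.
  by apply: h; near: n; [exact: heps_lt|exact: kn].
- constructor 2 => K cK hK.
  (* [c i < 0] selects the points of [p2] with positive mass, the only ones where [u] tends to +oo;
     [K] may contain points of [p1]. *)
  have [|z z0 hz] := @compact_kap_ge R a b hab _ (singular_lift p1 p2) K (fun i => c i < 0) cK.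
    move=> [j|j]; rewrite torus_singular_lift /c /=; first by rewrite ltNge hm1.
    by move=> _ /hK; apply; exists j.
  (* [bound_by_regular] asks for the estimate at regular points under half the lower bound on
     [kap]. *)
  have z20 : 0 < z / 2 by rewrite divr_gt0.
  have [ta ta0 [nu nu0 hnu]] := grid_negative hab hP c C00 C10 kappa0 th0 z20.
  exists nu; split => //; apply: limn_esup_le; near=> n.
  have en : eps (sigma n) < ta by near: n; exact: heps_lt.
  apply: ub_ereal_sup => _ [q Kq <-]; rewrite -(repK q).
  apply: (bound_by_regular (P := singular_lift p1 p2) (A := fun i => c i < 0) hab
    (sol_continuous (hu (sigma n))) z0) => [x Ux hx|i ci].
    rewrite (finE _ _ Ux) lee_fin.
    exact: (hnu _ _ _ _ tg (sol (sigma n)) (hk (sigma n)) en (hth n) x Ux hx).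
  by apply: (hz _ _ _ ci); rewrite repK.
- constructor 3 => K cK hK.
  have [|z z0 hz] := @compact_kap_ge R a b hab _ (singular_lift p1 p2) K (fun i => 0 < c i) cK.
    move=> [j|j]; rewrite torus_singular_lift /c /=; last by rewrite oppr_gt0 ltNge hm2.
    by move=> _ /hK; apply; exists j.
  have z20 : 0 < z / 2 by rewrite divr_gt0.
  have [ta ta0 [nu nu0 hnu]] := grid_positive hab hP c C00 C10 kappa0 th0 z20.
  exists nu; split => //; apply: limn_einf_ge; near=> n.
  have en : eps (sigma n) < ta by near: n; exact: heps_lt.
  apply: le_ereal_inf_tmp => _ [q Kq <-]; rewrite -(repK q).
  (* The lower bound on [u] is an upper bound on [- u], to which the passage from regular to
     singular points applies. *)
  have cv : continuous (fun q => - u (sigma n) q)%E.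
    move=> y; apply: (@continuous_comp _ _ _ (u (sigma n)) -%E).
      exact: (sol_continuous (hu (sigma n))).
    exact: oppe_continuous.
  rewrite -leeN2; apply: (bound_by_regular (P := singular_lift p1 p2) (A := fun i => 0 < c i) hab cv z0
    (M := - nu)) => [x Ux hx|i ci].
    rewrite (finE _ _ Ux) -EFinN lee_fin lerN2.
    exact: (hnu _ _ _ _ tg (sol (sigma n)) (hk (sigma n)) en (hth n) x Ux hx).
  by apply: (hz _ _ _ ci); rewrite repK.
Unshelve. all: end_near. Qed.
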